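(* Consider the thinned stochastic volatility model $X_{it}^{(n)}=\sigma_{it}^{(n)}Z_{it}$ described in the context, and let $\mathbf X=\mathbf X_n=(X^{(n)}_{it})_{i=1,\ldots,p;\,t=1,\ldots,n}$, $\mathbf S=\mathbf X\mathbf X'$, and $\mathbf Y=\mathbf A^{1/2}\mathbf X$, so that $\mathbf Y\mathbf Y'=\mathbf A^{1/2}\mathbf S\mathbf A^{1/2}$. Assume the following. (1) For some $\alpha\in(0,2)\cup(2,4)$, constants $q_+,q_-\ge 0$ with $q_++q_-=1$ and a slowly varying function $L$, one has $\mathbb P(Z>x)\sim q_+L(x)x^{-\alpha}$ and $\mathbb P(Z<-x)\sim q_-L(x)x^{-\alpha}$ as $x\to\infty$; moreover $\mathbb E[Z]=0$ if $\mathbb E[|Z|]<\infty$. (2) $p=p_n\to\infty$ is an integer sequence of the form $p_n=n^{\beta}\ell(n)$, $n\ge 1$, where $\ell$ is a slowly varying function and $\beta\in(0,1]$. (3) For given $m\ge1$ and $0=s_0<s_1<\cdots<s_m<\infty$, $\mathbb P(\sigma^{(n)}=s_i)=q_i^{(n)}$ for $i=0,\ldots,m$ and $n\ge1$ (with $\sum_{i=0}^mq_i^{(n)}=1$), $\lim_{n\to\infty}q_0^{(n)}=1$, and the limits $\lim_{n\to\infty}n\,q_i^{(n)}>0$, $i=1,\ldots,m$, exist (finite or infinite). (4) $\mathbf A=\mathbf A_n$ is a sequence of deterministic, (symmetric) positive definite $p\times p$ matrices with uniformly bounded spectra, i.e. $\sup_n\|\mathbf A_n\|_2<\infty$. Then,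 as $n\to\infty$, $$b_n^{-2}\max_{i=1,\ldots,p}\big|\lambda_i(\mathbf A^{1/2}\mathbf S\mathbf A^{1/2})-\lambda_i(\operatorname{diag}(\mathbf S)\mathbf A)\big|\stackrel{\mathbb P}{\rightarrow}0.$$
   Context: Thinned stochastic volatility model: $(Z_{it})_{i,t\ge1}$ is a field of iid real random variables with generic element $Z$; for each $n\ge1$, $(\sigma^{(n)}_{it})_{i,t\ge1}$ is a field of iid non-negative random variables with generic element $\sigma^{(n)}$, independent of $(Z_{it})$; and $X_{it}^{(n)}=\sigma_{it}^{(n)}Z_{it}$. $(b_n)$ is a sequence of positive numbers such that $n\,p\,\mathbb E[(\sigma^{(n)})^\alpha]\,\mathbb P(|Z|>b_n)\to1$ as $n\to\infty$. $\mathbf A^{1/2}$ is the symmetric positive definite square root of $\mathbf A$. $\|\mathbf C\|_2$ is the spectral norm and $\operatorname{diag}(\mathbf C)$ the diagonal matrix with the same diagonal as $\mathbf C$. $\lambda_1(\mathbf C)\ge\cdots\ge\lambda_p(\mathbf C)$ denote the ordered eigenvalues of a $p\times p$ matrix $\mathbf C$ with real eigenvalues; the matrix $\operatorname{diag}(\mathbf S)\mathbf A$ has real non-negative eigenvalues, namely those of $\mathbf A^{1/2}\operatorname{diag}(\mathbf S)\mathbf A^{1/2}$. *)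

(* Defs.v *)
From HB Require Import structures.
From mathcomp Require Import all_boot all_order all_algebra.
From mathcomp Require Import all_classical all_reals all_analysis.

Set Implicit Arguments.
Unset Strict Implicit.
Unset Printing Implicit Defensive.

Import Order.TTheory GRing.Theory Num.Theory.
Import numFieldNormedType.Exports.

Local Open Scope classical_set_scope.
Local Open Scope ring_scope.

Section Matrices.
Variable R : realType.

Definition posdefmx n (A : 'M[R]_n) : Prop :=
  A^T = A /\ forall x : 'cV[R]_n, x != 0 -> 0 < (x^T *m A *m x) 0 0.

(* The symmetric positive definite square root of A; junk value 0 when A has
   none, i.e. when A is not symmetric positive definite. *)
Definition sqrtmx n (A : 'M[R]_n) : 'M[R]_n :=
  xget 0 [set B : 'M[R]_n | posdefmx B /\ B *m B = A].

Definition diagpart n (C : 'M[R]_n) : 'M[R]_n := diag_mx (\row_i C i i).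

(* The eigenvalues of C in non-increasing order, repeated according to their
   algebraic multiplicity; junk value [::] when they are not all real. *)
Definition eigenvalues n (C : 'M[R]_n) : seq R :=
  xget [::] [set s : seq R | sorted >=%R s /\
                             char_poly C = \prod_(x <- s) ('X - x%:P)].

(* lambda C i is the (i+1)-st largest eigenvalue of C. *)
Definition lambda n (C : 'M[R]_n) (i : 'I_n) : R := (eigenvalues C)`_i.

Definition norm2 n (x : 'cV[R]_n) : R := Num.sqrt (\sum_i x i 0 ^+ 2).

Definition spectral_norm n (C : 'M[R]_n) : R :=
  sup [set norm2 (C *m x) | x in [set x : 'cV[R]_n | norm2 x <= 1]].

Lemma eigenvaluesE n (C : 'M[R]_n) (s : seq R) :
  sorted >=%R s -> char_poly C = \prod_(x <- s) ('X - x%:P) ->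
  eigenvalues C = s.
Proof.
move=> s_sorted Cs; apply: xget_unique => // t [t_sorted Ct].
apply: (sorted_eq ge_trans ge_anti) => //.
by apply: prod_XsubC_eq; rewrite -Cs -Ct.
Qed.

End Matrices.

(* Slow variation at infinity, for functions that need only be measurable and
   positive on some half-line. *)
Definition slowly_varying (R : realType) (L : R -> R) : Prop :=
  (exists a : R, measurable_fun `[a, +oo[ L /\ forall x, a <= x -> 0 < L x) /\
  forall c : R, 0 < c -> L (c * x) / L x @[x --> +oo] --> (1 : R).

Section RandomFields.
Context (d : measure_display) (T : measurableType d) (R : realType)
  (P : probability T R).

Definition identically_distributed (I : Type) (X : I -> {RV P >-> R}) : Prop :=
  forall (i j : I) (B : set R), measurable B ->
    distribution P (X i) B = distribution P (X j) B.

Definition mutually_independent (I : choiceType) (X : I -> {RV P >-> R}) : Prop :=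
  forall (J : seq I) (B : I -> set R), uniq J ->
    (forall i, measurable (B i)) ->
    P (\bigcap_(i in [set` J]) (X i @^-1` B i)) =
    (\prod_(i <- J) P (X i @^-1` B i))%E.

Definition iid (I : choiceType) (X : I -> {RV P >-> R}) : Prop :=
  mutually_independent X /\ identically_distributed X.

Definition sigma_of (I : Type) (X : I -> {RV P >-> R}) : set (set T) :=
  <<s \bigcup_i preimage_set_system setT (X i) measurable >>.

Definition independent_fields (I J : Type)
    (X : I -> {RV P >-> R}) (Y : J -> {RV P >-> R}) : Prop :=
  forall E F : set T, sigma_of X E -> sigma_of Y F ->
    P (E `&` F) = (P E * P F)%E.

Definition cvg_in_probability (W : nat -> T -> R) (c : R) : Prop :=
  forall e : R, 0 < e -> P [set w | e < `|W n w - c|] @[n --> \oo] --> 0%E.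

(* The p x n matrix with entries sigma_it Z_it; the row and column indices
   i, t >= 1 of the fields are shifted to start from 0. *)
Definition sv_matrix (sigma Z : nat * nat -> {RV P >-> R}) (p n : nat) (w : T) :
    'M[R]_(p, n) :=
  \matrix_(i < p, t < n)
    (sigma (val i, val t) w * Z (val i, val t) w).

End RandomFields.

(* Main.v *)
Require Import Defs.
From mathcomp Require Import all_boot all_order all_algebra.
From mathcomp Require Import all_classical all_reals all_analysis.
From mathcomp Require Import measurable_realfun complex.
From mathcomp Require Import ring lra zify.

Set Implicit Arguments.
Unset Strict Implicit.
Unset Printing Implicit Defensive.

Import Order.TTheory GRing.Theory Num.Theory.
Import numFieldNormedType.Exports.

Local Open Scope classical_set_scope.
Local Open Scope ring_scope.

(** Write B for the square root of A, and let Q be the probability that a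
volatility is non-zero, so that N = n p Q is the mean number of non-zero entries
of X.

The theorem reduces to a bound on the off-diagonal part of S = X X'. The matrix
diag(S) A is similar to B diag(S) B, so both spectra belong to symmetric
matrices, and Weyl's inequality bounds every difference of ordered eigenvalues
by the norm of B (S - diag(S)) B, hence by the norm of A times that of
S - diag(S): this is [eigenvalue_perturbation]. It remains to show that
S - diag(S) has norm o(b_n^2) in probability.

Orders of magnitude. The normalization makes N P(|Z| > b_n) bounded, so the
regular variation of the tail gives N <= b^kappa eventually for every
kappa > alpha ([nonzero_entries_le]). As n Q stays away from zero, p is bounded
by a multiple of N; as p <= n^(1 + o(1)), also (p Q)^2 = N (p / n) Q <= b^kappa
([rows_le], [row_density_sqr_le]). On the other side, a moment of order
gamma < alpha of an entry is at most C Q ([thinned_moment_le]): thinning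
multiplies every moment by Q.

For alpha < 2, no entry exceeds tau = b^(1 + delta) with high probability. After
truncation at tau the mean squared Frobenius norm of the off-diagonal part is
computed by independence of the entries, and it is b^4 times a negative power
of b ([offdiag_bound_light], [offdiag_small_light]).

For 2 < alpha < 4 the Frobenius norm alone may be too large, since it adds up p
eigenvalues. The entries are truncated at tau = b^(1 - delta) and recentred,
which splits X into bounded centred entries F and a remainder H of small
variance; the off-diagonal part of X X' is the sum of those of F F', F H' and
H X'. The last two are small in Frobenius norm. For the first one, the trace of
an even power h is a sum over closed walks, only the walks visiting each entry
at least twice contribute, and counting them bounds its mean by a constant
times p tau^(2 h) ([trace_moment_le]). As tau^2 is smaller than b^2 by a power
of b, a large h absorbs the factor p ([offdiag_bound_heavy],
[offdiag_small_heavy]).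

Two facts of a different nature are needed. The probability in the conclusion
is that of an event, so the ordered eigenvalues must be random variables
([measurable_lambda]). And slowly varying functions must be dominated by powers
([slowly_varying_le]), which rests on the uniform convergence theorem for
measurable slowly varying functions. *)

(** * Spectral theory of real symmetric matrices *)

Section SymmetricMatrices.
Variable R : realType.

Definition dotrow n (x y : 'rV[R]_n) : R := (x *m y^T) 0 0.

Lemma dotrowE n (x y : 'rV[R]_n) : dotrow x y = \sum_j x 0 j * y 0 j.
Proof. by rewrite /dotrow mxE; apply: eq_bigr => j _; rewrite !mxE. Qed.

Lemma mul_row_tr n (x y : 'rV[R]_n) : x *m y^T = (dotrow x y)%:M.
Proof. by rewrite [LHS]mx11_scalar. Qed.

Lemma dotrowZ n c (x : 'rV[R]_n) : dotrow (c *: x) (c *: x) = c ^+ 2 * dotrow x x.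
Proof.
by rewrite !dotrowE mulr_sumr; apply: eq_bigr => j _; rewrite !mxE; ring.
Qed.

Lemma dotrow_ge0 n (x : 'rV[R]_n) : 0 <= dotrow x x.
Proof. by rewrite dotrowE sumr_ge0 // => j _; rewrite -expr2 sqr_ge0. Qed.

Lemma dotrow_eq0 n (x : 'rV[R]_n) : (dotrow x x == 0) = (x == 0).
Proof.
apply/eqP/eqP => [|->]; last by rewrite /dotrow mul0mx mxE.
rewrite dotrowE => /eqP; rewrite psumr_eq0 => [/allP x0|j _]; last first.
  by rewrite -expr2 sqr_ge0.
apply/rowP => j; rewrite mxE.
by have := x0 j (mem_index_enum _); rewrite -expr2 sqrf_eq0 => /eqP.
Qed.

Lemma dotrow_gt0 n (x : 'rV[R]_n) : x != 0 -> 0 < dotrow x x.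
Proof. by rewrite lt0r dotrow_ge0 dotrow_eq0 => ->. Qed.

(** Let a + i b be a complex eigenvalue of M. Then (M - a)^2 + b^2 is singular,
already over the reals; a real null vector v of it satisfies
|v (M - a)|^2 + b^2 |v|^2 = 0, so v is an eigenvector of M. *)
Lemma sym_eigenvector n (M : 'M[R]_n.+1) : M^T = M ->
  exists a (v : 'rV[R]_n.+1), v != 0 /\ v *m M = a *: v.
Proof.
move=> Msym.
pose f := real_complex R; pose MC := map_mx f M.
have [c] : exists c, root (char_poly MC) c.
  by apply/closed_rootP; rewrite size_char_poly.
rewrite -eigenvalue_root_char => /eigenvalueP[w wM w0].
pose a : R := complex.Re c; pose b : R := complex.Im c.
pose N := M - a%:M.
have Nsym : N^T = N by rewrite /N linearB /= Msym tr_scalar_mx.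
have cE : c = f a + 'i%C * f b by rewrite [LHS]complexE.
have wN : w *m map_mx f N = ('i%C * f b) *: w.
  rewrite /N map_mxB map_scalar_mx mulmxBr wM mul_mx_scalar cE scalerDl.
  by rewrite addrC addKr.
have /eqP/det0P[v v0 vN] : \det (N *m N + (b ^+ 2)%:M) = 0.
  apply: (@fmorph_inj _ _ f); rewrite rmorph0 -det_map_mx; apply/eqP/det0P.
  exists w => //; rewrite map_mxD map_mxM map_scalar_mx mulmxDr mulmxA wN.
  rewrite -scalemxAl wN scalerA mul_mx_scalar -scalerDl -expr2 exprMn sqr_i.
  by rewrite rmorphXn /= mulN1r addNr scale0r.
have : dotrow (v *m N) (v *m N) + b ^+ 2 * dotrow v v = 0.
  have : (v *m (N *m N + (b ^+ 2)%:M) *m v^T) 0 0 = 0 by rewrite vN mul0mx mxE.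
  rewrite mulmxDr mulmxDl mxE mul_mx_scalar -scalemxAl.
  rewrite [X in _ + X]mxE => <-; congr (_ + _).
  by rewrite /dotrow trmx_mul Nsym !mulmxA.
have b2 : 0 <= b ^+ 2 * dotrow v v.
  by apply: mulr_ge0; [exact: sqr_ge0|exact: dotrow_ge0].
move=> /eqP; rewrite paddr_eq0 ?dotrow_ge0 //.
rewrite dotrow_eq0 /N mulmxBr subr_eq0 => /andP[/eqP vM _].
by exists a, v; split=> //; rewrite vM mul_mx_scalar.
Qed.

(** The reflection along v - e exchanges the unit vectors e and v. It moves an
eigenvector to the first axis, which splits off one dimension in the
diagonalization of a symmetric matrix. *)
Lemma householder n (v : 'rV[R]_(1 + n)) : dotrow v v = 1 ->
  exists H : 'M[R]_(1 + n), [/\ H^T = H, H *m H = 1%:M &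
    row_mx 1%:M 0 *m H = v].
Proof.
move=> v1; pose e : 'rV[R]_(1 + n) := row_mx 1%:M 0.
have e1 : dotrow e e = 1.
  by rewrite /dotrow tr_row_mx mul_row_col trmx1 mulmx1 mul0mx addr0 mxE eqxx.
have [->|ve] := eqVneq v e.
  by exists 1%:M; rewrite trmx1 !mulmx1.
have [u uE] : exists u, u = v - e by exists (v - e).
have u0 : u != 0 by rewrite uE subr_eq0.
have uu := dotrow_gt0 u0.
have uuE : dotrow u u = - (2 * dotrow e u).
  have Dl x y z : dotrow (x - y) z = dotrow x z - dotrow y z :> R.
    by rewrite /dotrow mulmxBl !mxE.
  have Dr x y z : dotrow x (y - z) = dotrow x y - dotrow x z :> R.
    by rewrite /dotrow linearB /= mulmxBr !mxE.
  have C : dotrow v e = dotrow e v.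
    by rewrite !dotrowE; apply: eq_bigr => j _; rewrite mulrC.
  by rewrite uE !Dl !Dr v1 e1 C; ring.
have [c cE] : exists c, c * dotrow u u = 2.
  by exists (2 / dotrow u u); rewrite divfK // lt0r_neq0.
exists (1%:M - c *: (u^T *m u)); split.
- by rewrite linearB /= linearZ /= trmx1 trmx_mul trmxK.
- rewrite mulmxBl mul1mx mulmxBr mulmx1 -!scalemxAl -!scalemxAr.
  rewrite !mulmxA -(mulmxA u^T) mul_row_tr mul_mx_scalar -!scalemxAl !scalerA.
  by rewrite cE mulr_natr -scalerMnl mulr2n opprB addrK subrK.
- rewrite mulmxBr mulmx1 -scalemxAr mulmxA mul_row_tr mul_scalar_mx scalerA.
  have -> : c * dotrow e u = -1.
    apply: (mulfI (_ : -2 != 0 :> R)); first by rewrite oppr_eq0 pnatr_eq0.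
    by rewrite mulrN1 opprK -[RHS]cE uuE; ring.
  by rewrite scaleN1r opprK uE addrC subrK.
Qed.

Lemma spectral_sym n (M : 'M[R]_n) : M^T = M ->
  exists (U : 'M[R]_n) (d : 'rV[R]_n),
    U *m U^T = 1%:M /\ M = U^T *m diag_mx d *m U.
Proof.
elim: n M => [|n IH]; last rewrite -[n.+1]/(1 + n)%N; move=> M Msym.
  by exists 1%:M, 0; split; apply/matrixP; case.
have [a [v0 [v0n0 v0M]]] := @sym_eigenvector n M Msym.
pose v := (Num.sqrt (dotrow v0 v0))^-1 *: v0.
have v1 : dotrow v v = 1.
  rewrite /v dotrowZ exprVn sqr_sqrtr ?dotrow_ge0 // mulVf //.
  by rewrite lt0r_neq0 // dotrow_gt0.
have vM : v *m M = a *: v by rewrite /v -scalemxAl v0M !scalerA mulrC.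
have [H [Hsym HH eH]] := @householder n v v1.
pose W : 'M[R]_(1 + n) := H *m M *m H.
have Wsym : W^T = W by rewrite /W !trmx_mul Hsym Msym mulmxA.
have eW : usubmx W = row_mx a%:M 0.
  have -> : usubmx W = row_mx 1%:M 0 *m W.
    by rewrite -[W in RHS]vsubmxK mul_row_col mul1mx mul0mx addr0.
  rewrite /W !mulmxA eH vM -eH -scalemxAl -mulmxA HH mulmx1 scale_row_mx.
  by rewrite scaler0 scale_scalar_mx mulr1.
have Wur : ursubmx W = 0 by rewrite /ursubmx eW row_mxKr.
have Wul : ulsubmx W = a%:M by rewrite /ulsubmx eW row_mxKl.
have Wdl : dlsubmx W = 0 by rewrite -[LHS]trmxK trmx_dlsub Wsym Wur trmx0.
have /IH[U [d [UU dE]]] : (drsubmx W)^T = drsubmx W.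
  by rewrite trmx_drsub Wsym.
have WE : W = block_mx a%:M 0 0 (drsubmx W).
  by rewrite -[LHS]submxK Wur Wul Wdl.
exists (block_mx 1%:M 0 0 U *m H), (row_mx a%:M d); split.
  rewrite trmx_mul Hsym mulmxA -(mulmxA _ H H) HH mulmx1 tr_block_mx.
  rewrite mulmx_block !trmx0 trmx1 !mulmx0 !mul0mx mulmx1 !addr0 add0r UU.
  by rewrite -scalar_mx_block.
have diagE : diag_mx (row_mx a%:M d) = block_mx a%:M 0 0 (diag_mx d).
  rewrite diag_mx_row; congr block_mx; apply/matrixP => i j.
  by rewrite !ord1 !mxE eqxx.
rewrite diagE trmx_mul Hsym tr_block_mx !trmx0 trmx1 !mulmxA.
have -> : M = H *m W *m H.
  by rewrite /W !mulmxA HH mul1mx -mulmxA HH mulmx1.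
congr (_ *m H); rewrite -!mulmxA; congr (H *m _).
rewrite !mulmx_block !mulmx0 !mul0mx mulmx1 mul1mx !addr0 !add0r.
by rewrite !mulmx0 mulmxA -dE.
Qed.

Definition qform n (M : 'M[R]_n) (x : 'rV[R]_n) : R := (x *m M *m x^T) 0 0.

Lemma qform_diag n (d x : 'rV[R]_n) :
  qform (diag_mx d) x = \sum_j d 0 j * x 0 j ^+ 2.
Proof.
rewrite /qform mxE; apply: eq_bigr => j _.
by rewrite mul_mx_diag !mxE; ring.
Qed.

Lemma qform_conj n (U M : 'M[R]_n) x :
  qform (U^T *m M *m U) x = qform M (x *m U^T).
Proof. by rewrite /qform trmx_mul trmxK !mulmxA. Qed.

Lemma qform_spectral n (U M : 'M[R]_n) d x : M = U^T *m diag_mx d *m U ->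
  qform M x = \sum_j d 0 j * (x *m U^T) 0 j ^+ 2.
Proof. by move=> ->; rewrite qform_conj qform_diag. Qed.

Lemma dotrow_orthogonal n (U : 'M[R]_n) (x : 'rV[R]_n) : U *m U^T = 1%:M ->
  dotrow (x *m U^T) (x *m U^T) = dotrow x x.
Proof.
by move=> /mulmx1C UU; rewrite /dotrow trmx_mul trmxK mulmxA -(mulmxA x) UU mulmx1.
Qed.

(** Stated with one-sided inverses, it serves orthogonal matrices and invertible
ones alike. *)
Lemma char_poly_similar n (U V M : 'M[R]_n) : V *m U = 1%:M ->
  char_poly (V *m M *m U) = char_poly M.
Proof.
move=> VU; rewrite /char_poly /char_poly_mx.
have pVU : map_mx polyC V *m map_mx polyC U = 1%:M.
  by rewrite -map_mxM VU map_scalar_mx rmorph1.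
have -> : 'X%:M - map_mx polyC (V *m M *m U) =
    map_mx polyC V *m ('X%:M - map_mx polyC M) *m map_mx polyC U.
  rewrite mulmxBr mulmxBl !map_mxM; congr (_ - _).
  by rewrite mul_mx_scalar -scalemxAl pVU scalemx1.
by rewrite !det_mulmx mulrAC -det_mulmx pVU det1 mul1r.
Qed.

(** The eigenvalues are defined through the characteristic polynomial. Sorting the
diagonal of an arbitrary spectral decomposition turns it into lambda M, and from
then on the spectral theorem can be used with lambda M itself. *)
Lemma spectral_lambda n (M : 'M[R]_n) : M^T = M -> exists U : 'M[R]_n,
  [/\ U *m U^T = 1%:M, M = U^T *m diag_mx (\row_i lambda M i) *m U &
     forall i j : 'I_n, (i <= j)%N -> lambda M j <= lambda M i].
Proof.
move=> /spectral_sym[U [d [UU ME]]].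
pose s := sort >=%R (codom (d 0)).
have ss : sorted >=%R s by apply: sort_sorted => x y; exact: le_total.
have sz : size s = n by rewrite size_sort size_codom card_ord.
have eigM : eigenvalues M = s.
  apply: eigenvaluesE => //; rewrite ME char_poly_similar; last exact: mulmx1C.
  rewrite char_poly_trig ?diag_mx_is_trig //.
  rewrite (perm_big (codom (d 0))) ?perm_sort //= /codom big_image.
  by apply: eq_bigr => i _; rewrite mxE eqxx.
have lamE i : lambda M i = s`_i by rewrite /lambda eigM.
have /perm_iotaP : perm_eq s (codom (d 0)) by rewrite perm_sort.
move=> /(_ 0)[r rP sE].
have szr : size r = n by rewrite (perm_size rP) size_iota size_codom card_ord.
have r_lt (i : 'I_n) : (nth 0 r i < n)%N.
  have : nth 0%N r i \in r by rewrite mem_nth // szr.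
  by rewrite (perm_mem rP) mem_iota size_codom card_ord add0n => /andP[].
pose f i := Ordinal (r_lt i).
have f_inj : injective f.
  move=> i j [] /eqP; rewrite nth_uniq ?szr // ?(perm_uniq rP) ?iota_uniq //.
  by move=> /eqP /val_inj.
have df i : d 0 (f i) = lambda M i.
  rewrite lamE sE (nth_map 0%N) ?szr //.
  rewrite -[nth 0%N r i]/(val (f i)) codomE (nth_map (f i)) ?size_enum_ord ?ltn_ord //.
  by rewrite nth_ord_enum.
exists (rowsub f U); split.
- apply/matrixP => i j; rewrite !mxE.
  transitivity ((U *m U^T) (f i) (f j)).
    by rewrite mxE; apply: eq_bigr => k _; rewrite !mxE.
  by rewrite UU !mxE (inj_eq f_inj).
- rewrite [LHS]ME; apply/matrixP => i j; rewrite !mul_mx_diag !mxE.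
  rewrite (reindex_inj f_inj) /=; apply: eq_bigr => k _.
  by rewrite !mxE df.
- move=> i j ij; rewrite !lamE; apply: (sorted_leq_nth ge_trans ge_refl) => //.
  + by rewrite inE sz.
  + by rewrite inE sz.
Qed.

(** Weyl's inequality, by the Courant-Fischer argument: by dimension, some x <> 0
is orthogonal to the eigenvectors of N of index below i and to those of M of
index above i. For this x the form of M is at least lambda M i, and that of N at
most lambda N i. *)
Lemma lambda_le n (M N : 'M[R]_n) (e : R) : M^T = M -> N^T = N ->
  (forall x, qform M x <= qform N x + e * dotrow x x) ->
  forall i, lambda M i <= lambda N i + e.
Proof.
move=> /spectral_lambda[U [UU ME Ud]] /spectral_lambda[V [VV NE Vd]] MN i.
(* Column i of W vanishes; the other columns are the n - 1 constraints on x. *)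
pose W := \matrix_(k, j) (if (j < i)%N then V^T k j else
                          if (i < j)%N then U^T k j else 0).
have /eqP/det0P[x x0 xW] : \det W = 0.
  rewrite -det_tr; apply/eqP/det0P; exists (delta_mx 0 i).
    by apply/eqP => /rowP/(_ i)/eqP; rewrite !mxE !eqxx oner_eq0.
  by apply/rowP => j; rewrite -rowE !mxE ltnn.
have xU (j : 'I_n) : (i < j)%N -> (x *m U^T) 0 j = 0.
  move=> ij; move/rowP: xW => /(_ j); rewrite [in RHS]mxE => <-; rewrite !mxE.
  by apply: eq_bigr => k _; rewrite !mxE ij ltnNge ltnW.
have xV (j : 'I_n) : (j < i)%N -> (x *m V^T) 0 j = 0.
  move=> ij; move/rowP: xW => /(_ j); rewrite [in RHS]mxE => <-; rewrite !mxE.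
  by apply: eq_bigr => k _; rewrite !mxE ij.
have := MN x; rewrite (qform_spectral _ ME) (qform_spectral _ NE) => le_x.
have leM : lambda M i * dotrow x x <=
    \sum_j (\row_i lambda M i) 0 j * (x *m U^T) 0 j ^+ 2.
  rewrite -(dotrow_orthogonal x UU) dotrowE mulr_sumr; apply: ler_sum => j _.
  rewrite [X in _ <= X * _]mxE -expr2.
  have [ij|ji] := ltnP i j; first by rewrite xU // expr0n !mulr0.
  by rewrite ler_wpM2r ?sqr_ge0 ?Ud.
have leN : \sum_j (\row_i lambda N i) 0 j * (x *m V^T) 0 j ^+ 2 <=
    lambda N i * dotrow x x.
  rewrite -(dotrow_orthogonal x VV) dotrowE mulr_sumr; apply: ler_sum => j _.
  rewrite [X in X * _ <= _]mxE -expr2.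
  have [ji|ij] := ltnP j i; first by rewrite xV // expr0n !mulr0.
  by rewrite ler_wpM2r ?sqr_ge0 ?Vd.
rewrite -(ler_pM2r (dotrow_gt0 x0)) mulrDl.
by apply: (le_trans leM); apply: (le_trans le_x); rewrite lerD2r.
Qed.

Lemma lambda_dist n (M N : 'M[R]_n) (e : R) : M^T = M -> N^T = N ->
  (forall x, `|qform (M - N) x| <= e * dotrow x x) ->
  forall i, `|lambda M i - lambda N i| <= e.
Proof.
move=> Ms Ns MN i.
have qB x : qform (M - N) x = qform M x - qform N x.
  by rewrite /qform mulmxBr mulmxBl !mxE.
have MNi : lambda M i <= lambda N i + e.
  apply: lambda_le => // x.
  by have := MN x; rewrite qB ler_norml => /andP[_]; rewrite lerBlDl.
have NMi : lambda N i <= lambda M i + e.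
  apply: lambda_le => // x.
  by have := MN x; rewrite qB ler_norml => /andP[+ _]; rewrite lerNl opprB lerBlDl.
by rewrite ler_distl lerBlDr NMi MNi.
Qed.

Lemma qform_gt0P n (A : 'M[R]_n) : posdefmx A <->
  A^T = A /\ forall x : 'rV[R]_n, x != 0 -> 0 < qform A x.
Proof.
split=> -[As Ap]; split=> // x x0.
  by have := Ap x^T; rewrite trmxK -trmx0 (inj_eq trmx_inj); apply.
by have := Ap x^T; rewrite /qform trmxK -trmx0 (inj_eq trmx_inj); apply.
Qed.

(** The roots of the eigenvalues in a spectral decomposition of A give a positive
definite root, so the set from which sqrtmx chooses is not empty. *)
Lemma sqrtmxP n (A : 'M[R]_n) : posdefmx A ->
  posdefmx (sqrtmx A) /\ sqrtmx A *m sqrtmx A = A.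
Proof.
move=> Apd; rewrite /sqrtmx.
suff [B BP] : exists B, [set B : 'M[R]_n | posdefmx B /\ B *m B = A] B.
  by have := xgetI 0 BP.
have /qform_gt0P[/spectral_sym[U [d [UU AE]]] Ap] := Apd.
have VV := mulmx1C UU.
have d_gt0 i : 0 < d 0 i.
  have e0 : (delta_mx 0 i : 'rV_n) *m U != 0.
    apply/eqP => /(congr1 (mulmx^~ U^T)); rewrite -mulmxA UU mulmx1 mul0mx.
    by move/rowP/(_ i)/eqP; rewrite !mxE !eqxx oner_eq0.
  have := Ap _ e0; rewrite AE qform_conj -mulmxA UU mulmx1 qform_diag.
  rewrite (bigD1 i) //= big1 ?addr0 => [|j ji]; last first.
    by rewrite !mxE (negbTE ji) andbF expr0n mulr0.
  by rewrite !mxE !eqxx expr1n mulr1.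
pose r := \row_i Num.sqrt (d 0 i).
exists (U^T *m diag_mx r *m U); split; last first.
  rewrite !mulmxA -(mulmxA (U^T *m _) U) UU mulmx1 -(mulmxA U^T) mulmx_diag AE.
  congr (_ *m diag_mx _ *m _); apply/rowP => i; rewrite !mxE -expr2.
  by rewrite sqr_sqrtr // ltW.
apply/qform_gt0P; split=> [|x x0].
  by rewrite !trmx_mul trmxK tr_diag_mx mulmxA.
rewrite (qform_spectral x erefl).
have xU0 : x *m U^T != 0.
  apply: contraNneq x0 => /(congr1 (mulmx^~ U)).
  by rewrite -mulmxA VV mulmx1 mul0mx => ->.
rewrite lt0r sumr_ge0 ?andbT; last first.
  by move=> j _; rewrite mxE mulr_ge0 ?sqrtr_ge0 ?sqr_ge0.
rewrite psumr_eq0; last by move=> j _; rewrite mxE mulr_ge0 ?sqrtr_ge0 ?sqr_ge0.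
apply: contraNN xU0 => /allP r0; apply/eqP/rowP => j.
have := r0 j (mem_index_enum _); rewrite mulf_eq0 sqrf_eq0 [(r _ _)]mxE.
by rewrite sqrtr_eq0 leNgt d_gt0 [RHS]mxE => /eqP.
Qed.

Lemma posdefmx_unit n (A : 'M[R]_n) : posdefmx A -> A \in unitmx.
Proof.
move=> /qform_gt0P[_ Ap]; rewrite unitmxE unitfE; apply/negP => /det0P[v v0 vA].
by have := Ap v v0; rewrite /qform vA mul0mx mxE ltxx.
Qed.

(** With B = sqrtmx A, the matrix diag(S) A = diag(S) B B is conjugate to
B diag(S) B through B. *)
Lemma lambda_diag_mul n (A S : 'M[R]_n) i : posdefmx A ->
  lambda (diagpart S *m A) i = lambda (sqrtmx A *m diagpart S *m sqrtmx A) i.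
Proof.
move=> /sqrtmxP[/posdefmx_unit Bu BB]; rewrite /lambda /eigenvalues.
suff -> : char_poly (diagpart S *m A) =
  char_poly (sqrtmx A *m diagpart S *m sqrtmx A) by [].
rewrite -{1}BB -[RHS](@char_poly_similar _ (sqrtmx A) (invmx (sqrtmx A))).
  by rewrite !mulmxA mulVmx // mul1mx.
by rewrite mulVmx.
Qed.

(** Lagrange's identity: the gap is half the sum of (a_k b_l - a_l b_k)^2. *)
Lemma cauchy_schwarz (I : finType) (a b : I -> R) :
  (\sum_k a k * b k) ^+ 2 <= (\sum_k a k ^+ 2) * (\sum_k b k ^+ 2).
Proof.
have : 0 <= \sum_k \sum_l (a k * b l - a l * b k) ^+ 2.
  by apply: sumr_ge0 => k _; apply: sumr_ge0 => l _; exact: sqr_ge0.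
have -> : \sum_k \sum_l (a k * b l - a l * b k) ^+ 2 =
    (\sum_k a k ^+ 2) * (\sum_k b k ^+ 2) * 2 - (\sum_k a k * b k) ^+ 2 * 2.
  have E (f g : I -> R) :
      \sum_k \sum_l f k * g l = (\sum_k f k) * (\sum_l g l).
    by rewrite mulr_suml; apply: eq_bigr => k _; rewrite mulr_sumr.
  transitivity (\sum_k \sum_l a k ^+ 2 * b l ^+ 2
      + \sum_k \sum_l b k ^+ 2 * a l ^+ 2
      - (\sum_k \sum_l (a k * b k) * (a l * b l)) * 2); last by rewrite !E; ring.
  rewrite mulr_suml -big_split -sumrB /=; apply: eq_bigr => k _.
  rewrite mulr_suml -big_split -sumrB /=; apply: eq_bigr => l _.
  by ring.
by lra.
Qed.

Definition frob2 n (M : 'M[R]_n) : R := \sum_i \sum_j M i j ^+ 2.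

Lemma frob2_ge0 n (M : 'M[R]_n) : 0 <= frob2 M.
Proof. by apply: sumr_ge0 => i _; apply: sumr_ge0 => j _; exact: sqr_ge0. Qed.

(** Cauchy-Schwarz on pairs of indices: the form pairs the entries of M with
those of x^T x, whose squared norm is |x|^4. *)
Lemma qform_frob2 n (M : 'M[R]_n) (c : R) x : 0 <= c -> frob2 M <= c ^+ 2 ->
  `|qform M x| <= c * dotrow x x.
Proof.
move=> c0 Mc; rewrite -(ler_pXn2r (_ : 0 < 2)%N) ?nnegrE //; last first.
  by rewrite mulr_ge0 // dotrow_ge0.
rewrite real_normK ?num_real // exprMn.
have -> : qform M x = \sum_(k : 'I_n * 'I_n) M k.1 k.2 * (x 0 k.1 * x 0 k.2).
  rewrite -(pair_bigA _ (fun i j => M i j * (x 0 i * x 0 j))) /=.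
  rewrite exchange_big /qform mxE; apply: eq_bigr => j _.
  by rewrite !mxE mulr_suml; apply: eq_bigr => i _; ring.
apply: (le_trans (cauchy_schwarz _ _)).
have -> : \sum_(k : 'I_n * 'I_n) M k.1 k.2 ^+ 2 = frob2 M.
  by rewrite /frob2 (pair_bigA _ (fun i j => M i j ^+ 2)).
have -> : \sum_(k : 'I_n * 'I_n) (x 0 k.1 * x 0 k.2) ^+ 2 = dotrow x x ^+ 2.
  rewrite -(pair_bigA _ (fun i j => (x 0 i * x 0 j) ^+ 2)) /=.
  rewrite dotrowE expr2 mulr_suml; apply: eq_bigr => i _.
  by rewrite mulr_sumr; apply: eq_bigr => j _; ring.
by rewrite ler_wpM2r // sqr_ge0.
Qed.

Lemma expr_spectral n (U M : 'M[R]_n) d k :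
  U *m U^T = 1%:M -> M = U^T *m diag_mx d *m U ->
  M ^+ k = U^T *m diag_mx (\row_j d 0 j ^+ k) *m U.
Proof.
move=> UU ME; elim: k => [|k IH].
  have -> : \row_j d 0 j ^+ 0 = const_mx 1 :> 'rV_n by apply/rowP => j; rewrite !mxE expr0.
  by rewrite diag_const_mx mulmx1 (mulmx1C UU) expr0.
rewrite exprS IH ME -[_ * _]/(_ *m _) !mulmxA -(mulmxA (U^T *m _) U) UU mulmx1.
rewrite -(mulmxA U^T) mulmx_diag; congr (_ *m diag_mx _ *m _).
by apply/rowP => j; rewrite !mxE exprS.
Qed.

Lemma mxtrace_expr_ge0 n (M : 'M[R]_n) k : M^T = M -> ~~ odd k ->
  0 <= \tr (M ^+ k).
Proof.
move=> /spectral_sym[U [d [UU ME]]] ek.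
rewrite (expr_spectral _ UU ME) -mulmxA mxtrace_mulC -mulmxA UU mulmx1.
rewrite mxtrace_diag; apply: sumr_ge0 => i _.
by rewrite mxE exprn_even_ge0.
Qed.

(** For even k the trace of M^k is a sum of non-negative powers of the
eigenvalues, so it bounds each of them. Against the norm of M it loses a factor
n^(1/k), which a large k makes harmless, where the Frobenius norm may lose
n^(1/2). *)
Lemma qform_mxtrace n (M : 'M[R]_n) k (c : R) x : M^T = M -> ~~ odd k ->
  (0 < k)%N -> 0 <= c -> \tr (M ^+ k) <= c ^+ k ->
  `|qform M x| <= c * dotrow x x.
Proof.
move=> /spectral_sym[U [d [UU ME]]] ek k0 c0.
rewrite (expr_spectral _ UU ME) -mulmxA mxtrace_mulC -mulmxA UU mulmx1.
rewrite mxtrace_diag => trc.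
rewrite (qform_spectral x ME) -(dotrow_orthogonal x UU) dotrowE mulr_sumr.
apply: (le_trans (ler_norm_sum _ _ _)); apply: ler_sum => j _.
rewrite -expr2 normrM [X in _ * X]ger0_norm ?sqr_ge0 //.
rewrite ler_wpM2r ?sqr_ge0 // -(ler_pXn2r k0) ?nnegrE //.
apply: le_trans trc; rewrite -normrX ger0_norm; last first.
  by rewrite exprn_even_ge0.
rewrite (bigD1 j) //= mxE lerDl; apply: sumr_ge0 => i _.
by rewrite mxE exprn_even_ge0.
Qed.

Lemma qformZ n (M : 'M[R]_n) c x : qform M (c *: x) = c ^+ 2 * qform M x.
Proof.
have cx : (c *: x)^T = c *: x^T by rewrite linearZ.
rewrite /qform cx -scalemxAl -scalemxAl -scalemxAr mxE [in LHS]mxE mulrA.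
by rewrite expr2.
Qed.

Lemma norm2_tr n (x : 'rV[R]_n) : norm2 x^T = Num.sqrt (dotrow x x).
Proof.
rewrite /norm2 dotrowE; congr Num.sqrt.
by apply: eq_bigr => j _; rewrite mxE expr2.
Qed.

(** On a unit vector, Cauchy-Schwarz bounds the form by norm2 (A y), which is a
member of the set defining the spectral norm; the Frobenius norm shows that this
set is bounded, so that its supremum is meaningful. *)
Lemma qform_spectral_norm n (A : 'M[R]_n) K x : spectral_norm A <= K ->
  `|qform A x| <= K * dotrow x x.
Proof.
move=> AK; have [->|x0] := eqVneq x 0.
  by rewrite /qform /dotrow !mul0mx !mxE normr0 mulr0.
pose y := (Num.sqrt (dotrow x x))^-1 *: x.
have sx : 0 < Num.sqrt (dotrow x x) by rewrite sqrtr_gt0 dotrow_gt0.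
have y1 : dotrow y y = 1.
  rewrite /y dotrowZ exprVn sqr_sqrtr ?dotrow_ge0 // mulVf //.
  by rewrite lt0r_neq0 // dotrow_gt0.
have yx : qform A x = dotrow x x * qform A y.
  have -> : x = Num.sqrt (dotrow x x) *: y.
    by rewrite /y scalerA mulfV ?scale1r // lt0r_neq0.
  by rewrite dotrowZ qformZ y1 mulr1.
rewrite yx normrM ger0_norm ?dotrow_ge0 // mulrC ler_wpM2r ?dotrow_ge0 //.
apply: le_trans AK.
have le_norm (z : 'cV[R]_n) : norm2 z <= 1 -> dotrow z^T z^T <= 1.
  rewrite -{1}[z]trmxK norm2_tr => z1.
  rewrite -[leLHS]sqr_sqrtr ?dotrow_ge0 // expr_le1 // sqrtr_ge0.
have AzE (z : 'cV[R]_n) : norm2 (A *m z) ^+ 2 = \sum_i (\sum_j A i j * z j 0) ^+ 2.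
  rewrite sqr_sqrtr; last by apply: sumr_ge0 => i _; exact: sqr_ge0.
  by apply: eq_bigr => i _; rewrite mxE.
have bnd : has_ubound [set norm2 (A *m z) | z in [set z : 'cV[R]_n | norm2 z <= 1]].
  exists (Num.sqrt (frob2 A)) => _ [z /= z1 <-].
  rewrite -(ler_pXn2r (_ : 0 < 2)%N) ?nnegrE ?sqrtr_ge0 // AzE.
  rewrite sqr_sqrtr ?frob2_ge0 //; apply: ler_sum => i _.
  apply: (le_trans (cauchy_schwarz _ _)); rewrite ler_piMr //.
    by apply: sumr_ge0 => j _; exact: sqr_ge0.
  apply: le_trans (le_norm _ z1); rewrite dotrowE; apply: ler_sum => j _.
  by rewrite mxE expr2.
have : norm2 (A *m y^T) <= spectral_norm A.
  by apply: ub_le_sup => //; exists y^T => //=; rewrite norm2_tr y1 sqrtr1.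
apply: le_trans; rewrite -(ler_pXn2r (_ : 0 < 2)%N) ?nnegrE ?sqrtr_ge0 //.
rewrite real_normK ?num_real //.
have -> : qform A y = \sum_i y 0 i * (A *m y^T) i 0.
  by rewrite /qform -mulmxA mxE.
apply: (le_trans (cauchy_schwarz _ _)).
rewrite [X in X * _](_ : _ = 1) ?mul1r; last first.
  by rewrite -y1 dotrowE; apply: eq_bigr => i _; rewrite expr2.
by rewrite sqr_sqrtr // sumr_ge0 // => i _; exact: sqr_ge0.
Qed.

(** With B = sqrtmx A, both spectra are those of the symmetric matrices B S B and
B diag(S) B. The form of their difference at x is that of S - diag(S) at x B, so
at most c |x B|^2 = c x A x^T <= c K |x|^2, and Weyl's inequality concludes. *)
Lemma eigenvalue_perturbation n (A S : 'M[R]_n) (K c : R) : posdefmx A ->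
  spectral_norm A <= K -> S^T = S -> 0 <= c ->
  (forall x, `|qform (S - diagpart S) x| <= c * dotrow x x) ->
  forall i, `|lambda (sqrtmx A *m S *m sqrtmx A) i
              - lambda (diagpart S *m A) i| <= c * K.
Proof.
move=> Apd AK Ss c0 Sx i; rewrite lambda_diag_mul //.
have [[Bs _] BB] := sqrtmxP Apd.
apply: lambda_dist => [||x].
- by rewrite !trmx_mul Bs Ss mulmxA.
- by rewrite !trmx_mul Bs tr_diag_mx mulmxA.
rewrite -mulmxBl -mulmxBr -{1}Bs qform_conj Bs.
apply: (le_trans (Sx _)); rewrite -mulrA ler_wpM2l //.
apply: le_trans (qform_spectral_norm x AK).
rewrite /dotrow trmx_mul Bs mulmxA -(mulmxA x) BB; exact: ler_norm.
Qed.

End SymmetricMatrices.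

(** * Measurability of the ordered eigenvalues *)

Section MeasurableEigenvalues.
Context (R : realType) (d : measure_display) (T : measurableType d).

Lemma measurable_set_lt (f g : T -> R) : measurable_fun setT f ->
  measurable_fun setT g -> measurable [set w | f w < g w].
Proof.
move=> mf mg; rewrite -[X in measurable X]setTI.
have := measurable_lte (@measurableT _ T) (proj2 (measurable_EFinP _ _) mf)
  (proj2 (measurable_EFinP _ _) mg).
by under eq_set do rewrite /= lte_fin.
Qed.

(** Each ordered eigenvalue of a symmetric matrix is a Lipschitz function of the
entries. Hence the event lambda (M w) i > y is the countable union, over rational
symmetric N and rational r > 0 with lambda N i > y + n r, of the events that all
entries of M w lie within r of those of N. *)
Lemma measurable_lambda n (M : T -> 'M[R]_n) :
  (forall w, (M w)^T = M w) ->
  (forall i j, measurable_fun setT (fun w => M w i j)) ->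
  forall i, measurable_fun setT (fun w => lambda (M w) i).
Proof.
move=> Ms mM i mT; apply: (measurability _ (RGenOInfty.measurableE R)) => //.
move=> _ [_ [y ->] <-]; rewrite preimage_itvoy setTI.
pose F (Q : 'M[rat]_n * rat) : set T :=
  let N : 'M[R]_n := map_mx ratr Q.1 in let r : R := ratr Q.2 in
  if (N^T == N) && (0 < r) && (y + n%:R * r < lambda N i) then
    \bigcap_(k in [set: 'I_n * 'I_n])
       [set w | `|M w k.1 k.2 - N k.1 k.2| < r]
  else set0.
have N_close w (N : 'M[R]_n) (r : R) : 0 < r -> N^T = N ->
    (forall k l, `|M w k l - N k l| < r) ->
    `|lambda (M w) i - lambda N i| <= n%:R * r.
  move=> r0 Ns MNr; apply: lambda_dist => // x; apply: qform_frob2.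
    by rewrite mulr_ge0 // ltW.
  apply: (@le_trans _ _ (\sum_(k < n) \sum_(l < n) r ^+ 2)).
    apply: ler_sum => k _; apply: ler_sum => l _; rewrite !mxE.
    by rewrite -real_normK ?num_real // lerXn2r ?nnegrE // ?ltW.
  by rewrite !sumr_const card_ord -mulrnA -[leLHS]mulr_natl natrM -expr2 -exprMn.
have -> : [set x | y < lambda (M x) i] = \bigcup_Q F Q; last first.
  apply: countable_bigcupT_measurable => [|[N r]]; first exact: countableP.
  rewrite /F /=; case: ifP => _ //; apply: fin_bigcap_measurable => // k _.
  apply: measurable_set_lt => //.
  by apply: measurableT_comp => //; apply: measurable_funB.
apply/seteqP; split=> [w /= yw|w [[Q r] _]]; last first.
  rewrite /F /=; case: ifP => // /andP[/andP[/eqP Qs r0] yQ] /= MQ.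
  have := N_close w _ _ r0 Qs (fun k l => MQ (k, l) I).
  by rewrite ler_distl => /andP[lM _]; apply: lt_le_trans lM; rewrite ltrBrDr.
have [r] : exists r : rat, ratr r \in `]0, (lambda (M w) i - y) / (2 * n.+1%:R)[.
  by apply: rat_in_itvoo; rewrite divr_gt0 ?subr_gt0 // mulr_gt0 // ltr0n.
rewrite in_itv /= => /andP[r0 rM].
have qex (z : R) : exists q : rat, ratr q \in `]z - ratr r, z + ratr r[.
  by apply: rat_in_itvoo; rewrite ltrD2l gtrN.
pose q (z : R) := projT1 (cid (qex z)).
have qP (z : R) : `|z - ratr (q z)| < ratr r.
  by rewrite ltr_distlC; have := projT2 (cid (qex z)); rewrite in_itv.
pose Q : 'M[rat]_n := \matrix_(k, l) q (M w k l).
have Qs : (map_mx ratr Q : 'M[R]_n)^T = map_mx ratr Q.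
  by apply/matrixP => k l; rewrite !mxE -{1}(Ms w) mxE.
have QM k l : `|M w k l - (map_mx ratr Q : 'M[R]_n) k l| < ratr r.
  by rewrite !mxE.
exists (Q, r) => //; rewrite /F /= Qs eqxx r0 /=.
suff -> : y + n%:R * ratr r < lambda (map_mx ratr Q : 'M[R]_n) i.
  by move=> [k l] _ /=.
have := N_close w _ _ r0 Qs QM; rewrite ler_distl => /andP[_].
rewrite -lerBlDr; apply: lt_le_trans.
rewrite ltrBrDr -addrA -mulrDl -ltrBrDl.
move: rM; rewrite ltr_pdivlMr ?mulr_gt0 ?ltr0n //; apply: le_lt_trans.
rewrite mulrC ler_wpM2l ?(ltW r0) //.
by rewrite -natrD -natrM ler_nat; lia.
Qed.

End MeasurableEigenvalues.

(** * Independence: product integrals and products of fields *)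

Section Independence.
Import HBNNSimple.
Context (d : measure_display) (T : measurableType d) (R : realType)
  (P : probability T R).

Lemma measurable_comp_RV (X : {RV P >-> R}) (g : R -> R) :
  measurable_fun setT g -> measurable_fun setT (fun w => g (X w)).
Proof. by move=> mg; apply: measurableT_comp. Qed.

Lemma seq_setU1 (I : eqType) (i : I) (J : seq I) :
  [set` i :: J] = i |` [set` J].
Proof.
apply/seteqP; split=> j /=; rewrite inE.
  by move=> /orP[/eqP|]; [left|right].
by move=> [->|->]; rewrite ?eqxx ?orbT.
Qed.

Lemma integral_simple_mul (X : {RV P >-> R}) (W : T -> R) (h : {nnsfun R >-> R}) :
  measurable_fun setT W -> (forall w, 0 <= W w) ->
  (\int[P]_w (h (X w) * W w)%:E =
   \sum_(y \in range h) y%:E * \int[P]_w (\1_(h @^-1` [set y]) (X w) * W w)%:E)%E.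
Proof.
move=> mW W0.
have hE w : ((h (X w) * W w)%:E =
    \sum_(y \in range h) (y * (\1_(h @^-1` [set y]) (X w) * W w))%:E)%E.
  rewrite fsumEFin //; congr _%:E; rewrite (fimfunE h) mulrC mulr_fsumr.
  by apply: eq_fsbigr => y _; rewrite mulrC mulrA.
under eq_integral do rewrite hE.
rewrite ge0_integral_fsum //.
- apply: eq_fsbigr => y; rewrite inE => -[x _ <-].
  under eq_integral do rewrite EFinM.
  rewrite ge0_integralZl //.
  + apply/measurable_EFinP; apply: measurable_funM => //.
    by apply: measurable_comp_RV; exact: measurable_indic.
  + by move=> w _; rewrite lee_fin mulr_ge0 // indicE.
  + by rewrite lee_fin.
- move=> y; apply/measurable_EFinP; apply: measurable_funM => //.
  apply: measurable_funM => //.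
  by apply: measurable_comp_RV; exact: measurable_indic.
- move=> y w _; rewrite lee_fin indicE; case: (boolP (X w \in _)) => [|_].
    by rewrite inE /= => <-; rewrite !mulr_ge0.
  by rewrite mul0r mulr0.
Qed.

(** A product rule known for indicators extends to non-negative simple functions
by linearity and to all non-negative functions by monotone convergence. *)
Lemma integral_mul_of_indic (X : {RV P >-> R}) (W : T -> R) (c : R) (g : R -> R) :
  measurable_fun setT W -> (forall w, 0 <= W w) ->
  (forall B, measurable B ->
     (\int[P]_w (\1_B (X w) * W w)%:E = P (X @^-1` B) * c%:E)%E) ->
  measurable_fun setT g -> (forall x, 0 <= g x) ->
  (\int[P]_w (g (X w) * W w)%:E = (\int[P]_w (g (X w))%:E) * c%:E)%E.
Proof.
move=> mW W0 HB mg g0.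
have mg' : measurable_fun setT (EFin \o g) by exact/measurable_EFinP.
pose h := nnsfun_approx measurableT mg'.
have hg x : (h n x)%:E @[n --> \oo] --> (g x)%:E.
  by apply: cvg_nnsfun_approx => // y _; rewrite lee_fin.
have hnd x : {homo (fun n => h n x) : m n / (m <= n)%N >-> m <= n}.
  by move=> m n mn; have /lefP := nd_nnsfun_approx measurableT mg' mn; apply.
have cvg1 (V : T -> R) : measurable_fun setT V -> (forall w, 0 <= V w) ->
    (\int[P]_w (h n (X w) * V w)%:E)%E @[n --> \oo] -->
    (\int[P]_w (g (X w) * V w)%:E)%E.
  move=> mV V0.
  have hV w : (h n (X w) * V w)%:E @[n --> \oo] --> (g (X w) * V w)%:E.
    under eq_fun do rewrite EFinM.
    by rewrite EFinM; apply: cvgeZr => //; exact: hg.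
  have -> : (\int[P]_w (g (X w) * V w)%:E =
      \int[P]_w limn (fun n => (h n (X w) * V w)%:E))%E.
    by apply: eq_integral => w _; apply/esym/cvg_lim => //; exact: hV.
  apply: (@cvg_monotone_convergence _ _ _ P setT measurableT
    (fun n w => (h n (X w) * V w)%:E)).
  - move=> n; apply/measurable_EFinP; apply: measurable_funM => //.
    exact: measurable_comp_RV.
  - by move=> n w _; rewrite lee_fin mulr_ge0.
  - by move=> w _ m n mn; rewrite lee_fin ler_wpM2r // hnd.
have cvgW := cvg1 W mW W0.
have cvg_1 : (\int[P]_w (h n (X w))%:E)%E @[n --> \oo] -->
    (\int[P]_w (g (X w))%:E)%E.
  have := cvg1 (cst 1) (measurable_cst _) (fun=> ler01).
  under eq_integral do rewrite mulr1.
  by under eq_fun do under eq_integral do rewrite mulr1.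
have step n : (\int[P]_w (h n (X w) * W w)%:E =
    (\int[P]_w (h n (X w))%:E) * c%:E)%E.
  rewrite integral_simple_mul //.
  under [in RHS]eq_integral do rewrite -[h n _]mulr1.
  rewrite (@integral_simple_mul X (cst 1)) //.
  have IX y : (\int[P]_w (\1_(h n @^-1` [set y]) (X w) * 1)%:E =
      P (X @^-1` (h n @^-1` [set y])))%E.
    under eq_integral do rewrite mulr1.
    by rewrite -[X in integral _ _ X]/(EFin \o \1_(X @^-1` (h n @^-1` [set y])))
      integral_indic ?setIT //; exact: measurable_sfunP.
  under eq_fsbigr do rewrite HB // muleA.
  under [in RHS]eq_fsbigr do rewrite IX.
  rewrite ge0_mule_fsuml // => y.
  have [y0|y0] := leP 0 y; first by rewrite mule_ge0 ?lee_fin.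
  rewrite [X in P X](_ : _ = set0) ?measure0 ?mule0 //.
  by rewrite -subset0 => w /= hy; move: y0; rewrite -hy ltNge => /negP[].
apply: (cvg_unique _ cvgW) => //; rewrite (funext step).
exact: cvgeZr.
Qed.

(** Independence is the product rule for indicators. The induction carries two
lists, one with functions g i and one with indicators, and turns one indicator
into a function at a time. *)
Lemma integral_prod_indep_ge0 (I : choiceType) (X : I -> {RV P >-> R})
    (g : I -> R -> R) :
  mutually_independent X -> (forall i, measurable_fun setT (g i)) ->
  (forall i x, 0 <= g i x) ->
  (forall i, (\int[P]_w (g i (X i w))%:E < +oo)%E) ->
  forall J : seq I, uniq J ->
  (\int[P]_w (\prod_(i <- J) g i (X i w))%:E =
   \prod_(i <- J) \int[P]_w (g i (X i w))%:E)%E.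
Proof.
move=> indX mg g0 g_fin.
suff H : forall (J1 J2 : seq I) (B : I -> set R), uniq (J1 ++ J2) ->
    (forall i, measurable (B i)) ->
    (\int[P]_w ((\prod_(i <- J1) g i (X i w)) *
                (\prod_(i <- J2) \1_(B i) (X i w)))%:E =
     (\prod_(i <- J1) \int[P]_w (g i (X i w))%:E) *
     (\prod_(i <- J2) P (X i @^-1` B i)))%E.
  move=> J uJ; have := H J [::] (fun=> setT).
  rewrite cats0 big_nil mule1 => <- //.
  by apply: eq_integral => w _; rewrite big_nil mulr1.
have mg' i : measurable_fun setT (fun w => g i (X i w)) by exact: measurable_comp_RV.
elim=> [|i J1 IH] J2 B.
  move=> uJ mB; rewrite big_nil mul1e -indX //.
  have mcap : measurable (\bigcap_(i in [set` J2]) (X i @^-1` B i)).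
    apply: fin_bigcap_measurable => // i _; exact: measurable_sfunP.
  rewrite -[X in _ = P X]setIT -integral_indic //.
  apply: eq_integral => w _; rewrite big_nil mul1r; congr _%:E.
  elim: J2 {uJ mcap} => [|j J IHJ].
    by rewrite big_nil indicE mem_set // => i.
  by rewrite big_cons IHJ seq_setU1 bigcap_setU1 indicI.
rewrite cat_cons => /= /andP[iJ uJ] mB.
pose W w := (\prod_(i <- J1) g i (X i w)) * (\prod_(i <- J2) \1_(B i) (X i w)).
have mW : measurable_fun setT W.
  apply: measurable_funM; apply: measurable_prod => j _ //.
  by apply: measurable_comp_RV; exact: measurable_indic.
have W0 w : 0 <= W w.
  by rewrite mulr_ge0 // prodr_ge0 // => j _; rewrite indicE.
have W_fin : (\prod_(i <- J1) \int[P]_w (g i (X i w))%:E *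
    \prod_(i <- J2) P (X i @^-1` B i))%E \is a fin_num.
  apply: fin_numM.
    rewrite big_seq; apply: prode_fin_num => j _.
    by rewrite ge0_fin_numE ?g_fin // integral_ge0 // => w _; rewrite lee_fin.
  rewrite big_seq; apply: prode_fin_num => j _; apply: fin_num_measure.
  exact: measurable_sfunP.
pose c := fine (\prod_(i <- J1) \int[P]_w (g i (X i w))%:E *
    \prod_(i <- J2) P (X i @^-1` B i))%E.
have HB B0 : measurable B0 ->
    (\int[P]_w (\1_B0 (X i w) * W w)%:E = P (X i @^-1` B0) * c%:E)%E.
  move=> mB0; pose B' k := if k == i then B0 else B k.
  have iJ2 j : j \in J2 -> B' j = B j.
    move=> jJ; rewrite /B'; case: eqP => // ji; move: iJ.
    by rewrite -ji mem_cat jJ orbT.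
  have uJ' : uniq (J1 ++ i :: J2).
    by rewrite -[i :: J2]cat1s uniq_catCA /= iJ.
  have mB' k : measurable (B' k) by rewrite /B'; case: ifP.
  have := IH (i :: J2) B' uJ' mB'; rewrite !big_cons {2}/B' eqxx muleCA fineK //.
  have -> : (\prod_(j <- J2) P (X j @^-1` B' j) =
      \prod_(j <- J2) P (X j @^-1` B j))%E.
    by apply: eq_big_seq => j jJ; rewrite iJ2.
  move=> <-; apply: eq_integral => w _; rewrite /W big_cons {1}/B' eqxx mulrCA.
  by congr (_ * (_ * _))%:E; apply: eq_big_seq => j jJ; rewrite iJ2.
under eq_integral do rewrite big_cons -mulrA.
by rewrite (integral_mul_of_indic mW W0 HB) // big_cons fineK // muleA.
Qed.

Lemma integrable_prod_indep (I : choiceType) (X : I -> {RV P >-> R})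
    (g : I -> R -> R) :
  mutually_independent X -> (forall i, measurable_fun setT (g i)) ->
  (forall i, P.-integrable setT (fun w => (g i (X i w))%:E)) ->
  forall J : seq I, uniq J ->
  P.-integrable setT (fun w => (\prod_(i <- J) g i (X i w))%:E).
Proof.
move=> indX mg gi J uJ; apply/integrableP; split.
  apply/measurable_EFinP; apply: measurable_prod => j _.
  exact: measurable_comp_RV.
under eq_integral do rewrite abse_EFin normr_prod.
have := @integral_prod_indep_ge0 I X (fun i x => `|g i x|) indX.
move=> -> //; last 2 first.
- by move=> i; apply: measurableT_comp => //; exact: mg.
- by move=> i; have /integrableP[_] := gi i.
rewrite ltey_eq big_seq prode_fin_num // => j _.
rewrite ge0_fin_numE; last by apply: integral_ge0 => w _; rewrite lee_fin.
by have /integrableP[_] := gi j.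
Qed.

(** Splitting a factor into its positive and negative parts reduces the number of
signed factors by one; J1 lists those that may be signed. *)
Lemma Rintegral_prod_indep (I : choiceType) (X : I -> {RV P >-> R})
    (g : I -> R -> R) :
  mutually_independent X -> (forall i, measurable_fun setT (g i)) ->
  (forall i, P.-integrable setT (fun w => (g i (X i w))%:E)) ->
  forall J : seq I, uniq J ->
  \int[P]_w (\prod_(i <- J) g i (X i w)) = \prod_(i <- J) \int[P]_w (g i (X i w)).
Proof.
move=> indX + + J uJ.
suff H : forall (J1 : seq I) (g : I -> R -> R),
    (forall i, i \notin J1 -> forall x, 0 <= g i x) ->
    (forall i, measurable_fun setT (g i)) ->
    (forall i, P.-integrable setT (fun w => (g i (X i w))%:E)) ->
    \int[P]_w (\prod_(i <- J) g i (X i w)) =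
    \prod_(i <- J) \int[P]_w (g i (X i w)).
  move=> mg gi; pose g1 k := if k \in J then g k else cst 0.
  have E k : k \in J -> g1 k = g k by rewrite /g1 => ->.
  have -> : \prod_(k <- J) \int[P]_w g k (X k w) =
      \prod_(k <- J) \int[P]_w g1 k (X k w).
    by apply: eq_big_seq => k kJ; rewrite E.
  rewrite -(H J g1).
  - by apply: eq_Rintegral => w _; apply: eq_big_seq => k kJ; rewrite E.
  - by move=> k kJ x; rewrite /g1 (negbTE kJ).
  - by move=> k; rewrite /g1; case: (k \in J).
  - by move=> k; rewrite /g1; case: ifP => // _; exact: integrable0.
move=> J1; elim: J1 {g} => [|i J1 IH] g g0 mg gi.
  have g_fin i : (\int[P]_w (g i (X i w))%:E)%E \is a fin_num.
    exact: integrable_fin_num.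
  rewrite /Rintegral integral_prod_indep_ge0 //.
  - elim: J {uJ} => [|j J IHJ]; first by rewrite !big_nil.
    rewrite !big_cons fineM ?IHJ //.
    by rewrite big_seq; apply: prode_fin_num.
  - by move=> k x; exact: g0.
  - by move=> k; rewrite ltey_eq g_fin.
pose gp (h : R -> R) k x := if k == i then h x else g k x.
have gpP (h : R -> R) : measurable_fun setT h -> (forall x, 0 <= h x) ->
    P.-integrable setT (fun w => (h (X i w))%:E) ->
    \int[P]_w (\prod_(k <- J) gp h k (X k w)) =
    \prod_(k <- J) \int[P]_w (gp h k (X k w)).
  move=> mh h0 hi; apply: IH => k; rewrite /gp; have [ki|ki] := eqVneq k i => //.
    by move=> kJ x; apply: g0; rewrite inE negb_or ki.
  by rewrite ki.
have [iJ|iJ] := boolP (i \in J); last first.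
  have E (h : R -> R) k : k \in J -> gp h k = g k.
    by move=> kJ; rewrite /gp; case: eqP => // ki; rewrite -ki kJ in iJ.
  have := gpP (cst 0) (measurable_cst _) (fun=> lexx _) (integrable0 _ _).
  under eq_Rintegral do under eq_big_seq do rewrite E //.
  by under [in RHS]eq_big_seq do rewrite E //.
pose p x := Num.max (g i x) 0; pose n x := Num.max (- g i x) 0.
have gE x : g i x = p x - n x.
    rewrite /p /n; case: (lerP (g i x) 0) => gx.
      by rewrite max_l ?oppr_ge0 // sub0r opprK.
    by rewrite max_r ?oppr_le0 ?ltW // subr0.
have mp : measurable_fun setT p.
  by apply: measurable_maxr => //; exact: measurable_cst.
have mn : measurable_fun setT n.
  apply: measurable_maxr; last exact: measurable_cst.
  by apply: measurable_funN; exact: mg.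
have ip : P.-integrable setT (fun w => (p (X i w))%:E).
  exact: (integrable_funrpos measurableT (gi i)).
have iN : P.-integrable setT (fun w => (n (X i w))%:E).
  exact: (integrable_funrneg measurableT (gi i)).
have p0 x : 0 <= p x by rewrite le_max lexx orbT.
have n0 x : 0 <= n x by rewrite le_max lexx orbT.
have DJ (f : I -> R) : \prod_(k <- J) f k = f i * \prod_(k <- J | k != i) f k.
  exact: bigD1_seq.
have int_gp (h : R -> R) : measurable_fun setT h ->
    P.-integrable setT (fun w => (h (X i w))%:E) ->
    P.-integrable setT (fun w => (\prod_(k <- J) gp h k (X k w))%:E).
  move=> mh hi; apply: integrable_prod_indep => // k; rewrite /gp.
    by have [_|_] := eqVneq k i.
  by case: eqP => [->|].
have gpD (h : R -> R) w : \prod_(k <- J) gp h k (X k w) =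
    h (X i w) * \prod_(k <- J | k != i) g k (X k w).
  rewrite DJ {1}/gp eqxx; congr (_ * _); apply: eq_bigr => k ki.
  by rewrite /gp (negbTE ki).
have gpI (h : R -> R) : \prod_(k <- J) \int[P]_w (gp h k (X k w)) =
    (\int[P]_w (h (X i w))) * \prod_(k <- J | k != i) \int[P]_w (g k (X k w)).
  rewrite DJ {1}/gp eqxx; congr (_ * _); apply: eq_bigr => k ki.
  by rewrite /gp (negbTE ki).
have -> : (fun w => \prod_(k <- J) g k (X k w)) =
    (fun w => \prod_(k <- J) gp p k (X k w) - \prod_(k <- J) gp n k (X k w)).
  by apply/funext => w; rewrite !gpD DJ gE mulrBl.
rewrite RintegralB ?gpP ?gpI //; [|exact: int_gp|exact: int_gp].
rewrite -mulrBl -RintegralB // DJ; congr (_ * _).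
by apply: eq_Rintegral => w _; rewrite gE.
Qed.

Lemma sigma_of_bigcap (I : choiceType) (X : I -> {RV P >-> R}) (J : seq I)
    (B : I -> set R) : (forall i, measurable (B i)) ->
  sigma_of X (\bigcap_(i in [set` J]) (X i @^-1` B i)).
Proof.
move=> mB; pose G := \bigcup_i preimage_set_system setT (X i) measurable.
have : @measurable _ (g_sigma_algebraType G) (\bigcap_(i in [set` J]) (X i @^-1` B i)).
  apply: fin_bigcap_measurable => // i _; apply: sub_sigma_algebra.
  by exists i => //; exists (B i) => //; rewrite setTI.
by [].
Qed.

Lemma independent_fields_bigcap (I : choiceType) (X Y : I -> {RV P >-> R})
    (J : seq I) (C D : I -> set R) :
  mutually_independent X -> mutually_independent Y -> independent_fields X Y ->
  uniq J -> (forall i, measurable (C i)) -> (forall i, measurable (D i)) ->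
  (P (\bigcap_(i in [set` J]) (X i @^-1` C i `&` Y i @^-1` D i)) =
   \prod_(i <- J) (P (X i @^-1` C i) * P (Y i @^-1` D i)))%E.
Proof.
move=> iX iY XY uJ mC mD; rewrite bigcapI XY; [|exact: sigma_of_bigcap..].
by rewrite iX // iY // big_split.
Qed.

Lemma probability_partition m (X : {RV P >-> R}) (s : 'I_m -> R) (A : set T) :
  injective s -> (\sum_i P (X @^-1` [set s i]) = 1)%E -> measurable A ->
  (P A = \sum_i P (A `&` X @^-1` [set s i]))%E.
Proof.
move=> s_inj sX mA.
have mX i : measurable (X @^-1` [set s i]) by exact: measurable_sfunP.
pose U := \big[setU/set0]_(i < m) (X @^-1` [set s i]).
have mU : measurable U by exact: bigsetU_measurable.
have tX : trivIset [set: 'I_m] (fun i => X @^-1` [set s i]).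
  by move=> i j _ _ [w [/= Xi Xj]]; apply: s_inj; rewrite -Xi -Xj.
have PU : P U = 1%E by rewrite measure_bigsetU_ord.
have PUc : P (~` U) = 0%E by rewrite probability_setC // PU subee.
have mUc : measurable (~` U) by exact: measurableC.
have mAUc : measurable (A `&` ~` U) by exact: measurableI.
transitivity (P (A `&` U)).
  rewrite -[in LHS](setIT A) -(setUv U) setIUr measureU //.
  - rewrite [X in (_ + X)%E](_ : _ = 0%E) ?adde0 //.
    apply/eqP; rewrite eq_le measure_ge0 andbT -PUc.
    by apply: le_measure; rewrite ?inE //; exact: subIsetr.
  - exact: measurableI.
  - by rewrite setIACA setICr setI0.
rewrite /U big_distrr /= measure_bigsetU_ord //.
by move=> i j Di Dj [w [[_ ?] [_ ?]]]; apply: tX => //; exists w.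
Qed.

Section Product.
Variables (I : choiceType) (sg Z : I -> {RV P >-> R}) (m : nat) (s : 'I_m -> R).
Hypothesis s_inj : injective s.
Hypothesis sgs : forall e, (\sum_i P (sg e @^-1` [set s i]) = 1)%E.
Hypothesis isg : mutually_independent sg.
Hypothesis iZ : mutually_independent Z.
Hypothesis sgZ : independent_fields sg Z.

Let X e : {RV P >-> R} := sg e * Z e.

Let mult_preim i (B : set R) : set R := ( *%R (s i)) @^-1` B.

Let m_mult i B : measurable B -> measurable (mult_preim i B).
Proof.
by move=> mB; rewrite -[X in measurable X]setTI; exact: mulrl_measurable.
Qed.

Let X_on i e B :
  X e @^-1` B `&` sg e @^-1` [set s i] =
  sg e @^-1` [set s i] `&` Z e @^-1` (mult_preim i B).
Proof.
apply/seteqP; split=> w [].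
  by move=> XB sw; split=> //; rewrite /mult_preim /preimage /= -sw.
move=> sw XB; split=> //; change (B (sg e w * Z e w)).
by rewrite (sw : sg e w = s i).
Qed.

Lemma probability_product e (B : set R) : measurable B ->
  (P (X e @^-1` B) =
   \sum_i P (sg e @^-1` [set s i]) * P (Z e @^-1` (( *%R (s i)) @^-1` B)))%E.
Proof.
move=> mB; rewrite (probability_partition s_inj (sgs e)); last first.
  exact: measurable_sfunP.
apply: eq_bigr => i _; rewrite X_on.
have := @independent_fields_bigcap I sg Z [:: e] (fun=> [set s i])
  (fun=> mult_preim i B) isg iZ sgZ.
rewrite big_seq1 => <- //; last by move=> _; exact: m_mult.
by rewrite (_ : [set` [:: e]] = [set e]) ?bigcap_set1 // seq_setU1 set_nil setU0.
Qed.

(** On the event sg e = s i, a condition on sg e * Z e is a condition on Z e.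
Summing over i turns the products, one index at a time, into pairs (sg e, Z e),
whose joint independence is known; K lists the indices already treated. *)
Lemma product_mutually_independent :
  mutually_independent (fun e => sg e * Z e : {RV P >-> R}).
Proof.
move=> J B uJ mB.
suff H : forall (J K : seq I) (C D : I -> set R), uniq (J ++ K) ->
    (forall e, measurable (C e)) -> (forall e, measurable (D e)) ->
    (P (\bigcap_(e in [set` J]) (X e @^-1` B e) `&`
       \bigcap_(e in [set` K]) (sg e @^-1` C e `&` Z e @^-1` D e)) =
     (\prod_(e <- J) P (X e @^-1` B e)) *
     \prod_(e <- K) (P (sg e @^-1` C e) * P (Z e @^-1` D e)))%E.
  have := H J [::] (fun=> setT) (fun=> setT).
  by rewrite cats0 big_nil mule1 set_nil bigcap_set0 setIT; apply.
elim=> [|e {uJ}J IH] K C D uJK mC mD.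
  by rewrite big_nil mul1e set_nil bigcap_set0 setTI independent_fields_bigcap.
move: uJK; rewrite cat_cons cons_uniq => /andP[eJK uJK].
pose upd (F : I -> set R) G k := if k == e then G else F k.
have updE F G k : k \in K -> upd F G k = F k.
  move=> kK; rewrite /upd; case: eqP => // ke; move: eJK.
  by rewrite -ke mem_cat kK orbT.
rewrite (probability_partition s_inj (sgs e)); last first.
  apply: measurableI; apply: fin_bigcap_measurable => // k _.
    exact: measurable_sfunP.
  by apply: measurableI; exact: measurable_sfunP.
rewrite big_cons probability_product //.
rewrite -muleA ge0_sume_distrl; last by move=> i _; rewrite mule_ge0.
apply: eq_bigr => i _.
pose C' := upd C [set s i]; pose D' := upd D (mult_preim i (B e)).
have uJK' : uniq (J ++ e :: K) by rewrite -[e :: K]cat1s uniq_catCA /= eJK.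
have mC' k : measurable (C' k) by rewrite /C' /upd; case: ifP.
have mD' k : measurable (D' k).
  by rewrite /D' /upd; case: ifP => // _; exact: m_mult.
have := IH (e :: K) C' D' uJK' mC' mD'.
have C'e : C' e = [set s i] by rewrite /C' /upd eqxx.
have D'e : D' e = mult_preim i (B e) by rewrite /D' /upd eqxx.
rewrite big_cons C'e D'e.
have -> : (\prod_(k <- K) (P (sg k @^-1` C' k) * P (Z k @^-1` D' k)) =
    \prod_(k <- K) (P (sg k @^-1` C k) * P (Z k @^-1` D k)))%E.
  by apply: eq_big_seq => k kK; rewrite /C' /D' !updE.
rewrite muleCA => <-; congr (P _).
rewrite !seq_setU1 !bigcap_setU1 C'e D'e -X_on.
rewrite (_ : \bigcap_(k in [set` K]) (sg k @^-1` C' k `&` Z k @^-1` D' k) =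
    \bigcap_(k in [set` K]) (sg k @^-1` C k `&` Z k @^-1` D k)).
  by apply/seteqP; split=> w /=; tauto.
by apply: eq_bigcapr => k kK; rewrite /C' /D' !updE.
Qed.

End Product.

Lemma integral_ident (X Y : {RV P >-> R}) (g : R -> R) :
  (forall B : set R, measurable B -> P (X @^-1` B) = P (Y @^-1` B)) ->
  measurable_fun setT g ->
  (\int[P]_w (g (X w))%:E = \int[P]_w (g (Y w))%:E)%E.
Proof.
move=> XY mg.
have mg' : measurable_fun setT (EFin \o g) by exact/measurable_EFinP.
have H (h : R -> \bar R) : measurable_fun setT h -> (forall x, 0 <= h x)%E ->
    (\int[P]_w h (X w) = \int[P]_w h (Y w))%E.
  move=> mh h0; have := ge0_integral_distribution X mh h0 => /esym.
  have -> : (\int[P]_w (h \o X) w = \int[P]_w h (X w))%E by [].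
  move=> ->; have := ge0_integral_distribution Y mh h0 => /esym.
  have -> : (\int[P]_w (h \o Y) w = \int[P]_w h (Y w))%E by [].
  by move=> ->; apply: eq_measure_integral => B mB _; exact: XY.
rewrite integralE [RHS]integralE; congr (_ - _)%E.
- have := H _ (measurable_funepos mg') (fun x => funepos_ge0 _ x).
  by rewrite !funepos.unlock.
- have := H _ (measurable_funeneg mg') (fun x => funeneg_ge0 _ x).
  by rewrite !funeneg.unlock.
Qed.

Lemma integral_mul_indep (X Y : {RV P >-> R}) (f g : R -> R) :
  (forall C D : set R, measurable C -> measurable D ->
     P (X @^-1` C `&` Y @^-1` D) = P (X @^-1` C) * P (Y @^-1` D))%E ->
  measurable_fun setT f -> measurable_fun setT g ->
  (forall x, 0 <= f x) -> (forall x, 0 <= g x) ->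
  (\int[P]_w (g (Y w))%:E < +oo)%E ->
  (\int[P]_w (f (X w) * g (Y w))%:E =
   \int[P]_w (f (X w))%:E * \int[P]_w (g (Y w))%:E)%E.
Proof.
move=> XY mf mg f0 g0 g_fin.
have gE : (\int[P]_w (g (Y w))%:E)%E \is a fin_num.
  by rewrite ge0_fin_numE // integral_ge0 // => w _; rewrite lee_fin.
rewrite -[X in (_ * X)%E]fineK //; apply: integral_mul_of_indic => //.
  exact: measurable_comp_RV.
move=> B mB; rewrite fineK // muleC.
have mXB : measurable (X @^-1` B) by exact: measurable_sfunP.
have PXB : P (X @^-1` B) \is a fin_num by exact: fin_num_measure.
rewrite -[X in (_ * X)%E]fineK //.
rewrite -(@integral_mul_of_indic Y (fun w => \1_B (X w))) //.
- by apply: eq_integral => w _; rewrite mulrC.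
- by apply: measurable_comp_RV; exact: measurable_indic.
move=> D mD; rewrite fineK // muleC -XY // -[X in P X]setIT -integral_indic //.
  by apply: eq_integral => w _; rewrite indicI /= mulrC.
by apply: measurableI => //; exact: measurable_sfunP.
Qed.

Lemma integral_finite_valued m (X : {RV P >-> R}) (s : 'I_m -> R) (f : R -> R) :
  injective s -> (\sum_i P (X @^-1` [set s i]) = 1)%E ->
  measurable_fun setT f -> (forall x, 0 <= f x) ->
  (\int[P]_w (f (X w))%:E = \sum_i (f (s i))%:E * P (X @^-1` [set s i]))%E.
Proof.
move=> s_inj sX mf f0.
have mX i : measurable (X @^-1` [set s i]) by exact: measurable_sfunP.
have tX : trivIset [set: 'I_m] (fun i => X @^-1` [set s i]).
  by move=> i j _ _ [w [/= Xi Xj]]; apply: s_inj; rewrite -Xi -Xj.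
pose U := \big[setU/set0]_(i < m) (X @^-1` [set s i]).
have mU : measurable U by exact: bigsetU_measurable.
have PU : P U = 1%E by rewrite measure_bigsetU_ord.
have PUc : P (~` U) = 0%E by rewrite probability_setC // PU subee.
have mfX : measurable_fun setT (fun w => (f (X w))%:E).
  by apply/measurable_EFinP; exact: measurable_comp_RV.
rewrite -(setUv U) ge0_integral_setU //; first last.
- by rewrite /disj_set setICr.
- by move=> w _; rewrite lee_fin.
- by rewrite setUv.
- exact: measurableC.
rewrite (@null_set_integral _ _ _ P (~` U)) //; last 2 first.
- exact: measurableC.
- exact: measurable_funTS.
rewrite adde0 /U ge0_integral_bigsetU //; first last.
- by move=> w _; rewrite lee_fin.
- exact: measurable_funTS.
- by move=> i j _ _; exact: tX.
- exact: index_enum_uniq.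
apply: eq_bigr => i _.
rewrite -integral_cst //; apply: eq_integral => w.
by rewrite inE /= => ->.
Qed.

End Independence.

(** * Walks in a Gram matrix *)

Section Walks.

(** A step (t, i) leads from the current row, initially a, through the column t to
the row i; it contributes the entries (row, t) and (i, t), which are the edges of
a walk in the complete bipartite graph of rows and columns. *)
Fixpoint walk_edges (a : nat) (s : seq (nat * nat)) : seq (nat * nat) :=
  if s is (t, i) :: s' then (a, t) :: (i, t) :: walk_edges i s' else [::].

(** A step stays off the diagonal of the Gram matrix when it changes the row. *)
Fixpoint walk_steps (a : nat) (s : seq (nat * nat)) : bool :=
  if s is (t, i) :: s' then (a != i) && walk_steps i s' else true.

Definition walk_rows (a : nat) (s : seq (nat * nat)) := a :: map snd s.

Definition nb_edges a s := size (undup (walk_edges a s)).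
Definition nb_rows a s := size (undup (walk_rows a s)).
Definition nb_cols (s : seq (nat * nat)) := size (undup (map fst s)).

Lemma size_undup_cons (T : eqType) (x : T) s :
  size (undup (x :: s)) = ((x \notin s) + size (undup s))%N.
Proof. by rewrite /=; case: (x \in s). Qed.

Lemma size_walk_edges a s : size (walk_edges a s) = (size s).*2.
Proof. by elim: s a => [|[t i] s IH] a //=; rewrite IH. Qed.

Lemma walk_edges_row a s e : e \in walk_edges a s -> e.1 \in walk_rows a s.
Proof.
elim: s a => [|[t i] s IH] a //=; rewrite !inE => /or3P[/eqP->|/eqP->|/IH] /=.
- by rewrite eqxx.
- by rewrite eqxx orbT.
- by rewrite inE => ->; rewrite orbT.
Qed.

Lemma walk_edges_col a s e : e \in walk_edges a s -> e.2 \in map fst s.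
Proof.
elim: s a => [|[t i] s IH] a //=; rewrite !inE => /or3P[/eqP->|/eqP->|/IH] /=.
- by rewrite eqxx.
- by rewrite eqxx.
- by move=> ->; rewrite orbT.
Qed.

Lemma nb_rows_cons a t i s :
  nb_rows a ((t, i) :: s) = ((a \notin walk_rows i s) + nb_rows i s)%N.
Proof. exact: size_undup_cons. Qed.

Lemma nb_cols_cons t i s :
  nb_cols ((t, i) :: s) = ((t \notin map fst s) + nb_cols s)%N.
Proof. exact: size_undup_cons. Qed.

(** The edges form a connected graph, so there is at most one vertex more than
there are edges. A column is entered and left through different rows, so it
carries at least two edges. *)
Lemma walk_count a s : walk_steps a s ->
  (nb_rows a s + nb_cols s <= (nb_edges a s).+1)%N
  /\ (2 * nb_cols s <= nb_edges a s)%N.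
Proof.
elim: s a => [|[t i] s IH] a //= /andP[ai /IH[IH1 IH2]].
have -> : nb_edges a ((t, i) :: s) =
    (((a, t) \notin walk_edges i s) +
      (((i, t) \notin walk_edges i s) + nb_edges i s))%N.
  rewrite /nb_edges [walk_edges a _]/= !size_undup_cons.
  by rewrite inE xpair_eqE (negbTE ai).
rewrite nb_rows_cons nb_cols_cons.
have colE b : (b, t) \in walk_edges i s -> t \in map fst s.
  by move=> /walk_edges_col.
have rowE : (a, t) \in walk_edges i s -> a \in walk_rows i s.
  by move=> /walk_edges_row.
move: IH1 IH2 (colE a) (colE i) rowE.
case: (t \in _); case: (a \in _); case: ((a, t) \in _); case: ((i, t) \in _) => /=;
  move=> IH1 IH2 // H1 H2 H3; try (by have := H1 isT); try (by have := H2 isT);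
  try (by have := H3 isT); lia.
Qed.

End Walks.

Section WalkSums.
Variables (R : realType) (p n : nat).

(** The sum of G over all lists of k steps, nested so that walks grow by one step
in front. *)
Fixpoint walk_sum k (G : seq (nat * nat) -> R) : R :=
  if k is k'.+1 then
    \sum_(t < n) \sum_(i < p) walk_sum k' (fun s => G ((val t, val i) :: s))
  else G [::].

Lemma le_walk_sum k G H : (forall s, size s = k -> G s <= H s) ->
  walk_sum k G <= walk_sum k H.
Proof.
elim: k G H => [|k IH] G H GH /=; first exact: GH.
apply: ler_sum => t _; apply: ler_sum => i _; apply: IH => s sk.
by apply: GH; rewrite /= sk.
Qed.

Lemma eq_walk_sum k G H : (forall s, size s = k -> G s = H s) -> walk_sum k G = walk_sum k H.
Proof.
by move=> GH; apply/eqP; rewrite eq_le !le_walk_sum // => s sk; rewrite GH.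
Qed.

Lemma walk_sumZ k c G : walk_sum k (fun s => c * G s) = c * walk_sum k G.
Proof.
elim: k G => [|k IH] G //=; rewrite mulr_sumr; apply: eq_bigr => t _.
by rewrite mulr_sumr; apply: eq_bigr => i _; exact: IH.
Qed.

Lemma walk_sum_sum k (I : Type) (r : seq I) (G : I -> seq (nat * nat) -> R) :
  walk_sum k (fun s => \sum_(j <- r) G j s) = \sum_(j <- r) walk_sum k (G j).
Proof.
elim: k G => [|k IH] G //=.
rewrite [RHS]exchange_big; apply: eq_bigr => t _.
by rewrite [RHS]exchange_big; apply: eq_bigr => i _; rewrite IH.
Qed.

(** The indices outside L contribute at most 1 altogether, those in L at most 1
each. *)
Lemma sum_notin_le m (L : seq nat) : (0 < m)%N ->
  \sum_(a < m) (m%:R : R) ^- (val a \notin L) <= (size L).+1%:R.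
Proof.
move=> m0; apply: (@le_trans _ _ (\sum_(a < m) (m%:R^-1 + (val a \in L)%:R))).
  apply: ler_sum => a _; case: (val a \in L) => /=; last by rewrite expr1 addr0.
  by rewrite expr0 invr1 lerDr invr_ge0.
rewrite big_split /= sumr_const card_ord -[_ *+ m]mulr_natl divff ?pnatr_eq0 ?lt0n_neq0 //.
rewrite -natr_sum -natr1 addrC lerD2r ler_nat.
rewrite -(big_mkord xpredT (fun a => nat_of_bool (a \in L))) -big_mkcond /=.
rewrite sum1_count -size_filter; apply: uniq_leq_size.
  by rewrite filter_uniq // iota_uniq.
by move=> x; rewrite mem_filter => /andP[].
Qed.

(** A vertex weighs 1/p or 1/n at its first visit only. Prepending a step to a
walk of k steps adds a row and a column; each is new, with total weight at most
1, or one of the k + 1 rows or k columns already present. The factors k + 2 and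
k + 1 build the factorials. *)
Lemma sum_walk_le k : (0 < p)%N -> (0 < n)%N ->
  \sum_(a < p) walk_sum k (fun s => (p%:R : R) ^- nb_rows a s * n%:R ^- nb_cols s)
  <= (k.+1`! * k`!)%:R.
Proof.
move=> p0 n0; elim: k => [|k IH] /=.
  rewrite (eq_bigr (fun=> p%:R^-1)) => [|a _].
    by rewrite sumr_const card_ord -[_ *+ p]mulr_natl divff // pnatr_eq0 lt0n_neq0.
  by rewrite /nb_rows /nb_cols /= expr1 expr0 invr1 mulr1.
have step : \sum_(a < p) \sum_(t < n) \sum_(i < p)
    walk_sum k (fun s => (p%:R : R) ^- nb_rows a ((val t, val i) :: s) *
                     n%:R ^- nb_cols ((val t, val i) :: s)) =
  \sum_(i < p) walk_sum k (fun s => (p%:R : R) ^- nb_rows i s * n%:R ^- nb_cols s *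
    ((\sum_(a < p) p%:R ^- (val a \notin walk_rows i s)) *
     (\sum_(t < n) n%:R ^- (val t \notin map fst s)))).
  under eq_bigr do rewrite exchange_big.
  rewrite exchange_big; apply: eq_bigr => i _ /=.
  under eq_bigr do rewrite -walk_sum_sum.
  rewrite -walk_sum_sum; apply: eq_walk_sum => s _.
  rewrite mulr_suml mulr_sumr; apply: eq_bigr => a _.
  rewrite !mulr_sumr; apply: eq_bigr => t _.
  rewrite nb_rows_cons nb_cols_cons.
  by rewrite !exprD !invfM; ring.
rewrite step.
apply: (@le_trans _ _ (\sum_(i < p) (k.+2 * k.+1)%:R *
   walk_sum k (fun s => (p%:R : R) ^- nb_rows i s * n%:R ^- nb_cols s))).
  apply: ler_sum => i _; rewrite -walk_sumZ; apply: le_walk_sum => s sk.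
  rewrite mulrC; apply: ler_wpM2r.
    by rewrite mulr_ge0 // invr_ge0 exprn_ge0.
  rewrite natrM; apply: ler_pM.
  - by apply: sumr_ge0 => a _; rewrite invr_ge0 exprn_ge0.
  - by apply: sumr_ge0 => a _; rewrite invr_ge0 exprn_ge0.
  - apply: le_trans (sum_notin_le _ p0) _.
    by rewrite /walk_rows /= size_map sk.
  - apply: le_trans (sum_notin_le _ n0) _.
    by rewrite size_map sk.
rewrite -mulr_sumr; apply: (@le_trans _ _ ((k.+2 * k.+1)%:R * (k.+1`! * k`!)%:R)).
  by rewrite ler_wpM2l.
by rewrite -natrM ler_nat [k.+2`!]factS [k.+1`! in leqRHS]factS mulnACA.
Qed.

Fixpoint walk_end (a : nat) (s : seq (nat * nat)) : nat :=
  if s is (_, i) :: s' then walk_end i s' else a.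

(** The matrix F G^T with its diagonal removed. *)
Definition offgram (F G : nat * nat -> R) : 'M[R]_p :=
  \matrix_(i, j) if i == j then 0 else
     \sum_(t < n) F (val i, val t) * G (val j, val t).

Lemma offgram_sym F : (offgram F F)^T = offgram F F.
Proof.
apply/matrixP => i j; rewrite !mxE eq_sym; case: ifP => // _.
by apply: eq_bigr => t _; rewrite mulrC.
Qed.

Lemma offgram_exprE F k a b :
  (offgram F F ^+ k) a b = walk_sum k (fun s =>
    if walk_steps (val a) s && (walk_end (val a) s == val b)
    then \prod_(e <- walk_edges (val a) s) F e else 0).
Proof.
elim: k a => [|k IH] a /=.
  rewrite expr0 -[1 in LHS]/(1%:M : 'M[R]_p) !mxE big_nil.
  by rewrite (inj_eq val_inj); case: (a == b).
rewrite exprS -[_ * _]/(_ *m _) mxE.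
rewrite [RHS]exchange_big /=; apply: eq_bigr => i _.
rewrite IH mxE; case: eqVneq => [->|ai].
  rewrite mul0r big1 // => t _; rewrite (eq_walk_sum (H := fun=> 0 * 0)).
    by rewrite walk_sumZ mul0r.
  by move=> s _; rewrite eqxx mul0r.
rewrite mulr_suml; apply: eq_bigr => t _; rewrite -walk_sumZ; apply: eq_walk_sum => s _.
rewrite (_ : (val a != val i) = true) //=.
by case: ifP => _; rewrite ?mulr0 // !big_cons mulrA.
Qed.

Lemma offgram_trace F k : \tr (offgram F F ^+ k) =
  \sum_(a < p) walk_sum k (fun s =>
    if walk_steps (val a) s && (walk_end (val a) s == val a)
    then \prod_(e <- walk_edges (val a) s) F e else 0).
Proof. by apply: eq_bigr => a _; rewrite offgram_exprE. Qed.

End WalkSums.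

(** * Moments of the off-diagonal Gram matrix *)

Section TraceMoments.
Context (d : measure_display) (T : measurableType d) (R : realType)
  (P : probability T R).

Lemma integrable_bounded (Y : T -> R) (B : R) : measurable_fun setT Y ->
  (forall w, `|Y w| <= B) -> P.-integrable setT (EFin \o Y).
Proof.
move=> mY YB; apply: (@le_integrable _ _ _ P setT measurableT _ (cst B%:E)).
- exact/measurable_EFinP.
- by move=> w _; rewrite /= lee_fin; apply: le_trans (ler_norm B); exact: YB.
- exact: finite_measure_integrable_cst.
Qed.

Lemma markov_Rintegral (Y : T -> R) (c : R) : measurable_fun setT Y ->
  (forall w, 0 <= Y w) -> P.-integrable setT (EFin \o Y) -> 0 < c ->
  (P [set w | (c < Y w)%R] <= ((\int[P]_w Y w) / c)%R%:E)%E.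
Proof.
move=> mY Y0 iY c0.
have mS : measurable [set w | c < Y w] by exact: measurable_set_lt.
rewrite EFinM lee_pdivlMr // muleC.
rewrite -[X in P X]setIT -integral_indic // -ge0_integralZl //; last 2 first.
- by apply/measurable_EFinP; exact: measurable_indic.
- by rewrite lee_fin ltW.
rewrite /Rintegral fineK; last exact: integrable_fin_num.
apply: ge0_le_integral => //.
- by move=> w _; rewrite -EFinM lee_fin mulr_ge0 ?indicE // ltW.
- by apply: measurable_funeM; apply/measurable_EFinP; exact: measurable_indic.
- exact/measurable_EFinP.
move=> w _; rewrite -EFinM lee_fin indicE; case: (boolP (w \in _)).
  by rewrite inE /= mulr1 => /ltW.
by rewrite mulr0.
Qed.

Lemma Rintegral_sum (I : Type) (r : seq I) (Y : I -> T -> R) :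
  (forall i, P.-integrable setT (EFin \o Y i)) ->
  P.-integrable setT (fun w => (\sum_(i <- r) Y i w)%:E) /\
  \int[P]_w (\sum_(i <- r) Y i w) = \sum_(i <- r) \int[P]_w Y i w.
Proof.
move=> iY; elim: r => [|i r [IH1 IH2]].
  split; first by under eq_fun do rewrite big_nil; exact: integrable0.
  by under eq_Rintegral do rewrite big_nil; rewrite big_nil Rintegral_cst // mul0r.
split.
  under eq_fun do rewrite big_cons EFinD.
  by apply: integrableD => //; exact: iY.
under eq_Rintegral do rewrite big_cons.
by rewrite big_cons -IH2 RintegralD //; exact: iY.
Qed.

Lemma Rintegral_walk_sum (p n k : nat) (Y : seq (nat * nat) -> T -> R) :
  (forall s, P.-integrable setT (EFin \o Y s)) ->
  P.-integrable setT (fun w => (walk_sum p n k (fun s => Y s w))%:E) /\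
  \int[P]_w (walk_sum p n k (fun s => Y s w)) = walk_sum p n k (fun s => \int[P]_w Y s w).
Proof.
elim: k Y => [|k IH] Y iY /=; first by split=> //; exact: iY.
have iti t i := IH (fun s => Y ((t, i) :: s)) (fun s => iY _).
have it (t : 'I_n) := Rintegral_sum (index_enum 'I_p) (fun i : 'I_p => proj1 (iti t i)).
have [itE1 itE2] := Rintegral_sum (index_enum 'I_n) (fun t => proj1 (it t)).
split=> //; rewrite itE2; apply: eq_bigr => t _; rewrite (proj2 (it t)).
by apply: eq_bigr => i _; rewrite (proj2 (iti t i)).
Qed.

Section Moments.
Variables (X : nat * nat -> {RV P >-> R}) (f : R -> R) (B Q : R).
Hypothesis iX : mutually_independent X.
Hypothesis mf : measurable_fun setT f.
Hypothesis B_gt0 : 0 < B.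
Hypothesis fB : forall x, `|f x| <= B.
Hypothesis f_mean : forall e, \int[P]_w f (X e w) = 0.
Hypothesis f_var : forall e, \int[P]_w (f (X e w) ^+ 2) <= Q.

Let ipow e k : P.-integrable setT (fun w => (f (X e w) ^+ k)%:E).
Proof.
apply: (@integrable_bounded (fun w => f (X e w) ^+ k) (B ^+ k)).
  by apply: measurable_funX; exact: measurable_comp_RV.
by move=> w; rewrite normrX lerXn2r ?nnegrE // ltW.
Qed.

(** The first moment vanishes, and for larger k the factor |f|^(k - 2) is at most
B^(k - 2): this is where an entry visited once by a walk disappears. *)
Lemma bounded_moment_le e k : (0 < k)%N ->
  B ^+ 2 * `|\int[P]_w (f (X e w) ^+ k)| <= Q * B ^+ k.
Proof.
case: k => // -[|k] _.
  under eq_Rintegral do rewrite expr1.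
  rewrite f_mean normr0 mulr0 mulr_ge0 ?(ltW B_gt0) ?expr1 //.
  apply: le_trans (f_var e); apply: Rintegral_ge0 => // w _; exact: sqr_ge0.
have if2 : P.-integrable setT (fun w => (B ^+ k * f (X e w) ^+ 2)%:E).
  apply: (@integrable_bounded (fun w => B ^+ k * f (X e w) ^+ 2) (B ^+ k * B ^+ 2)).
    apply: measurable_funM => //; apply: measurable_funX.
    exact: measurable_comp_RV.
  move=> w; rewrite normrM !normrX (gtr0_norm B_gt0).
  by rewrite ler_wpM2l ?exprn_ge0 ?(ltW B_gt0) // lerXn2r ?nnegrE // ltW.
have le1 : `|\int[P]_w (f (X e w) ^+ k.+2)| <= B ^+ k * Q.
  apply: (le_trans (le_normr_Rintegral measurableT (ipow e k.+2))).
  apply: (@le_trans _ _ (\int[P]_w (B ^+ k * f (X e w) ^+ 2))).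
    apply: le_Rintegral => //; first exact: (integrable_norm (ipow e k.+2)).
    move=> w _; rewrite normrX -addn2 exprD real_normK ?num_real //.
    by rewrite ler_wpM2r ?sqr_ge0 // lerXn2r ?nnegrE // ltW.
  rewrite RintegralZl //; last exact: ipow.
  by rewrite ler_wpM2l // exprn_ge0 // ltW.
have -> : Q * B ^+ k.+2 = B ^+ 2 * (B ^+ k * Q) by rewrite -addn2 exprD; ring.
by rewrite ler_wpM2l // sqr_ge0.
Qed.

(** By independence the expectation factors over the distinct entries, and each
distinct entry gains a factor Q / B^2 over the trivial bound. *)
Lemma prod_moment_le (es : seq (nat * nat)) :
  B ^+ 2 ^+ size (undup es) * `|\int[P]_w (\prod_(e <- es) f (X e w))| <=
  Q ^+ size (undup es) * B ^+ size es.
Proof.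
have prodE (g : nat * nat -> R) : \prod_(e <- es) g e =
    \prod_(e <- undup es) g e ^+ count_mem e es.
  by rewrite -big_undup_iterop_count; apply: eq_bigr.
under eq_Rintegral do rewrite prodE.
rewrite (Rintegral_prod_indep iX (g := fun e x => f x ^+ count_mem e es)); first last.
- exact: undup_uniq.
- by move=> e; exact: ipow.
- by move=> e; exact: measurable_funX.
have -> : B ^+ size es = \prod_(e <- undup es) B ^+ count_mem e es.
  by rewrite -(prodE (fun=> B)) big_const_seq count_predT -Monoid.iteropE.
have : {in undup es, forall e, (0 < count_mem e es)%N}.
  by move=> e; rewrite mem_undup -has_count has_pred1.
have := bounded_moment_le; have := sqr_ge0 B; move: (B ^+ 2) => B2 B2_ge0 le_mom.
elim: (undup es) => [|e u IH] es0; first by rewrite !big_nil normr1 !expr0 mulr1.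
rewrite !big_cons /= !exprS normrM mulrACA [leRHS]mulrACA.
apply: ler_pM; rewrite ?mulr_ge0 ?exprn_ge0 ?(ltW B_gt0) //.
  by apply: le_mom; apply: es0; rewrite mem_head.
by apply: IH => e' e'u; apply: es0; rewrite inE e'u orbT.
Qed.

Lemma second_moment_bound_ge0 : 0 <= Q.
Proof.
apply: le_trans (f_var (0, 0)%N); apply: Rintegral_ge0 => // w _.
exact: sqr_ge0.
Qed.

Section Bound.
Variables (p n : nat).
Hypothesis p_gt0 : (0 < p)%N.
Hypothesis n_gt0 : (0 < n)%N.
Hypothesis pQ : p%:R * Q <= B ^+ 2.
Hypothesis npQ : n%:R * p%:R * Q ^+ 2 <= B ^+ 4.

(** The gain Q / B^2 per edge pays for the choice of the vertices. By
[walk_count], p^r n^c Q^e is at most p times e - 2 c factors p Q and c factors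
n p Q^2, and each of these is at most the corresponding power of B. *)
Lemma walk_weight_le a s : walk_steps a s ->
  p%:R ^+ nb_rows a s * n%:R ^+ nb_cols s * Q ^+ nb_edges a s <=
  p%:R * B ^+ 2 ^+ nb_edges a s.
Proof.
move=> /walk_count[]; move: (nb_rows a s) (nb_cols s) (nb_edges a s) => r c e rc ce.
have Q0 := second_moment_bound_ge0.
have p1 : 1 <= p%:R :> R by rewrite ler1n.
apply: (@le_trans _ _ (p%:R ^+ (e.+1 - c) * n%:R ^+ c * Q ^+ e)).
  rewrite -!mulrA ler_wpM2r ?mulr_ge0 ?exprn_ge0 //.
  by apply: ler_weXn2l => //; lia.
have -> : (p%:R : R) ^+ (e.+1 - c) * n%:R ^+ c * Q ^+ e =
    p%:R * ((p%:R * Q) ^+ (e - 2 * c) * (n%:R * p%:R * Q ^+ 2) ^+ c).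
  rewrite (_ : (e.+1 - c)%N = (1 + (e - 2 * c) + c)%N); last by lia.
  rewrite (_ : Q ^+ e = Q ^+ (e - 2 * c) * Q ^+ 2 ^+ c); last first.
    by rewrite -exprM -exprD; congr (_ ^+ _); lia.
  by rewrite !exprD !exprMn expr1; ring.
rewrite ler_wpM2l //.
have -> : B ^+ 2 ^+ e = B ^+ 2 ^+ (e - 2 * c) * B ^+ 4 ^+ c.
  by rewrite -!exprM -exprD; congr (_ ^+ _); lia.
apply: ler_pM; rewrite ?exprn_ge0 ?mulr_ge0 ?exprn_ge0 //;
  apply: lerXn2r; rewrite ?nnegrE ?mulr_ge0 ?exprn_ge0 ?(ltW B_gt0) //.
Qed.

Lemma walk_expectation_le a s : walk_steps a s ->
  `|\int[P]_w (\prod_(e <- walk_edges a s) f (X e w))| <=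
  p%:R * B ^+ (size s).*2 * (p%:R ^- nb_rows a s * n%:R ^- nb_cols s).
Proof.
move=> /walk_weight_le le_w.
have := prod_moment_le (walk_edges a s); rewrite size_walk_edges => le_E.
have p0 : 0 < p%:R :> R by rewrite ltr0n.
have n0 : 0 < n%:R :> R by rewrite ltr0n.
have c0 : 0 < (p%:R : R) ^+ nb_rows a s * n%:R ^+ nb_cols s.
  by rewrite mulr_gt0 // exprn_gt0.
have B0 : 0 < B ^+ 2 ^+ nb_edges a s by rewrite !exprn_gt0.
rewrite -invfM ler_pdivlMr // -(ler_pM2r B0).
move: le_E le_w c0 B0; rewrite -/(nb_edges a s).
move: (_ ^+ nb_rows a s * _) (B ^+ 2 ^+ _) (Q ^+ _) => c b2 qe le_E le_w c0 b20.
move: (`|_|) le_E => E le_E.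
apply: (@le_trans _ _ (c * (qe * B ^+ (size s).*2))).
  by rewrite (mulrC E) -mulrA ler_wpM2l ?(ltW c0) // mulrC.
by rewrite mulrA [leRHS]mulrAC ler_wpM2r // exprn_ge0 // ltW.
Qed.

(** The trace is a sum over closed walks of expectations of products of entries.
What remains of their bound, p^(- r) n^(- c), has a sum depending on k only. *)
Lemma trace_moment_le k :
  P.-integrable setT (fun w => (\tr (offgram p n (fun e => f (X e w))
                                     (fun e => f (X e w)) ^+ k))%:E) /\
  \int[P]_w (\tr (offgram p n (fun e => f (X e w)) (fun e => f (X e w)) ^+ k)) <=
  p%:R * B ^+ k.*2 * (k.+1`! * k`!)%:R.
Proof.
pose Y (a : 'I_p) s w := if walk_steps (val a) s && (walk_end (val a) s == val a)
  then \prod_(e <- walk_edges (val a) s) f (X e w) else 0.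
have iY a s : P.-integrable setT (EFin \o Y a s).
  rewrite /Y; case: (walk_steps _ _ && _); last exact: integrable0.
  apply: (@integrable_bounded _ (B ^+ size (walk_edges (val a) s))).
    by apply: measurable_prod => e _; exact: measurable_comp_RV.
  move=> w; rewrite normr_prod.
  elim: walk_edges => [|e es IH]; first by rewrite big_nil expr0.
  by rewrite big_cons exprS ler_pM // prodr_ge0.
have iYk a := Rintegral_walk_sum p n k (iY a).
have [iS ES] := Rintegral_sum (index_enum 'I_p) (fun a => proj1 (iYk a)).
under eq_fun do rewrite offgram_trace.
split; first exact: iS.
under eq_Rintegral do rewrite offgram_trace.
rewrite ES.
apply: (@le_trans _ _ (\sum_(a < p) walk_sum p n k (fun s =>
    p%:R * B ^+ k.*2 * (p%:R ^- nb_rows a s * n%:R ^- nb_cols s)))).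
  apply: ler_sum => a _; rewrite (proj2 (iYk a)); apply: le_walk_sum => s sk.
  apply: le_trans (ler_norm _) _; rewrite /Y.
  case E : (walk_steps _ _ && _).
    move: E => /andP[ws _].
    by rewrite -sk; exact: walk_expectation_le.
  rewrite Rintegral_cst // mul0r normr0 !mulr_ge0 ?invr_ge0 ?exprn_ge0 //.
  exact: ltW.
under eq_bigr do rewrite walk_sumZ.
rewrite -mulr_sumr ler_wpM2l ?sum_walk_le //.
by rewrite mulr_ge0 // exprn_ge0 // ltW.
Qed.

End Bound.
End Moments.

Section FrobeniusMoment.
Variables (X : nat * nat -> {RV P >-> R}) (f g : R -> R) (a b u v : R).
Hypothesis iX : mutually_independent X.
Hypotheses (mf : measurable_fun setT f) (mg : measurable_fun setT g).
Hypothesis if2 : forall e, P.-integrable setT (fun w => (f (X e w) ^+ 2)%:E).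
Hypothesis ig2 : forall e, P.-integrable setT (fun w => (g (X e w) ^+ 2)%:E).
Hypothesis f_var : forall e, \int[P]_w (f (X e w) ^+ 2) <= a.
Hypothesis g_var : forall e, \int[P]_w (g (X e w) ^+ 2) <= b.
Hypothesis f_mean : forall e, `|\int[P]_w f (X e w)| <= u.
Hypothesis g_mean : forall e, `|\int[P]_w g (X e w)| <= v.

(** On a probability space, because |Y| <= 1 + Y^2. *)
Lemma integrable_of_sqr (Y : T -> R) : measurable_fun setT Y ->
  P.-integrable setT (fun w => (Y w ^+ 2)%:E) -> P.-integrable setT (EFin \o Y).
Proof.
move=> mY iY2.
have i1 : P.-integrable setT (fun w => (1 + Y w ^+ 2)%:E).
  under eq_fun do rewrite EFinD.
  by apply: integrableD => //; exact: finite_measure_integrable_cst.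
apply: le_integrable i1 => //; first exact/measurable_EFinP.
move=> w _ /=; rewrite lee_fin (ger0_norm (_ : 0 <= 1 + Y w ^+ 2)); last first.
  by rewrite addr_ge0 ?sqr_ge0.
rewrite -[Y w ^+ 2]real_normK ?num_real //.
have := sqr_ge0 (`|Y w| - 1); have := normr_ge0 (Y w); nra.
Qed.

Let i_f e : P.-integrable setT (fun w => (f (X e w))%:E).
Proof.
by apply: (@integrable_of_sqr (fun w => f (X e w))); [exact: measurable_comp_RV|].
Qed.

Let i_g e : P.-integrable setT (fun w => (g (X e w))%:E).
Proof.
by apply: (@integrable_of_sqr (fun w => g (X e w))); [exact: measurable_comp_RV|].
Qed.

Let quad (i j t s : nat) w :=
  (f (X (i, t) w) * g (X (j, t) w)) * (f (X (i, s) w) * g (X (j, s) w)).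

(** The four entries are distinct unless the columns t and s coincide, when they
form two squares. *)
Lemma quad_moment i j t s : i != j ->
  P.-integrable setT (fun w => (quad i j t s w)%:E) /\
  \int[P]_w quad i j t s w <= if t == s then a * b else u ^+ 2 * v ^+ 2.
Proof.
move=> ij; have ji : (j == i) = false by rewrite eq_sym (negbTE ij).
have [ts|ts] := eqVneq t s.
  pose h (e : nat * nat) x := if e.1 == i then f x ^+ 2 else g x ^+ 2.
  have mh e : measurable_fun setT (h e).
    by rewrite /h; case: (e.1 == i); exact: measurable_funX.
  have ih e : P.-integrable setT (fun w => (h e (X e w))%:E).
    by rewrite /h; case: (e.1 == i).
  have uJ : uniq [:: (i, t); (j, t)].
    by rewrite /= andbT inE xpair_eqE (negbTE ij).
  have qE : quad i j t s =
      fun w => \prod_(e <- [:: (i, t); (j, t)]) h e (X e w).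
    apply/funext => w; rewrite big_cons big_seq1 /h /= eqxx ji /quad -ts.
    by ring.
  rewrite qE; split; first exact: integrable_prod_indep.
  rewrite Rintegral_prod_indep // big_cons big_seq1 /h /= eqxx ji.
  by apply: ler_pM => //; apply: Rintegral_ge0 => // w _; exact: sqr_ge0.
pose h (e : nat * nat) x := if e.1 == i then f x else g x.
have mh e : measurable_fun setT (h e) by rewrite /h; case: (e.1 == i).
have ih e : P.-integrable setT (fun w => (h e (X e w))%:E).
  by rewrite /h; case: (e.1 == i).
have uJ : uniq [:: (i, t); (i, s); (j, t); (j, s)].
  rewrite /= !inE !xpair_eqE !eqxx (negbTE ij) (negbTE ts) /= ?andbF //.
have qE : quad i j t s =
    fun w => \prod_(e <- [:: (i, t); (i, s); (j, t); (j, s)]) h e (X e w).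
  apply/funext => w; rewrite !big_cons big_nil /h /= eqxx ji /quad.
  by ring.
rewrite qE; split; first exact: integrable_prod_indep.
rewrite Rintegral_prod_indep // !big_cons big_nil /h /= eqxx ji mulr1 !expr2.
apply: le_trans (ler_norm _) _; rewrite !normrM -!mulrA.
by rewrite !ler_pM // !mulr_ge0.
Qed.

Lemma frob2_moment_le (p n : nat) :
  P.-integrable setT (fun w => (frob2 (offgram p n (fun e => f (X e w))
                                                   (fun e => g (X e w))))%:E) /\
  \int[P]_w (frob2 (offgram p n (fun e => f (X e w)) (fun e => g (X e w)))) <=
  p%:R ^+ 2 * (n%:R * (a * b) + n%:R ^+ 2 * (u ^+ 2 * v ^+ 2)).
Proof.
pose Y (i j : 'I_p) (t s : 'I_n) w := if i == j then 0 else quad i j t s w.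
have Y_le i j t s : P.-integrable setT (EFin \o Y i j t s) /\
    \int[P]_w Y i j t s w <= (if t == s then a * b else 0) + u ^+ 2 * v ^+ 2.
  have ab0 : 0 <= a * b.
    rewrite mulr_ge0 //; first apply: le_trans (f_var (0, 0)%N).
      by apply: Rintegral_ge0 => // w _; exact: sqr_ge0.
    apply: le_trans (g_var (0, 0)%N).
    by apply: Rintegral_ge0 => // w _; exact: sqr_ge0.
  have uv0 : 0 <= u ^+ 2 * v ^+ 2 by rewrite mulr_ge0 ?sqr_ge0.
  rewrite /Y; have [ij|ij] := eqVneq i j.
    split; first exact: integrable0.
    rewrite Rintegral_cst // mul0r; case: (t == s); lra.
  have [iq qle] := @quad_moment i j t s ij.
  split=> //; apply: le_trans qle _; rewrite (inj_eq val_inj).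
  by case: (t == s); lra.
have fE w : frob2 (offgram p n (fun e => f (X e w)) (fun e => g (X e w))) =
    \sum_i \sum_j \sum_t \sum_s Y i j t s w.
  apply: eq_bigr => i _; apply: eq_bigr => j _; rewrite mxE /Y.
  case: (i == j).
    by rewrite expr0n /= big1 // => t _; rewrite big1.
  rewrite expr2 mulr_suml; apply: eq_bigr => t _.
  by rewrite mulr_sumr; apply: eq_bigr.
have is4 i j t := Rintegral_sum (index_enum 'I_n) (fun s => proj1 (Y_le i j t s)).
have is3 i j := Rintegral_sum (index_enum 'I_n) (fun t => proj1 (is4 i j t)).
have is2 i := Rintegral_sum (index_enum 'I_p) (fun j => proj1 (is3 i j)).
have [is1 E1] := Rintegral_sum (index_enum 'I_p) (fun i => proj1 (is2 i)).
under eq_fun do rewrite fE; split; first exact: is1.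
under eq_Rintegral do rewrite fE.
rewrite E1.
apply: (@le_trans _ _ (\sum_(i < p) \sum_(j < p)
   (n%:R * (a * b) + n%:R ^+ 2 * (u ^+ 2 * v ^+ 2)))).
  apply: ler_sum => i _; rewrite (proj2 (is2 i)).
  apply: ler_sum => j _; rewrite (proj2 (is3 i j)).
  apply: (@le_trans _ _ (\sum_(t < n) (a * b + n%:R * (u ^+ 2 * v ^+ 2)))).
    apply: ler_sum => t _; rewrite (proj2 (is4 i j t)).
    apply: (@le_trans _ _
      (\sum_(s < n) ((if t == s then a * b else 0) + u ^+ 2 * v ^+ 2))).
      by apply: ler_sum => s _; exact: (proj2 (Y_le i j t s)).
    rewrite big_split /= sumr_const card_ord -[_ *+ n]mulr_natl lerD2r.
    by rewrite -big_mkcond /= (big_pred1 t) // => s; rewrite eq_sym.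
  rewrite sumr_const card_ord -[_ *+ n]mulr_natl mulrDr expr2; lra.
rewrite !sumr_const card_ord -mulrnA -[_ *+ (p * p)]mulr_natl natrM expr2; lra.
Qed.

End FrobeniusMoment.
End TraceMoments.

(** * Uniform convergence for slowly varying functions *)

Section UniformIncrements.
Variable R : realType.
Local Notation mu := (@lebesgue_measure R).

Lemma measurable_addr (u : R) : measurable_fun setT (fun x : R => u + x).
Proof. exact: measurable_funD. Qed.

(** Both sides are measures agreeing on half-open intervals. *)
Lemma lebesgue_measure_translation (u : R) (A : set R) : measurable A ->
  mu ((fun x => u + x) @^-1` A) = mu A.
Proof.
pose tr : {mfun (measurableTypeR R) >-> (measurableTypeR R)} :=
  @mfun_Sub _ _ (measurableTypeR R) (measurableTypeR R) (fun x : R => u + x)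
    (mem_set (measurable_addr u)).
move=> mA; apply/esym.
apply: (@lebesgue_measure_unique R (pushforward mu tr)) => //.
move=> _ [[a b]] _ <-; rewrite /pushforward.
have E : tr @^-1` `]a, b]%classic = `]a - u, b - u]%classic.
  by apply/seteqP; split=> x /=; rewrite !in_itv /= ltrBlDl lerBrDl.
transitivity (mu (tr @^-1` `]a, b]%classic)); last by [].
rewrite E.
rewrite !lebesgue_measure_itv /= !lte_fin ltrD2r -!EFinB.
by rewrite (_ : b - u - (a - u) = b - a) //; ring.
Qed.

Lemma near_pinftyP (Q : R -> Prop) :
  (\forall x \near +oo, Q x) <-> exists M, forall x, M <= x -> Q x.
Proof.
split=> [[M [_ MQ]]|[M MQ]].
  by exists (M + 1) => x Mx; apply: MQ; apply: lt_le_trans Mx; rewrite ltrDl.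
by exists M; split=> [|x Mx]; [exact: num_real|apply/MQ/ltW].
Qed.

Variable h : R -> R.
Hypothesis mh : measurable_fun setT h.
Hypothesis h_incr : forall u, h (y + u) - h y @[y --> +oo] --> (0 : R).

(** In the application h y = ln (L (exp y)), for which slow variation of L says
that the increments of h over any fixed length tend to zero. *)
Lemma increments_small (u e : R) : 0 < e ->
  exists M : R, forall y : R, M <= y -> `|h (y + u) - h y| < e.
Proof.
move=> e0; apply/near_pinftyP.
have /cvgrPdist_lt/(_ _ e0) := h_incr u.
by apply: filterS => y; rewrite sub0r normrN.
Qed.

(** The shifts v whose effect on h is small all along the tail of z. They exhaust
[0, 2] as n grows, because the increments vanish for each v. *)
Definition stable_set (z : nat -> R) n : set R := [set v | v \in `[0, 2] /\
  forall m, (n <= m)%N -> `|h (z m + v) - h (z m)| < 1 / 2].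

Lemma measurable_stable_set z n : measurable (stable_set z n).
Proof.
have -> : stable_set z n = `[0, 2]%classic `&`
    \bigcap_(m in [set m | (n <= m)%N])
      [set v | `|h (z m + v) - h (z m)| < 1 / 2].
  by apply/seteqP; split.
apply: measurableI => //; apply: bigcap_measurable.
  by exists n => /=.
move=> m _; apply: measurable_set_lt => //; apply: measurableT_comp => //.
apply: measurable_funB => //.
by apply: (measurableT_comp mh); exact: measurable_addr.
Qed.

Lemma stable_set_gt (z : nat -> R) : (forall n, n%:R <= z n) ->
  exists N, forall n, (N <= n)%N -> ((3 / 2)%:E < mu (stable_set z n))%E.
Proof.
move=> z_ge; have mV := measurable_stable_set z.
have V_nd : {homo stable_set z : n m / (n <= m)%N >-> (n <= m)%O}.
  move=> n m nm; apply/subsetPset => v [v2 vV]; split=> // k mk.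
  by apply: vV; exact: leq_trans mk.
have V_cup : \bigcup_n stable_set z n = `[0, 2]%classic.
  apply/seteqP; split=> [v [n _ []]|v v2] //.
  have [|M hM] := @increments_small v (1 / 2); first by lra.
  exists (Num.bound `|M|) => //; split=> // m Mm; apply: hM.
  apply: le_trans (z_ge m); apply: le_trans (ler_norm _) _.
  apply: le_trans (ltW (archi_boundP (normr_ge0 _))) _.
  by rewrite ler_nat.
have [N VN] : exists N, ((3 / 2)%:E < mu (stable_set z N))%E.
  apply: contrapT => noN.
  have VN n : (mu (stable_set z n) <= (3 / 2)%:E)%E.
    by rewrite leNgt; apply/negP => ?; apply: noN; exists n.
  have cV := nondecreasing_cvg_mu (mu := mu) mV (bigcup_measurable (fun n _ => mV n)) V_nd.
  have : (mu (\bigcup_n stable_set z n) <= (3 / 2)%:E)%E.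
    rewrite -(cvg_lim _ cV) //; apply: lime_le; first by apply/cvg_ex; eexists; exact: cV.
    exact: nearW.
  by rewrite V_cup lebesgue_measure_itv /= lte_fin ltr0n /= -EFinB lee_fin; lra.
exists N => n Nn; apply: lt_le_trans VN _.
apply: le_measure; rewrite ?inE; [exact: mV|exact: mV|].
by have /subsetPset := V_nd _ _ Nn.
Qed.

(** Otherwise there are y_n tending to infinity and u_n in [0, 1] with increments
above 1. For large n the stable set of y_n and the stable set of y_n + u_n moved
by u_n lie in [0, 3] and both have measure above 3/2, so they share a point v:
then h (y_n + v) is within 1/2 of h at y_n and at y_n + u_n, a contradiction. *)
Lemma increments_bounded :
  exists M : R, forall y u : R, M <= y -> u \in `[0, 1] -> `|h (y + u) - h y| <= 1.
Proof.
apply: contrapT => noM.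
have yu n : exists yu : R * R, [/\ n%:R <= yu.1, yu.2 \in `[0, 1] &
    1 < `|h (yu.1 + yu.2) - h yu.1|].
  apply: contrapT => noyu; apply: noM; exists n%:R => y u ny u01.
  by rewrite leNgt; apply/negP => ?; apply: noyu; exists (y, u).
have [yu_ yuP] := choice yu.
pose y n := (yu_ n).1; pose u n := (yu_ n).2.
have y_ge n : n%:R <= y n by case: (yuP n).
have u01 n : 0 <= u n <= 1 by case: (yuP n) => _; rewrite in_itv.
have yu_ge n : n%:R <= y n + u n.
  by apply: le_trans (y_ge n) _; rewrite lerDl; case/andP: (u01 n).
have [N1 V1] := stable_set_gt y_ge.
have [N2 V2] := stable_set_gt yu_ge.
pose n := maxn N1 N2.
pose A := stable_set y n; pose B := (fun x => - u n + x) @^-1` stable_set (fun n => y n + u n) n.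
have mA : measurable A := measurable_stable_set y n.
have mB0 := measurable_stable_set (fun n => y n + u n) n.
have mB : measurable B.
  by rewrite -[B]setTI; exact: (measurable_addr (- u n)).
have muA : ((3 / 2)%:E < mu A)%E by apply: V1; rewrite leq_maxl.
have muB : ((3 / 2)%:E < mu B)%E.
  by rewrite lebesgue_measure_translation //; apply: V2; rewrite leq_maxr.
have [v [[_ Av] [_ Bv]]] : A `&` B !=set0.
  apply/set0P/eqP => AB0.
  have AB3 : A `|` B `<=` `[0, 3]%classic.
    move=> x [[]|[]]; rewrite /= !in_itv /=; have := u01 n; lra.
  have : (mu (A `|` B) <= 3%:E)%E.
    have -> : 3%:E = mu (`[0, 3]%classic : set R).
      by rewrite lebesgue_measure_itv /= lte_fin ltr0n /= -EFinB subr0.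
    by apply: le_measure; rewrite ?inE //; exact: measurableU.
  rewrite measureU // leNgt => /negP; apply.
  have -> : 3%:E = ((3 / 2)%:E + (3 / 2)%:E)%E :> \bar R by rewrite -EFinD; congr _%:E; lra.
  exact: lteD.
have := Av n (leqnn n); have := Bv n (leqnn n).
rewrite (_ : y n + u n + (- u n + v) = y n + v); last by ring.
have [_ _] := yuP n; rewrite -/(y n) -/(u n).
move: (h (y n + v)) (h (y n + u n)) (h (y n)) => c b a.
rewrite ltNge ler_norml !ltr_norml => /negP nba /andP[? ?] /andP[? ?].
by apply: nba; apply/andP; split; lra.
Qed.

(** Far enough, a unit step increases h by at most e / 2; the bound on increments
over [0, 1] accounts for the fractional part. *)
Lemma sublinear (e : R) : 0 < e -> exists M : R, forall y : R, M <= y -> h y <= e * y.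
Proof.
move=> e0; have [M1 hM1] := increments_bounded.
have [|M2 hM2] := @increments_small 1 (e / 2); first by lra.
pose M := `|M1| + `|M2|.
have M0 : 0 <= M by rewrite addr_ge0.
have hM k : h (M + k%:R) <= h M + k%:R * (e / 2).
  elim: k => [|k IH]; first by rewrite addr0 mul0r addr0.
  have /hM2 : M2 <= M + k%:R.
    have := ler_norm M2; have := normr_ge0 M1; have := ler0n R k.
    by rewrite /M; lra.
  rewrite -[k.+1%:R]natr1 addrA ltr_norml => /andP[_]; lra.
exists (M + `|2 * (h M + 1) / e|) => y My.
have yM : 0 <= y - M by have := normr_ge0 (2 * (h M + 1) / e); lra.
have [k /andP[k1 k2]] : exists k : nat, k%:R <= y - M < k.+1%:R.
  by exists (Num.trunc (y - M)); rewrite truncn_itv.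
have := hM k.
have : M1 <= M + k%:R.
  by have := ler_norm M1; have := normr_ge0 M2; have := ler0n R k; rewrite /M; lra.
move=> /(hM1 _ (y - M - k%:R)).
rewrite (_ : M + k%:R + (y - M - k%:R) = y); last by ring.
rewrite -[k.+1%:R]natr1 in k2.
rewrite in_itv /= subr_ge0 k1 lerBlDl ltW //= => /(_ isT).
rewrite ler_norml => /andP[_ hy] hk.
have : 2 * (h M + 1) / e <= y - M.
  by apply: le_trans (ler_norm _) _; lra.
rewrite ler_pdivrMr // => hy2.
have : k%:R * e <= (y - M) * e by rewrite ler_pM2r.
have : 0 <= M * e by rewrite mulr_ge0 // ltW.
lra.
Qed.

End UniformIncrements.

(** * Regularly varying tails and moments *)

Section RegularVariation.
Variable R : realType.

Lemma cvg_pinfty_shift (f : R -> R) (c l : R) : 0 < c ->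
  f x @[x --> +oo] --> l -> f (c * x) @[x --> +oo] --> l.
Proof.
move=> c0 /cvgrPdist_lt fl; apply/cvgrPdist_lt => e e0.
have /near_pinftyP[M fM] := fl _ e0.
apply/near_pinftyP; exists (M / c) => x Mx; apply: fM.
by move: Mx; rewrite ler_pdivrMr // mulrC.
Qed.

(** This is [sublinear] for h y = ln (L (exp y)). *)
Lemma slowly_varying_le (L : R -> R) (e : R) : slowly_varying L -> 0 < e ->
  exists M : R, forall x : R, M <= x -> L x <= x `^ e.
Proof.
move=> [[a [mL L0]] Lsv] e0.
(* L is measurable on a half-line only, so it is extended by 0. *)
pose L1 := L \_ `[a, +oo[; pose h y := ln (L1 (expR y)).
have L1E x : a <= x -> L1 x = L x.
  by move=> ax; rewrite /L1 patchE mem_set //= in_itv /= ax.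
have mL1 : measurable_fun setT L1.
  apply: (proj1 (measurable_restrict (D := `[a, +oo[) (E := setT) L _ _)) => //.
  by rewrite setTI.
have mh : measurable_fun setT h.
  apply: (measurableT_comp (measurable_ln (R := R))).
  by apply: (measurableT_comp mL1); exact: measurable_expR.
have h_incr u : h (y + u) - h y @[y --> +oo] --> (0 : R).
  pose c := expR u; have c0 : 0 < c by exact: expR_gt0.
  have := Lsv c c0 => Lc.
  have : ln (L (c * x) / L x) @[x --> +oo] --> ln (1 : R).
    by apply: (continuous_cvg _ (continuous_ln (ltr01 : 0 < 1 :> R))) => //; exact: Lc.
  rewrite ln1 => /cvgrPdist_lt lnc; apply/cvgrPdist_lt => e' e'0.
  have /near_pinftyP[M hM] := lnc _ e'0.
  pose M' := Num.max 1 (Num.max M (Num.max a (a / c))).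
  apply/near_pinftyP; exists (ln M') => y My.
  have M'0 : 0 < M' by rewrite lt_max ltr01.
  have xM' : M' <= expR y by rewrite -[M']lnK ?posrE // ler_expR.
  move: xM'; rewrite !ge_max => /and4P[_ /hM hx ax acx].
  have acx' : a <= c * expR y by move: acx; rewrite ler_pdivrMr // mulrC.
  rewrite /h (addrC y u) expRD -/c !L1E // -ln_div ?posrE ?L0 //.
have [M hM] := sublinear mh h_incr e0.
pose M' := Num.max 1 (Num.max (expR M) a).
exists M' => x; rewrite !ge_max => /and3P[x1 xM ax].
have x0 : 0 < x by exact: lt_le_trans x1.
have lnx : M <= ln x by rewrite -ler_expR lnK.
have := hM _ lnx; rewrite /h lnK ?posrE // L1E //.
by rewrite -ler_expR lnK ?posrE ?L0 // /powR gt_eqF.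
Qed.

Lemma ltr_powR2 (r s : R) : r < s -> 2 `^ r < 2 `^ s :> R.
Proof.
move=> rs; have two0 : (2 == 0 :> R) = false by rewrite pnatr_eq0.
by rewrite /powR two0 ltr_expR ltr_pM2r // ln_gt0 // ltr1n.
Qed.

Lemma dyadic_cover (x0 x : R) : 0 < x0 -> x0 < x ->
  exists k : nat, 2 ^+ k * x0 < x <= 2 ^+ k.+1 * x0.
Proof.
move=> x00 xx.
have ex_k : exists k : nat, x <= 2 ^+ k * x0.
  have x_x0 : 0 <= x / x0 by rewrite divr_ge0 ?ltW // (lt_trans x00).
  exists (Num.bound (x / x0)); rewrite -ler_pdivrMr //.
  apply: le_trans (ltW (archi_boundP x_x0)) _.
  by rewrite -natrX ler_nat ltnW // ltn_expl.
case: (ex_minnP ex_k) => -[|k] xk k_min.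
  by move: xk; rewrite expr0 mul1r leNgt xx.
exists k; rewrite xk andbT ltNge; apply/negP => /k_min; by rewrite ltnn.
Qed.

Section Tail.
Variables (H L : R -> R) (alpha : R).
Hypothesis H_nincr : forall x y, x <= y -> H y <= H x.
Hypothesis H_ge0 : forall x, 0 <= H x.
Hypothesis L_sv : slowly_varying L.
Hypothesis HL : H x / (L x * x `^ (- alpha)) @[x --> +oo] --> (1 : R).

Lemma tail_gt0_near : exists M : R, 0 < M /\ forall x, M <= x -> 0 < H x.
Proof.
have /cvgrPdist_lt/(_ _ ltr01)/near_pinftyP[M hM] := HL.
exists (Num.max 1 M); split; first by rewrite lt_max ltr01.
move=> x; rewrite ge_max => /andP[_ /hM]; rewrite lt0r H_ge0 andbT.
by apply: contraTN => /eqP ->; rewrite mul0r subr0 normr1 ltxx.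
Qed.

Lemma tail_gt0 x : 0 < H x.
Proof.
have [M [M0 hM]] := tail_gt0_near.
apply: (@lt_le_trans _ _ (H (Num.max M x))).
  by apply: hM; rewrite le_max lexx.
by apply: H_nincr; rewrite le_max lexx orbT.
Qed.

(** The dyadic form of regular variation; its iteration gives the power bounds
below. *)
Lemma tail_doubling : H (2 * x) / H x @[x --> +oo] --> 2 `^ (- alpha).
Proof.
have [[a [_ L0]] Lsv] := L_sv.
(* H (2x) / H x = (r (2x) / r x) * (L (2x) / L x) * 2^(- alpha). *)
pose r x := H x / (L x * x `^ (- alpha)).
have r2 : r (2 * x) @[x --> +oo] --> (1 : R) by apply: (@cvg_pinfty_shift r).
have : (r (2 * x) / r x) * (L (2 * x) / L x) * 2 `^ (- alpha) @[x --> +oo]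
    --> (1 / 1 * 1 * 2 `^ (- alpha) : R).
  apply: cvgM; last exact: cvg_cst.
  apply: cvgM; last exact: Lsv.
  by apply: cvgM => //; apply: cvgV => //; rewrite oner_eq0.
rewrite divr1 !mul1r; apply: cvg_trans; apply: near_eq_cvg.
apply/near_pinftyP; exists (Num.max 1 a) => x; rewrite ge_max => /andP[x1 ax].
have x0 : 0 < x by exact: lt_le_trans x1.
have Lx : L x != 0 by rewrite gt_eqF // L0.
have L2x : L (2 * x) != 0 by rewrite gt_eqF // L0 //; lra.
have Hx : H x != 0 by rewrite gt_eqF // tail_gt0.
have px : x `^ (- alpha) != 0 by rewrite gt_eqF // powR_gt0.
have p2 : 2 `^ (- alpha) != 0 :> R by rewrite gt_eqF // powR_gt0.
rewrite /r powRM ?ltW //; field.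
by rewrite Lx L2x Hx px p2.
Qed.

(** From some point on, doubling x divides H by at most 2^kappa; a general x is
compared with the dyadic points around it. *)
Lemma tail_lower kappa : 0 < kappa -> alpha < kappa -> exists c x0 : R,
  [/\ 0 < c, 0 < x0 & forall x, x0 < x -> c <= x `^ kappa * H x].
Proof.
move=> k0 ak.
have p2k : 2 `^ (- kappa) < 2 `^ (- alpha) :> R by apply: ltr_powR2; rewrite ltrN2.
have /cvgrPdist_lt/(_ (2 `^ (- alpha) - 2 `^ (- kappa))) := tail_doubling.
rewrite subr_gt0 => /(_ p2k)/near_pinftyP[M hM].
pose x0 := Num.max 1 M.
have x0_gt0 : 0 < x0 by rewrite lt_max ltr01.
have dbl x : x0 <= x -> 2 `^ (- kappa) * H x <= H (2 * x).
  rewrite ge_max => /andP[_ /hM]; rewrite ltr_distlC => /andP[+ _].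
  by rewrite opprB addrCA subrr addr0 ltr_pdivlMr ?tail_gt0 // => /ltW.
have dblk k : 2 `^ (- kappa) ^+ k * H x0 <= H (2 ^+ k * x0).
  elim: k => [|k IH]; first by rewrite !expr0 !mul1r.
  rewrite !exprS -!mulrA; apply: le_trans (dbl _ _); last first.
    by rewrite ler_peMl ?(ltW x0_gt0) // exprn_ege1 // ler1n.
  by rewrite ler_wpM2l // powR_ge0.
exists ((x0 / 2) `^ kappa * H x0), x0; split=> //.
  by rewrite mulr_gt0 ?tail_gt0 // powR_gt0 // divr_gt0.
move=> x xx0; have [k /andP[kx xk]] := dyadic_cover x0_gt0 xx0.
have x_gt0 : 0 < x by exact: lt_trans xx0.
have Hx : 2 `^ (- kappa) ^+ k.+1 * H x0 <= H x.
  by apply: le_trans (dblk _) _; exact: H_nincr.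
apply: le_trans (_ : x `^ kappa * (2 `^ (- kappa) ^+ k.+1 * H x0) <= _); last first.
  by rewrite ler_wpM2l // powR_ge0.
rewrite mulrA ler_wpM2r //.
have -> : 2 `^ (- kappa) ^+ k.+1 = (2 ^+ k.+1) `^ (- kappa) :> R.
  rewrite -(powR_mulrn k.+1 (powR_ge0 _ _)) -powRrM mulrC powRrM powR_mulrn //.
rewrite powRN ler_pdivlMr ?powR_gt0 ?exprn_gt0 // -powRM ?exprn_ge0 //; last first.
  by rewrite divr_ge0 // ltW.
apply: ge0_ler_powR; rewrite ?nnegrE ?(ltW k0) ?(ltW x_gt0) //.
  by rewrite mulr_ge0 ?exprn_ge0 // divr_ge0 // ltW.
by rewrite exprS mulrA divfK // mulrC ltW.
Qed.

Lemma tail_dyadic_upper gamma : gamma < alpha -> exists x0 : R,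
  0 < x0 /\ forall k, H (2 ^+ k * x0) <= 2 `^ (- gamma) ^+ k * H x0.
Proof.
move=> ga.
have p2g : 2 `^ (- alpha) < 2 `^ (- gamma) :> R by apply: ltr_powR2; rewrite ltrN2.
have /cvgrPdist_lt/(_ (2 `^ (- gamma) - 2 `^ (- alpha))) := tail_doubling.
rewrite subr_gt0 => /(_ p2g)/near_pinftyP[M hM].
pose x0 := Num.max 1 M.
have x0_gt0 : 0 < x0 by rewrite lt_max ltr01.
have dbl x : x0 <= x -> H (2 * x) <= 2 `^ (- gamma) * H x.
  rewrite ge_max => /andP[_ /hM]; rewrite ltr_distlC => /andP[_].
  by rewrite addrCA subrr addr0 ltr_pdivrMr ?tail_gt0 // => /ltW.
exists x0; split=> //; elim=> [|k IH]; first by rewrite !expr0 !mul1r.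
rewrite !exprS -!mulrA; apply: (le_trans (dbl _ _)).
  by rewrite ler_peMl ?(ltW x0_gt0) // exprn_ege1 // ler1n.
by rewrite ler_wpM2l // powR_ge0.
Qed.

End Tail.
End RegularVariation.

Section TailMoments.
Context (d : measure_display) (T : measurableType d) (R : realType)
  (P : probability T R).

(** On the shell 2^k x0 < |Z| <= 2^(k + 1) x0 the integrand is at most
(2^(k + 1) x0)^gamma, so the moment is dominated by a geometric series of ratio
2^(gamma - gamma'). *)
Lemma abs_moment_lty (Z : {RV P >-> R}) (gamma gamma' x0 : R) :
  0 < gamma -> gamma < gamma' -> 0 < x0 ->
  (forall k, fine (P [set w | 2 ^+ k * x0 < `|Z w|]) <=
     2 `^ (- gamma') ^+ k * fine (P [set w | x0 < `|Z w|])) ->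
  (\int[P]_w (`|Z w| `^ gamma)%:E < +oo)%E.
Proof.
move=> g0 gg x00 H_le.
have mZ : measurable_fun setT (fun w => `|Z w|) by apply: measurableT_comp.
have mS k : measurable [set w | 2 ^+ k * x0 < `|Z w|].
  by apply: measurable_set_lt => //; exact: measurable_cst.
pose c k := (2 ^+ k.+1 * x0) `^ gamma.
have c0 k : 0 <= c k by exact: powR_ge0.
pose F k w := (c k * \1_[set w | 2 ^+ k * x0 < `|Z w|] w)%:E.
have F0 k w : (0 <= F k w)%E by rewrite lee_fin mulr_ge0 // indicE.
have mF k : measurable_fun setT (F k).
  apply/measurable_EFinP; apply: measurable_funM => //; exact: measurable_indic.
have le_F w : ((`|Z w| `^ gamma)%:E <= (x0 `^ gamma)%:E + \sum_(k <oo) F k w)%E.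
  have [Zx|xZ] := leP `|Z w| x0.
    apply: (@le_trans _ _ (x0 `^ gamma)%:E).
      by rewrite lee_fin; apply: ge0_ler_powR; rewrite ?nnegrE ?(ltW g0) ?(ltW x00).
    by rewrite leeDl // nneseries_ge0.
  have [k /andP[kZ Zk]] := dyadic_cover x00 xZ.
  apply: (@le_trans _ _ (F k w)).
    rewrite /F indicE mem_set // mulr1 lee_fin.
    apply: ge0_ler_powR; rewrite ?nnegrE ?(ltW g0) //.
    by rewrite mulr_ge0 ?exprn_ge0 // ltW.
  apply: (@le_trans _ _ (\sum_(k <oo) F k w)%E).
    apply: le_trans (nneseries_lim_ge k.+1 (fun n _ _ => F0 n w)).
    by rewrite big_nat_recr //= leeDr // sume_ge0.
  by rewrite leeDr // lee_fin powR_ge0.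
apply: (@le_lt_trans _ _ (\int[P]_w ((x0 `^ gamma)%:E + \sum_(k <oo) F k w))%E).
  apply: ge0_le_integral => //.
  - apply/measurable_EFinP; apply: (measurableT_comp (measurable_powR gamma)).
    exact: mZ.
  - apply: emeasurable_funD => //; exact: ge0_emeasurable_sum.
rewrite ge0_integralD //; first last.
- exact: ge0_emeasurable_sum.
- by move=> w _; exact: nneseries_ge0.
- by move=> w _; rewrite lee_fin powR_ge0.
have -> : (\int[P]_w (x0 `^ gamma)%:E = (x0 `^ gamma)%:E)%E.
  by rewrite integral_cst // [X in (_ * X)%E]probability_setT mule1.
rewrite lte_add_pinfty ?ltry //.
rewrite integral_nneseries //.
pose C := (2 * x0) `^ gamma.
pose rho := 2 `^ (gamma - gamma') : R.
have rho0 : 0 <= rho by exact: powR_ge0.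
have rho1 : rho < 1.
  by rewrite -(powRr0 2) ltr_powR2 // subr_lt0.
apply: (@le_lt_trans _ _ (\sum_(k <oo) (C * rho ^+ k)%:E)%E).
  apply: lee_nneseries => [k _ _|k _].
    by apply: integral_ge0 => w _; exact: F0.
  rewrite /F; under eq_integral do rewrite EFinM.
  rewrite ge0_integralZl ?lee_fin //; last first.
    by apply/measurable_EFinP; exact: measurable_indic.
  rewrite integral_indic // setIT.
  have PS : P [set w | 2 ^+ k * x0 < `|Z w|] \is a fin_num by exact: fin_num_measure.
  rewrite -[X in (_ * X)%E]fineK // -EFinM lee_fin.
  have H1 : fine (P [set w | x0 < `|Z w|]) <= 1.
    have mS0 : measurable [set w | x0 < `|Z w|].
      by apply: measurable_set_lt => //; exact: measurable_cst.
    rewrite -lee_fin fineK; first exact: probability_le1.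
    exact: fin_num_measure.
  have Hk : fine (P [set w | 2 ^+ k * x0 < `|Z w|]) <= 2 `^ (- gamma') ^+ k.
    by apply: le_trans (H_le k) _; rewrite ler_piMr // exprn_ge0 // powR_ge0.
  have -> : C * rho ^+ k = c k * 2 `^ (- gamma') ^+ k.
    rewrite /C /c /rho powRD ?pnatr_eq0 ?implybT // exprMn mulrA; congr (_ * _).
    have pk : (2 ^+ k : R) `^ gamma = 2 `^ gamma ^+ k.
      by rewrite -(powR_mulrn k (powR_ge0 _ _)) -powRrM mulrC powRrM powR_mulrn.
    have x20 : 0 <= 2 * x0 by rewrite mulr_ge0 // ltW.
    by rewrite exprSr -mulrA (powRM _ (exprn_ge0 k (ler0n _ 2)) x20) pk mulrC.
  by rewrite ler_wpM2l.
apply: (@le_lt_trans _ _ (C / (1 - rho))%:E); last exact: ltry.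
have C0 : 0 <= C by exact: powR_ge0.
apply: lime_le.
  by apply: is_cvg_nneseries => n _ _; rewrite lee_fin mulr_ge0 // exprn_ge0.
apply: nearW => n; rewrite sumEFin lee_fin.
have -> : \sum_(0 <= i < n) C * rho ^+ i = series (geometric C rho) n by [].
rewrite geometric_seriesE ?lt_eqF //= ler_wpM2r ?invr_ge0 ?subr_ge0 ?(ltW rho1) //.
by rewrite ler_piMr // lerBlDr lerDl exprn_ge0.
Qed.

End TailMoments.

(** * Truncation estimates *)

Section Truncation.
Context (d : measure_display) (T : measurableType d) (R : realType)
  (P : probability T R).

Definition trunc (tau x : R) : R := if `|x| <= tau then x else 0.

Lemma measurable_trunc tau : measurable_fun setT (trunc tau).
Proof.
apply: measurable_fun_ifT => //.
by apply: measurable_fun_ler => //; exact: normr_measurable.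
Qed.

Lemma norm_trunc_le tau x : 0 <= tau -> `|trunc tau x| <= tau.
Proof. by move=> t0; rewrite /trunc; case: ifP => // _; rewrite normr0. Qed.

Lemma powR_le_below (tau x a g : R) : 0 <= x -> x <= tau -> g <= a -> 0 < a ->
  x `^ a <= tau `^ (a - g) * x `^ g.
Proof.
move=> x0 xt ga a0; have [->|xn0] := eqVneq x 0.
  by rewrite powR0 ?gt_eqF // mulr_ge0 ?powR_ge0.
have -> : x `^ a = x `^ (a - g) * x `^ g by rewrite -powRD ?subrK // xn0 implybT.
rewrite ler_wpM2r ?powR_ge0 //.
by apply: ge0_ler_powR; rewrite ?nnegrE ?subr_ge0 // (le_trans x0).
Qed.

Lemma powR_le_above (tau x a g : R) : 0 < tau -> tau <= x -> a <= g ->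
  x `^ a <= tau `^ (a - g) * x `^ g.
Proof.
move=> t0 tx ag; have x0 : 0 < x by exact: lt_le_trans tx.
have -> : x `^ a = x `^ (a - g) * x `^ g.
  by rewrite -powRD ?subrK // (gt_eqF x0) implybT.
rewrite ler_wpM2r ?powR_ge0 // -opprB !powRN lef_pV2 ?posrE ?powR_gt0 //.
by apply: ge0_ler_powR; rewrite ?nnegrE ?subr_ge0 ?(ltW t0) ?(ltW x0).
Qed.

Variables (X : {RV P >-> R}) (gamma M : R).
Hypothesis X_mom : (\int[P]_w (`|X w| `^ gamma)%:E <= M%:E)%E.

Let mXg : measurable_fun setT (fun w => `|X w| `^ gamma).
Proof.
apply: (measurableT_comp (measurable_powR gamma)).
by apply: measurableT_comp.
Qed.

Lemma integrable_abs_moment : P.-integrable setT (fun w => (`|X w| `^ gamma)%:E).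
Proof.
apply/integrableP; split; first exact/measurable_EFinP.
under eq_integral do rewrite gee0_abs ?lee_fin ?powR_ge0 //.
exact: le_lt_trans X_mom (ltry _).
Qed.

(** Every truncation estimate below is a pointwise comparison with |X|^gamma. *)
Lemma Rintegral_le_moment (Y : T -> R) (c : R) : measurable_fun setT Y ->
  (forall w, `|Y w| <= c * `|X w| `^ gamma) -> 0 <= c ->
  P.-integrable setT (EFin \o Y) /\ `|\int[P]_w Y w| <= c * M.
Proof.
move=> mY Yc c0.
have icX : P.-integrable setT (fun w => (c * `|X w| `^ gamma)%:E).
  under eq_fun do rewrite EFinM.
  by apply: integrableZl => //; exact: integrable_abs_moment.
have iY : P.-integrable setT (EFin \o Y).
  apply: le_integrable icX => //; first exact/measurable_EFinP.
  move=> w _ /=; rewrite lee_fin; apply: le_trans (Yc w) _; exact: ler_norm.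
split=> //; apply: (le_trans (le_normr_Rintegral measurableT iY)).
apply: (@le_trans _ _ (\int[P]_w (c * `|X w| `^ gamma))).
  by apply: le_Rintegral => //; exact: (integrable_norm iY).
rewrite RintegralZl //; last exact: integrable_abs_moment.
rewrite ler_wpM2l // -lee_fin /Rintegral fineK //.
exact: integrable_fin_num integrable_abs_moment.
Qed.

Lemma tail_prob_le (tau : R) : 0 < tau -> 0 <= gamma ->
  (P [set w | (tau < `|X w|)%R] <= (tau `^ (- gamma) * M)%:E)%E.
Proof.
move=> t0 g0.
have mS : measurable [set w | tau < `|X w|].
  by apply: measurable_set_lt => //; exact: measurableT_comp.
have m1 : measurable_fun setT (\1_[set w | tau < `|X w|] : T -> R).
  exact: measurable_indic.
have [] := @Rintegral_le_moment (\1_[set w | tau < `|X w|]) (tau `^ (- gamma)) m1.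
- move=> w; rewrite indicE; case: (boolP (w \in _)) => [|_].
    rewrite inE /= normr1 => /ltW tX.
    have := powR_le_above t0 tX g0.
    by rewrite powRr0 sub0r.
  by rewrite normr0 mulr_ge0 ?powR_ge0.
- exact: powR_ge0.
move=> _; rewrite {1}/Rintegral integral_indic // setIT => le_P.
have PS : P [set w | (tau < `|X w|)%R] \is a fin_num by exact: fin_num_measure.
by rewrite -[leLHS]fineK // lee_fin (le_trans (ler_norm _)).
Qed.

Lemma trunc_var_le (tau : R) : 0 < tau -> gamma <= 2 ->
  P.-integrable setT (fun w => (trunc tau (X w) ^+ 2)%:E) /\
  \int[P]_w (trunc tau (X w) ^+ 2) <= tau `^ (2 - gamma) * M.
Proof.
move=> t0 g2; have [] := @Rintegral_le_moment (fun w => trunc tau (X w) ^+ 2)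
  (tau `^ (2 - gamma)).
- by apply: measurable_funX; apply: measurable_comp_RV; exact: measurable_trunc.
- move=> w; rewrite normrX /trunc; case: ifP => [Xt|_]; last first.
    by rewrite normr0 expr0n /= mulr_ge0 ?powR_ge0.
  by rewrite -powR_mulrn //; apply: powR_le_below.
- exact: powR_ge0.
by move=> ? /(le_trans (ler_norm _)).
Qed.

Lemma overshoot_var_le (tau : R) : 0 < tau -> 2 <= gamma ->
  P.-integrable setT (fun w => ((X w - trunc tau (X w)) ^+ 2)%:E) /\
  \int[P]_w ((X w - trunc tau (X w)) ^+ 2) <= tau `^ (2 - gamma) * M.
Proof.
move=> t0 g2; have [] := @Rintegral_le_moment
  (fun w => (X w - trunc tau (X w)) ^+ 2) (tau `^ (2 - gamma)).
- apply: measurable_funX; apply: measurable_funB => //.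
  by apply: measurable_comp_RV; exact: measurable_trunc.
- move=> w; rewrite normrX /trunc; case: (leP `|X w| tau) => [_|Xt].
    by rewrite subrr normr0 expr0n /= mulr_ge0 ?powR_ge0.
  by rewrite subr0 -powR_mulrn //; apply: powR_le_above => //; exact: ltW.
- exact: powR_ge0.
by move=> ? /(le_trans (ler_norm _)).
Qed.

(** For gamma <= 1 the truncated variable is compared with |X|^gamma. Otherwise
its mean is the opposite of the mean of the part cut off, which is compared
instead. *)
Lemma trunc_mean_le (tau : R) : 0 < tau ->
  (gamma <= 1 \/
   [/\ 1 <= gamma, P.-integrable setT (EFin \o X) & \int[P]_w X w = 0]) ->
  `|\int[P]_w trunc tau (X w)| <= tau `^ (1 - gamma) * M.
Proof.
have mt : measurable_fun setT (fun w => trunc tau (X w)).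
  by apply: measurable_comp_RV; exact: measurable_trunc.
move=> t0 [g1|[g1 iX X0]].
  have [] := @Rintegral_le_moment (fun w => trunc tau (X w)) (tau `^ (1 - gamma)) mt.
  - move=> w; rewrite /trunc; case: ifP => [Xt|_]; last first.
      by rewrite normr0 mulr_ge0 ?powR_ge0.
    by rewrite -{1}[`|X w|]powRr1 //; apply: powR_le_below.
  - exact: powR_ge0.
  by [].
have [|||iB B_le] := @Rintegral_le_moment (fun w => X w - trunc tau (X w))
    (tau `^ (1 - gamma)).
- exact: measurable_funB.
- move=> w; rewrite /trunc; case: (leP `|X w| tau) => [_|Xt].
    by rewrite subrr normr0 mulr_ge0 ?powR_ge0.
  rewrite subr0 -{1}[`|X w|]powRr1 //; apply: powR_le_above => //; exact: ltW.
- exact: powR_ge0.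
have it : P.-integrable setT (fun w => (trunc tau (X w))%:E).
  apply: (@integrable_bounded _ _ _ _ (fun w => trunc tau (X w)) tau) => // w.
  by apply: norm_trunc_le; exact: ltW.
by move: B_le; rewrite RintegralB // X0 sub0r normrN.
Qed.

End Truncation.

(** * The off-diagonal part outside an exceptional event *)

Section OffDiagonalBounds.
Context (d : measure_display) (T : measurableType d) (R : realType)
  (P : probability T R).
Variables (X : nat * nat -> {RV P >-> R}) (gamma M c tau : R) (p n : nat).
Hypothesis iX : mutually_independent X.
Hypothesis X_ident : forall e (B : set R), measurable B ->
  P (X e @^-1` B) = P (X (0, 0)%N @^-1` B).
Hypothesis X_mom : forall e, (\int[P]_w (`|X e w| `^ gamma)%:E <= M%:E)%E.
Hypotheses (c0 : 0 < c) (t0 : 0 < tau).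

Let gramX w := offgram p n (fun e => X e w) (fun e => X e w).

Lemma markov_event (Y : T -> R) (a b : R) :
  P.-integrable setT (fun w => (Y w)%:E) -> (forall w, 0 <= Y w) -> 0 < a ->
  \int[P]_w Y w <= b ->
  measurable [set w | a < Y w] /\ (P [set w | (a < Y w)%R] <= (b / a)%:E)%E.
Proof.
move=> iY Y0 a0 Yb.
have mY : measurable_fun setT Y by apply/measurable_EFinP; exact: measurable_int iY.
split; first exact: measurable_set_lt.
apply: (le_trans (markov_Rintegral mY Y0 iY a0)).
by rewrite lee_fin ler_wpM2r // invr_ge0 ltW.
Qed.

Lemma probability_bigsetU_le (I : Type) (s : seq I) (S : I -> set T) :
  (forall k, measurable (S k)) ->
  (P (\big[setU/set0]_(k <- s) S k) <= \sum_(k <- s) P (S k))%E.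
Proof.
move=> mS; elim: s => [|k s IH]; first by rewrite !big_nil measure0.
rewrite !big_cons; apply: le_trans (measureU2 _ _ _) _ => //.
  by elim: s {IH} => [|j s IH]; rewrite ?big_nil // big_cons; exact: measurableU.
exact: leeD.
Qed.

(** The exceptional event is that some entry exceeds tau, or that the off-diagonal
Gram matrix of the truncated entries has Frobenius norm above c. Outside of it
truncation changes nothing and the Frobenius norm bounds the form. *)
Lemma offdiag_bound_light : 0 <= gamma <= 2 ->
  (forall e, `|\int[P]_w trunc tau (X e w)| <= tau `^ (1 - gamma) * M) ->
  exists B : set T, [/\ measurable B,
    (P B <= (n%:R * p%:R * (tau `^ (- gamma) * M) +
      p%:R ^+ 2 * (n%:R * (tau `^ (2 - gamma) * M) ^+ 2 +
         n%:R ^+ 2 * (tau `^ (1 - gamma) * M) ^+ 4) / c ^+ 2)%:E)%E &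
    forall w, ~ B w -> forall x, `|qform (gramX w) x| <= c * dotrow x x].
Proof.
move=> /andP[g0 g2] mean_le.
pose D w := offgram p n (fun e => trunc tau (X e w)) (fun e => trunc tau (X e w)).
have tv e := trunc_var_le (X_mom e) t0 g2.
have [iF F_le] := frob2_moment_le iX (@measurable_trunc R tau)
  (@measurable_trunc R tau) (fun e => proj1 (tv e)) (fun e => proj1 (tv e))
  (fun e => proj2 (tv e)) (fun e => proj2 (tv e)) mean_le mean_le p n.
have {}F_le : \int[P]_w frob2 (D w) <= p%:R ^+ 2 *
    (n%:R * (tau `^ (2 - gamma) * M) ^+ 2 +
     n%:R ^+ 2 * (tau `^ (1 - gamma) * M) ^+ 4).
  by apply: le_trans F_le _; rewrite le_eqVlt; apply/orP; left; apply/eqP; ring.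
have [mB2 PB2] := markov_event iF (fun w => frob2_ge0 _) (exprn_gt0 2 c0) F_le.
pose S (k : 'I_p * 'I_n) := [set w | tau < `|X (val k.1, val k.2) w|].
have mS k : measurable (S k).
  by apply: measurable_set_lt => //; exact: measurableT_comp.
pose B1 := \big[setU/set0]_k S k.
have mB1 : measurable B1 by exact: bigsetU_measurable.
have PB1 : (P B1 <= (n%:R * p%:R * (tau `^ (- gamma) * M))%:E)%E.
  apply: (@le_trans _ _ (\sum_k P (S k))%E).
    exact: probability_bigsetU_le.
  apply: (@le_trans _ _ (\sum_(k : 'I_p * 'I_n) (tau `^ (- gamma) * M)%:E)%E).
    by apply: lee_sum => k _; exact: (tail_prob_le (X_mom _) t0 g0).
  rewrite sumEFin sumr_const card_prod !card_ord -[_ *+ _]mulr_natl natrM.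
  by rewrite (mulrC p%:R).
exists (B1 `|` [set w | c ^+ 2 < frob2 (D w)]); split.
- exact: measurableU.
- apply: le_trans (measureU2 _ _ _) _ => //.
  by rewrite EFinD; apply: leeD.
- move=> w /not_orP[nB1 /negP]; rewrite -leNgt => F_c x.
  apply: qform_frob2; first exact: ltW.
  have -> : gramX w = D w.
    apply/matrixP => i j; rewrite !mxE; case: (i == j) => //.
    have tE (i' : 'I_p) (t : 'I_n) : trunc tau (X (val i', val t) w) = X (val i', val t) w.
      rewrite /trunc; case: (leP `|X (val i', val t) w| tau) => // tX; case: nB1.
      by rewrite /B1 -bigcup_seq; exists (i', t) => //; exact: mem_index_enum.
    by apply: eq_bigr => t _; rewrite !tE.
  exact: F_c.
Qed.

Lemma Rintegral_cst_probability (a : R) : \int[P]_w a = a.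
Proof.
rewrite Rintegral_cst // -[RHS]mulr1; congr (_ * _).
exact: (congr1 fine (probability_setT P)).
Qed.

Lemma Rintegral_center_sqr (Y : T -> R) : measurable_fun setT Y ->
  P.-integrable setT (fun w => (Y w ^+ 2)%:E) ->
  P.-integrable setT (fun w => ((Y w - \int[P]_w Y w) ^+ 2)%:E) /\
  \int[P]_w ((Y w - \int[P]_w Y w) ^+ 2) <= \int[P]_w (Y w ^+ 2).
Proof.
move=> mY iY2; have iY := integrable_of_sqr mY iY2.
set mu := \int[P]_w Y w.
have E w : (Y w - mu) ^+ 2 = Y w ^+ 2 - (2 * mu) * Y w + mu ^+ 2 by ring.
have i1 : P.-integrable setT (fun w => (2 * mu * Y w)%:E).
  by under eq_fun do rewrite EFinM; exact: integrableZl.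
have i2 : P.-integrable setT (fun w => (Y w ^+ 2 - (2 * mu) * Y w)%:E).
  by under eq_fun do rewrite EFinB; exact: integrableB.
have i3 : P.-integrable setT (fun w => (mu ^+ 2)%:E).
  exact: finite_measure_integrable_cst.
split.
  under eq_fun do rewrite E EFinD; exact: integrableD.
under eq_Rintegral do rewrite E.
rewrite RintegralD // RintegralB // RintegralZl // Rintegral_cst_probability -/mu.
have := sqr_ge0 mu; lra.
Qed.

(** The truncated entries have a common mean, so that one function recentres them
all. *)
Lemma Rintegral_ident (g : R -> R) e : measurable_fun setT g ->
  \int[P]_w g (X e w) = \int[P]_w g (X (0, 0)%N w).
Proof.
by move=> mg; rewrite /Rintegral (integral_ident (X_ident e)).
Qed.

(** Put f x = trunc x - mu and h x = x - f x. Then f is bounded by 2 tau and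
centred, and h has variance of order tau^(2 - gamma). The off-diagonal part of
X X^T is the sum of those of f f^T, f h^T and h X^T, each allowed c / 3: the
trace of an even power controls the first one, the Frobenius norm the others,
whose mean terms vanish. *)
Lemma offdiag_bound_heavy (V : R) (K : nat) : 2 <= gamma ->
  (forall e, P.-integrable setT (fun w => (X e w ^+ 2)%:E)) ->
  (forall e, \int[P]_w (X e w ^+ 2) <= V) ->
  (forall e, \int[P]_w X e w = 0) ->
  (0 < p)%N -> (0 < n)%N -> (0 < K)%N -> ~~ odd K ->
  p%:R * V <= (2 * tau) ^+ 2 -> n%:R * p%:R * V ^+ 2 <= (2 * tau) ^+ 4 ->
  exists B : set T, [/\ measurable B,
    (P B <= (p%:R * (2 * tau) ^+ K.*2 * (K.+1`! * K`!)%:R / (c / 3) ^+ K +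
      2 * (p%:R ^+ 2 * n%:R * V * (tau `^ (2 - gamma) * M) / (c / 3) ^+ 2))%:E)%E &
    forall w, ~ B w -> forall x, `|qform (gramX w) x| <= c * dotrow x x].
Proof.
move=> g2 iX2 X_var X_mean p0 n0 K0 evenK pV npV.
have t20 : 0 < 2 * tau by rewrite mulr_gt0.
have c30 : 0 < c / 3 by rewrite divr_gt0.
have mt := @measurable_trunc R tau.
have mid : measurable_fun setT (@idfun R) by exact: measurable_id.
pose mu := \int[P]_w trunc tau (X (0, 0)%N w).
have muE e : \int[P]_w trunc tau (X e w) = mu by rewrite (Rintegral_ident _ mt).
pose f x := trunc tau x - mu; pose h x := (x - trunc tau x) + mu.
have mf : measurable_fun setT f by apply: measurable_funB.
have mh : measurable_fun setT h.
  by apply: measurable_funD => //; exact: measurable_funB.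
have mtX e : measurable_fun setT (fun w => trunc tau (X e w)) by exact: measurable_comp_RV.
have itX e : P.-integrable setT (fun w => (trunc tau (X e w))%:E).
  apply: (@integrable_bounded _ _ _ _ (fun w => trunc tau (X e w)) tau) => // w.
  by apply: norm_trunc_le; exact: ltW.
have itX2 e : P.-integrable setT (fun w => (trunc tau (X e w) ^+ 2)%:E).
  apply: (@integrable_bounded _ _ _ _ (fun w => trunc tau (X e w) ^+ 2) (tau ^+ 2)).
    exact: measurable_funX.
  move=> w; rewrite normrX lerXn2r ?nnegrE ?(ltW t0) //.
  by apply: norm_trunc_le; exact: ltW.
have iXe e : P.-integrable setT (EFin \o X e) by exact: integrable_of_sqr.
have mu_le : `|mu| <= tau.
  apply: (le_trans (le_normr_Rintegral measurableT (itX _))).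
  apply: (@le_trans _ _ (\int[P]_w tau)).
    apply: le_Rintegral => //.
    - exact: (integrable_norm (itX _)).
    - exact: finite_measure_integrable_cst.
    - by move=> w _; apply: norm_trunc_le; exact: ltW.
  by rewrite Rintegral_cst_probability.
have f_bound x : `|f x| <= 2 * tau.
  apply: le_trans (ler_normB _ _) _; have := norm_trunc_le x (ltW t0).
  by move: mu_le; lra.
have f_mean e : \int[P]_w f (X e w) = 0.
  have icst : P.-integrable setT (fun w : T => mu%:E).
    exact: finite_measure_integrable_cst.
  by rewrite (RintegralB measurableT (itX e) icst) muE Rintegral_cst_probability subrr.
have fC e := Rintegral_center_sqr (mtX e) (itX2 e).
have f_var e : P.-integrable setT (fun w => (f (X e w) ^+ 2)%:E) /\
    \int[P]_w (f (X e w) ^+ 2) <= V.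
  have [i1 le1] := fC e; rewrite muE in i1 le1; split=> //.
  apply: le_trans le1 _; apply: le_trans (X_var e).
  apply: le_Rintegral; [by []|exact: itX2|exact: iX2|move=> w _].
  rewrite /trunc; case: (leP `|X e w| tau) => _ //; by rewrite expr0n sqr_ge0.
have h_mean e : \int[P]_w h (X e w) = 0.
  have -> : (fun w => h (X e w)) = (fun w => X e w - f (X e w)).
    by apply/funext => w; rewrite /h /f; ring.
  have if_ : P.-integrable setT (EFin \o (fun w => f (X e w))).
    apply: integrable_of_sqr; last exact: (f_var e).1.
    exact: measurable_comp_RV.
  by rewrite (RintegralB measurableT (iXe e) if_) X_mean f_mean subrr.
have oX e := overshoot_var_le (X_mom e) t0 g2.
have h_var e : P.-integrable setT (fun w => (h (X e w) ^+ 2)%:E) /\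
    \int[P]_w (h (X e w) ^+ 2) <= tau `^ (2 - gamma) * M.
  have mo : measurable_fun setT (fun w => X e w - trunc tau (X e w)).
    exact: measurable_funB.
  have [i1 le1] := Rintegral_center_sqr mo (oX e).1.
  have E : \int[P]_w (X e w - trunc tau (X e w)) = - mu.
    by rewrite (RintegralB measurableT (iXe e) (itX e)) X_mean muE sub0r.
  rewrite E in i1 le1.
  have hE w : h (X e w) = X e w - trunc tau (X e w) - - mu by rewrite opprK.
  split; first by under eq_fun do rewrite hE.
  under eq_Rintegral do rewrite hE.
  exact: le_trans le1 (oX e).2.
have abs0 (g : R -> R) e : \int[P]_w g (X e w) = 0 -> `|\int[P]_w g (X e w)| <= 0.
  by move=> ->; rewrite normr0.
pose G1 w := offgram p n (fun e => f (X e w)) (fun e => f (X e w)).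
pose G2 w := offgram p n (fun e => f (X e w)) (fun e => h (X e w)).
pose G3 w := offgram p n (fun e => h (X e w)) (fun e => X e w).
have [iT1 T1] := trace_moment_le iX mf t20 f_bound f_mean (fun e => (f_var e).2)
  p0 n0 pV npV K.
have tr_ge0 w : 0 <= \tr (G1 w ^+ K).
  by apply: mxtrace_expr_ge0 => //; exact: offgram_sym.
have [mB1 PB1] := markov_event iT1 tr_ge0 (exprn_gt0 K c30) T1.
have cross (f1 f2 : R -> R) :
    measurable_fun setT f1 -> measurable_fun setT f2 ->
    forall a b, a * b = V * (tau `^ (2 - gamma) * M) ->
    (forall e, P.-integrable setT (fun w => (f1 (X e w) ^+ 2)%:E) /\
               \int[P]_w (f1 (X e w) ^+ 2) <= a) ->
    (forall e, P.-integrable setT (fun w => (f2 (X e w) ^+ 2)%:E) /\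
               \int[P]_w (f2 (X e w) ^+ 2) <= b) ->
    (forall e, \int[P]_w f1 (X e w) = 0) -> (forall e, \int[P]_w f2 (X e w) = 0) ->
    let G w := offgram p n (fun e => f1 (X e w)) (fun e => f2 (X e w)) in
    measurable [set w | (c / 3) ^+ 2 < frob2 (G w)] /\
    (P [set w | ((c / 3) ^+ 2 < frob2 (G w))%R] <=
      (p%:R ^+ 2 * n%:R * V * (tau `^ (2 - gamma) * M) / (c / 3) ^+ 2)%:E)%E.
  move=> m1 m2 a b ab v1 v2 e1 e2 G.
  have [iF F_le] := frob2_moment_le iX m1 m2 (fun e => (v1 e).1) (fun e => (v2 e).1)
    (fun e => (v1 e).2) (fun e => (v2 e).2) (fun e => abs0 f1 e (e1 e))
    (fun e => abs0 f2 e (e2 e)) p n.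
  apply: (markov_event iF (fun w => frob2_ge0 _) (exprn_gt0 2 c30)).
  apply: le_trans F_le _; rewrite ab expr0n /= !mul0r mulr0 addr0.
  by rewrite le_eqVlt; apply/orP; left; apply/eqP; ring.
have [mB2 PB2] := cross f h mf mh _ _ erefl f_var h_var f_mean h_mean.
have [mB3 PB3] := cross h idfun mh mid _ _ (mulrC _ _) h_var
  (fun e => conj (iX2 e) (X_var e)) h_mean X_mean.
exists ([set w | (c / 3) ^+ K < \tr (G1 w ^+ K)] `|`
  ([set w | (c / 3) ^+ 2 < frob2 (G2 w)] `|`
   [set w | (c / 3) ^+ 2 < frob2 (G3 w)])); split.
- by apply: measurableU => //; exact: measurableU.
- apply: le_trans (measureU2 _ _ _) _ => //; first exact: measurableU.
  rewrite EFinD; apply: leeD => //.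
  apply: le_trans (measureU2 _ _ _) _ => //.
  by rewrite mulr_natl mulr2n EFinD; apply: leeD.
move=> w /not_orP[/negP nB1 /not_orP[/negP nB2 /negP nB3]] x.
rewrite -!leNgt in nB1 nB2 nB3.
have q1 : `|qform (G1 w) x| <= c / 3 * dotrow x x.
  apply: (@qform_mxtrace _ _ _ K) => //; [exact: offgram_sym|exact: ltW].
have q2 : `|qform (G2 w) x| <= c / 3 * dotrow x x by apply: qform_frob2 nB2; exact: ltW.
have q3 : `|qform (G3 w) x| <= c / 3 * dotrow x x by apply: qform_frob2 nB3; exact: ltW.
have gE : gramX w = G1 w + G2 w + G3 w.
  apply/matrixP => i j; rewrite !mxE; case: (i == j); first by rewrite !addr0.
  rewrite -!big_split /=; apply: eq_bigr => t _; rewrite /f /h; ring.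
have qD (A1 A2 : 'M[R]_p) : qform (A1 + A2) x = qform A1 x + qform A2 x.
  by rewrite /qform mulmxDr mulmxDl mxE.
rewrite gE !qD; apply: le_trans (ler_normD _ _) _.
apply: le_trans (lerD (ler_normD _ _) (lexx _)) _.
by have := dotrow_ge0 x; lra.
Qed.

End OffDiagonalBounds.

(** * The thinned stochastic volatility field *)

Section ThinnedModel.
Context (d : measure_display) (T : measurableType d) (R : realType)
  (P : probability T R).
Variables (sg Z : nat * nat -> {RV P >-> R}) (m : nat) (s q : 'I_m.+1 -> R).
Hypotheses (Z_iid : iid Z) (sg_iid : iid sg).
Hypothesis sg_ge0 : forall e w, 0 <= sg e w.
Hypothesis sgZ : independent_fields sg Z.
Hypotheses (s_0 : s ord0 = 0) (s_incr : forall i j : 'I_m.+1, (i < j)%N -> s i < s j).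
Hypothesis sg_law0 : forall i, P (sg (0, 0)%N @^-1` [set s i]) = (q i)%:E.
Hypothesis q_sum : \sum_i q i = 1.

Lemma level_inj : injective s.
Proof.
move=> i j sij; apply/val_inj; case: (ltngtP i j) => // /s_incr.
  by rewrite sij ltxx.
by rewrite sij ltxx.
Qed.

Lemma level_ge0 i : 0 <= s i.
Proof.
have [->|i0] := eqVneq i ord0; first by rewrite s_0.
by rewrite -s_0 ltW //; apply: s_incr; rewrite lt0n.
Qed.

Lemma level_le_max i : s i <= s ord_max.
Proof.
have [->//|i0] := eqVneq i ord_max.
apply/ltW/s_incr; rewrite ltn_neqAle -ltnS ltn_ord andbT.
by apply: contra_neq i0 => im; apply/val_inj.
Qed.

Lemma sg_law e i : P (sg e @^-1` [set s i]) = (q i)%:E.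
Proof. by rewrite -sg_law0; exact: (sg_iid.2 e (0, 0)%N [set s i]). Qed.

Lemma sg_law_sum e : (\sum_i P (sg e @^-1` [set s i]) = 1)%E.
Proof. by under eq_bigr do rewrite sg_law; rewrite sumEFin q_sum. Qed.

Lemma law_ge0 i : 0 <= q i.
Proof. by rewrite -lee_fin -sg_law0. Qed.

Definition thinned e : {RV P >-> R} := sg e * Z e.

Lemma thinned_mutually_independent : mutually_independent thinned.
Proof.
exact: (product_mutually_independent level_inj sg_law_sum sg_iid.1 Z_iid.1 sgZ).
Qed.

Lemma thinned_ident e (B : set R) : measurable B ->
  P (thinned e @^-1` B) = P (thinned (0, 0)%N @^-1` B).
Proof.
have prodE e' := probability_product level_inj sg_law_sum sg_iid.1 Z_iid.1 sgZ e'.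
move=> mB; rewrite /thinned !prodE //; apply: eq_bigr => i _.
rewrite !sg_law; congr (_ * _)%E.
apply: (Z_iid.2 e (0, 0)%N (( *%R (s i)) @^-1` B)).
by rewrite -[X in measurable X]setTI; exact: mulrl_measurable.
Qed.

Lemma sg_Z_indep e (C D : set R) : measurable C -> measurable D ->
  P (sg e @^-1` C `&` Z e @^-1` D) = (P (sg e @^-1` C) * P (Z e @^-1` D))%E.
Proof.
move=> mC mD; have := @independent_fields_bigcap _ _ _ P _ sg Z [:: e]
  (fun=> C) (fun=> D) sg_iid.1 Z_iid.1 sgZ.
rewrite big_seq1 => <- //.
by rewrite (_ : [set` [:: e]] = [set e]) ?bigcap_set1 // seq_setU1 set_nil setU0.
Qed.

Lemma Z_ident e (g : R -> R) : measurable_fun setT g ->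
  (\int[P]_w (g (Z e w))%:E = \int[P]_w (g (Z (0, 0)%N w))%:E)%E.
Proof. by move=> mg; apply: integral_ident => // B mB; exact: (Z_iid.2 e). Qed.

Lemma integral_sg e (f : R -> R) : measurable_fun setT f -> (forall x, 0 <= f x) ->
  (\int[P]_w (f (sg e w))%:E = (\sum_i f (s i) * q i)%:E)%E.
Proof.
move=> mf f0; rewrite (integral_finite_valued level_inj (sg_law_sum e)) //.
by rewrite -sumEFin; apply: eq_bigr => i _; rewrite sg_law EFinM.
Qed.

(** The level s_0 = 0 does not contribute, which produces the factor
P(sg <> 0). *)
Lemma sum_nonzero_level_le g : 0 < g ->
  \sum_i s i `^ g * q i <= s ord_max `^ g * \sum_(i | i != ord0) q i.
Proof.
move=> g0; rewrite (bigID (fun i => i == ord0)) /= big_pred1_eq.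
rewrite s_0 powR0 ?gt_eqF // mul0r add0r mulr_sumr; apply: ler_sum => i _.
rewrite ler_wpM2r ?law_ge0 //; apply: ge0_ler_powR; rewrite ?nnegrE ?level_ge0 ?(ltW g0) //.
exact: level_le_max.
Qed.

Lemma thinned_moment_le g e : 0 < g ->
  (\int[P]_w (`|Z (0, 0)%N w| `^ g)%:E < +oo)%E ->
  (\int[P]_w (`|thinned e w| `^ g)%:E <=
   (s ord_max `^ g * fine (\int[P]_w (`|Z (0, 0)%N w| `^ g)%:E)
      * \sum_(i | i != ord0) q i)%:E)%E.
Proof.
move=> g0 Zg.
have mabs : measurable_fun setT (fun x : R => `|x| `^ g).
  apply: (measurableT_comp (measurable_powR g)); exact: normr_measurable.
have abs0 (x : R) : 0 <= `|x| `^ g by exact: powR_ge0.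
have ZE := Z_ident e mabs.
have Z0 : (0 <= \int[P]_w (`|Z (0, 0)%N w| `^ g)%:E)%E.
  by apply: integral_ge0 => w _; rewrite lee_fin.
have -> : (\int[P]_w (`|thinned e w| `^ g)%:E =
    \int[P]_w (`|sg e w| `^ g * `|Z e w| `^ g)%:E)%E.
  by apply: eq_integral => w _; rewrite /thinned /= normrM powRM.
have fin_Z : (\int[P]_w (`|Z e w| `^ g)%:E < +oo)%E by rewrite ZE.
have E := integral_mul_indep (sg_Z_indep e) mabs mabs abs0 abs0 fin_Z.
have sE : \sum_i `|s i| `^ g * q i = \sum_i s i `^ g * q i.
  by apply: eq_bigr => i _; rewrite ger0_norm // level_ge0.
rewrite (integral_sg e mabs abs0) ZE sE in E; rewrite {}E.
move: Zg Z0; set I := (\int[P]_w _)%E => Zg Z0.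
rewrite -{1}[I]fineK ?ge0_fin_numE // -EFinM lee_fin mulrAC.
rewrite ler_wpM2r ?fine_ge0 //; exact: sum_nonzero_level_le.
Qed.

(** Both parts of Z, positive and negative, are independent of sg, so the means of
their products with sg are multiples of their own by the same factor. *)
Lemma thinned_mean0 e : P.-integrable setT (EFin \o Z (0, 0)%N) ->
  \int[P]_w Z (0, 0)%N w = 0 ->
  P.-integrable setT (EFin \o thinned e) /\ \int[P]_w thinned e w = 0.
Proof.
move=> iZ0 Z00.
have mabs : measurable_fun setT (fun x : R => `|x|) by exact: normr_measurable.
have mpos : measurable_fun setT (fun x : R => Num.max x 0).
  exact: measurable_maxr.
have mneg : measurable_fun setT (fun x : R => Num.max (- x) 0).
  by apply: measurable_maxr => //; exact: oppr_measurable.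
have pos0 (x : R) : 0 <= Num.max x 0 by rewrite le_max lexx orbT.
have neg0 (x : R) : 0 <= Num.max (- x) 0 by rewrite le_max lexx orbT.
have xE (x : R) : x = Num.max x 0 - Num.max (- x) 0.
  case/orP: (le_total 0 x) => x0.
    by rewrite max_l // max_r ?subr0 // oppr_le0.
  by rewrite max_r // max_l ?oppr_ge0 // sub0r opprK.
pose a := \sum_i `|s i| * q i.
have part (g : R -> R) : measurable_fun setT g -> (forall x, 0 <= g x) ->
    (forall x, g x <= `|x|) ->
    [/\ P.-integrable setT (fun w => (g (Z (0, 0)%N w))%:E),
        P.-integrable setT (fun w => (`|sg e w| * g (Z e w))%:E) &
        \int[P]_w (`|sg e w| * g (Z e w)) = a * \int[P]_w g (Z (0, 0)%N w)].
  move=> mg g0 gx.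
  have ig : P.-integrable setT (fun w => (g (Z (0, 0)%N w))%:E).
    apply: (le_integrable _ _ _ iZ0) => //.
      by apply/measurable_EFinP; exact: measurable_comp_RV.
    by move=> w _ /=; rewrite lee_fin ger0_norm.
  have iE := Z_ident e mg.
  have fin_g : (\int[P]_w (g (Z (0, 0)%N w))%:E \is a fin_num)%E.
    exact: integrable_fin_num ig.
  have E := integral_mul_indep (sg_Z_indep e) mabs mg (@normr_ge0 _ _) g0.
  rewrite iE (integral_sg e mabs (@normr_ge0 _ _)) in E.
  have {}E := E (ltac:(by rewrite ltey_eq fin_g)).
  split=> //; last by rewrite /Rintegral E fineM.
  apply/integrableP; split.
    apply/measurable_EFinP; apply: measurable_funM; exact: measurable_comp_RV.
  under eq_integral => w _ do rewrite gee0_abs ?lee_fin ?mulr_ge0 //.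
  by rewrite E -[X in (_ * X)%E]fineK // -EFinM ltry.
have [|i1 i2 E12] := part _ mpos pos0.
  by move=> x; rewrite ge_max ler_norm normr_ge0.
have [|j1 j2 F12] := part _ mneg neg0.
  by move=> x; rewrite ge_max -normrN ler_norm normr_ge0.
have XE w : thinned e w =
    `|sg e w| * Num.max (Z e w) 0 - `|sg e w| * Num.max (- Z e w) 0.
  by rewrite -mulrBr -xE ger0_norm.
split.
  have -> : EFin \o thinned e = (fun w => (`|sg e w| * Num.max (Z e w) 0)%:E -
      (`|sg e w| * Num.max (- Z e w) 0)%:E)%E.
    by apply/funext => w /=; rewrite -EFinB -XE.
  exact: integrableB.
under eq_Rintegral do rewrite XE.
rewrite (RintegralB measurableT i2 j2) E12 F12 -mulrBr -(RintegralB measurableT i1 j1).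
by under eq_Rintegral do rewrite -xE; rewrite Z00 mulr0.
Qed.

End ThinnedModel.

(** * Growth of the normalizing sequence *)

Section AbsoluteTail.
Context (d : measure_display) (T : measurableType d) (R : realType)
  (P : probability T R).

Lemma abs_tail_nonincr (Z : {RV P >-> R}) x y : x <= y ->
  fine (P [set w | (y < `|Z w|)%R]) <= fine (P [set w | (x < `|Z w|)%R]).
Proof.
have mZ a : measurable [set w | a < `|Z w|].
  by apply: measurable_set_lt => //; exact: measurableT_comp.
move=> xy; apply: fine_le; rewrite ?fin_num_measure //.
by apply: le_measure; rewrite ?inE // => w /=; exact: le_lt_trans.
Qed.

Lemma abs_tail_cvg (Z : {RV P >-> R}) (g : R -> R) (a c : R) :
  fine (P [set w | (x < Z w)%R]) / g x @[x --> +oo] --> a ->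
  fine (P [set w | (Z w < - x)%R]) / g x @[x --> +oo] --> c ->
  fine (P [set w | (x < `|Z w|)%R]) / g x @[x --> +oo] --> a + c.
Proof.
move=> Za Zc; apply: (cvg_trans _ (cvgD Za Zc)); apply: near_eq_cvg.
apply/near_pinftyP; exists 0 => x x0 /=; rewrite -mulrDl; congr (_ / _).
have mp : measurable [set w | x < Z w] by apply: measurable_set_lt.
have mn : measurable [set w | Z w < - x] by apply: measurable_set_lt.
rewrite -[LHS]/(fine (P [set w | (x < Z w)%R]) + fine (P [set w | (Z w < - x)%R])).
rewrite -fineD ?fin_num_measure // -measureU //.
  congr (fine (P _)); apply/seteqP; split=> w /=; rewrite ltr_normr (ltrNr x (Z w)).
    by move=> [->//|->]; rewrite orbT.
  by move=> /orP.
apply/seteqP; split=> w //= [xZ Zx]; have := lt_trans xZ Zx; lra.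
Qed.

End AbsoluteTail.

Section Rates.
Variable R : realType.

Lemma powR_near_ge (theta M : R) : 0 < theta -> exists x0 : R,
  0 < x0 /\ forall x, x0 <= x -> M <= x `^ theta.
Proof.
move=> t0; pose M1 := Num.max 1 M; have M10 : 0 < M1 by rewrite lt_max ltr01.
exists (M1 `^ theta^-1); split; first exact: powR_gt0.
move=> x Mx; apply: (@le_trans _ _ M1); first by rewrite le_max lexx orbT.
have -> : M1 = (M1 `^ theta^-1) `^ theta.
  by rewrite -powRrM mulVf ?gt_eqF // powRr1 // ltW.
have T0 : 0 < M1 `^ theta^-1 by exact: powR_gt0.
apply: ge0_ler_powR => //; rewrite ?nnegrE ?(ltW t0) ?(ltW T0) //.
exact: le_trans (ltW T0) Mx.
Qed.

Section Growth.
Variable b : nat -> R.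
Hypothesis b_infty : forall M, \forall n \near \oo, M <= b n.

Lemma powR_dominate (C theta theta' : R) : theta < theta' ->
  \forall n \near \oo, C * b n `^ theta <= b n `^ theta'.
Proof.
move=> tt; have [|x0 [x00 hx]] := @powR_near_ge (theta' - theta) C.
  by rewrite subr_gt0.
near=> n; have bx : x0 <= b n by near: n; exact: b_infty.
have b0 : 0 < b n by exact: lt_le_trans bx.
have -> : b n `^ theta' = b n `^ (theta' - theta) * b n `^ theta.
  by rewrite -powRD ?subrK // (gt_eqF b0) implybT.
by rewrite ler_wpM2r ?powR_ge0 // hx.
Unshelve. all: by end_near. Qed.

Lemma powR_vanish (C theta eta : R) : theta < 0 -> 0 < eta ->
  \forall n \near \oo, C * b n `^ theta <= eta.
Proof.
move=> t0 e0; have := @powR_dominate (C / eta) _ _ t0; apply: filterS => n.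
by rewrite powRr0 mulrAC ler_pdivrMr // mul1r.
Qed.

End Growth.

Variables (p : nat -> nat) (b Q : nat -> R) (H L ell : R -> R) (alpha beta c0 c1 : R).
Hypothesis H_nincr : forall x y, x <= y -> H y <= H x.
Hypothesis H_ge0 : forall x, 0 <= H x.
Hypothesis L_sv : slowly_varying L.
Hypothesis HL : H x / (L x * x `^ (- alpha)) @[x --> +oo] --> (1 : R).
Hypothesis alpha0 : 0 < alpha.
Hypotheses (c00 : 0 < c0) (c10 : 0 < c1).
Hypothesis b_norm : \forall n \near \oo,
  c0 * (n%:R * (p n)%:R * Q n) * H (b n) <= 2.
Hypothesis Q01 : \forall n \near \oo, 0 <= Q n <= 1.
Hypothesis nQ : \forall n \near \oo, c1 <= n%:R * Q n.
Hypothesis p_infty : p n @[n --> \oo] --> \oo.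
Hypothesis beta1 : beta <= 1.
Hypothesis ell_sv : slowly_varying ell.
Hypothesis p_form : forall n, (0 < n)%N -> (p n)%:R = n%:R `^ beta * ell n%:R.

Let N n : R := n%:R * (p n)%:R * Q n.

Lemma rows_near_ge (M : R) : \forall n \near \oo, M <= (p n)%:R.
Proof.
have [k Mk] : exists k : nat, M <= k%:R.
  by exists (Num.bound `|M|); rewrite (le_trans (ler_norm M)) // ltW // archi_boundP.
near=> n; apply: (le_trans Mk).
by rewrite ler_nat; near: n; move/cvgnyPge: p_infty; apply.
Unshelve. all: by end_near. Qed.

Lemma nat_near_ge (M : R) : \forall n \near \oo, M <= (n%:R : R).
Proof.
exact: nbhs_infty_ger.
Qed.

(** Because n Q n stays away from zero. *)
Lemma nonzero_entries_ge : \forall n \near \oo, c1 * (p n)%:R <= N n.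
Proof.
near=> n; rewrite /N mulrAC ler_wpM2r //.
by near: n.
Unshelve. all: by end_near. Qed.

(** If b n <= M, then N n * H (b n) is at least N n * H M, and N n tends to
infinity with p n. *)
Lemma normalizer_infty M : \forall n \near \oo, M <= b n.
Proof.
have HM : 0 < H M by exact: tail_gt0 HL M.
near=> n; rewrite leNgt; apply/negP => bM.
have := H_nincr (ltW bM); rewrite leNgt => /negP; apply.
have NM : 2 / (c0 * H M) < N n.
  apply: lt_le_trans (_ : c1 * (p n)%:R <= _); last by near: n; exact: nonzero_entries_ge.
  rewrite -ltr_pdivrMl // mulrC.
  apply: (@lt_le_trans _ _ (2 / (c0 * H M) / c1 + 1)); first by rewrite ltrDl.
  by near: n; exact: rows_near_ge.
have c0H : 0 < c0 * H M by exact: mulr_gt0.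
have N0 : 0 < N n by apply: lt_trans NM; rewrite divr_gt0.
rewrite -(ltr_pM2l (mulr_gt0 c00 N0)).
apply: (@le_lt_trans _ _ 2); first by near: n; exact: b_norm.
by move: NM; rewrite ltr_pdivrMr // mulrCA mulrA.
Unshelve. all: by end_near. Qed.

(** The normalization bounds N n by a multiple of 1 / H (b n), and H decays more
slowly than any power of order - kappa with kappa > alpha. *)
Lemma nonzero_entries_le kappa : alpha < kappa -> \forall n \near \oo, N n <= b n `^ kappa.
Proof.
move=> ak; pose k' := (alpha + kappa) / 2.
have ak' : alpha < k' by rewrite /k'; lra.
have k'k : k' < kappa by rewrite /k'; lra.
have [c [x0 [c_gt0 x00 cH]]] := tail_lower H_nincr H_ge0 L_sv HL (lt_trans alpha0 ak') ak'.
near=> n.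
have bx : x0 < b n.
  apply: (@lt_le_trans _ _ (x0 + 1)); first by rewrite ltrDl.
  by near: n; exact: normalizer_infty.
have bn : c0 * N n * H (b n) <= 2 by near: n; exact: b_norm.
have N0 : 0 <= N n.
  have /andP[Q0 _] : 0 <= Q n <= 1 by near: n; exact: Q01.
  by rewrite !mulr_ge0.
apply: (@le_trans _ _ (2 / (c0 * c) * b n `^ k')); last first.
  by near: n; apply: powR_dominate k'k; exact: normalizer_infty.
rewrite mulrAC ler_pdivlMr ?mulr_gt0 //.
apply: (@le_trans _ _ (b n `^ k' * (c0 * N n * H (b n)))).
  have := ler_wpM2l (mulr_ge0 (ltW c00) N0) (cH _ bx); nra.
by rewrite mulrC ler_wpM2r ?powR_ge0.
Unshelve. all: by end_near. Qed.

Lemma rows_le kappa : alpha < kappa -> \forall n \near \oo, (p n)%:R <= b n `^ kappa.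
Proof.
move=> ak; pose k' := (alpha + kappa) / 2.
have ak' : alpha < k' by rewrite /k'; lra.
have k'k : k' < kappa by rewrite /k'; lra.
near=> n.
have h1 : c1 * (p n)%:R <= N n by near: n; exact: nonzero_entries_ge.
have h2 : N n <= b n `^ k' by near: n; exact: nonzero_entries_le.
have h3 : c1^-1 * b n `^ k' <= b n `^ kappa.
  by near: n; apply: powR_dominate k'k; exact: normalizer_infty.
by apply: le_trans h3; rewrite mulrC ler_pdivlMr // mulrC (le_trans h1).
Unshelve. all: by end_near. Qed.

Lemma rows_le_power e : 0 < e -> \forall n \near \oo, (p n)%:R <= n%:R * n%:R `^ e :> R.
Proof.
move=> e0; have [M hM] := slowly_varying_le ell_sv e0.
near=> n.
have n0 : (0 < n)%N by near: n; exact: nbhs_infty_gt.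
have n1 : 1 <= n%:R :> R by rewrite ler1n.
rewrite p_form //.
have -> : n%:R * n%:R `^ e = n%:R `^ 1 * n%:R `^ e :> R by rewrite powRr1.
apply: (@le_trans _ _ (n%:R `^ beta * n%:R `^ e)).
  rewrite ler_wpM2l ?powR_ge0 // hM //.
  by near: n; exact: nat_near_ge.
by rewrite ler_wpM2r ?powR_ge0 // ler_powR.
Unshelve. all: by end_near. Qed.

(** (p Q)^2 equals N Q (p / n), and p / n is smaller than any power of p because
p = n^beta ell(n) with beta <= 1. *)
Lemma row_density_sqr_le kappa : alpha < kappa ->
  \forall n \near \oo, ((p n)%:R * Q n) ^+ 2 <= b n `^ kappa.
Proof.
move=> ak; pose k' := (alpha + kappa) / 2.
have ak' : alpha < k' by rewrite /k'; lra.
have k'k : k' < kappa by rewrite /k'; lra.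
have k'0 : 0 < k' by exact: lt_trans ak'.
pose e := (kappa - k') / k'.
have e0 : 0 < e by rewrite divr_gt0 // subr_gt0.
near=> n.
have /andP[Q0 Q1] : 0 <= Q n <= 1 by near: n; exact: Q01.
have N_k : N n <= b n `^ k' by near: n; exact: nonzero_entries_le.
have p_k : (p n)%:R <= b n `^ k' by near: n; exact: rows_le.
have p1 : 1 <= (p n)%:R :> R by near: n; exact: rows_near_ge.
have n0 : 0 < n%:R :> R by rewrite ltr0n; near: n; exact: nbhs_infty_gt.
have pn : (p n)%:R <= n%:R * n%:R `^ e :> R by near: n; exact: rows_le_power.
have {}pn : (p n)%:R <= n%:R * (p n)%:R `^ e :> R.
  case: (leP (p n)%:R (n%:R : R)) => [le_pn|lt_np].
    apply: le_trans le_pn _; rewrite ler_peMr ?(ltW n0) //.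
    by have := ler_powR p1 (ltW e0); rewrite powRr0.
  apply: le_trans pn _; rewrite ler_wpM2l ?(ltW n0) //.
  by apply: ge0_ler_powR; rewrite ?nnegrE ?(ltW e0) ?(ltW n0) // ltW.
have -> : b n `^ kappa = b n `^ k' * (b n `^ k') `^ e.
  have b0 : 0 < b n.
    by apply: (@lt_le_trans _ _ 1) => //; near: n; exact: normalizer_infty.
  rewrite -powRrM -powRD ?(gt_eqF b0) ?implybT //; congr (_ `^ _).
  by rewrite /e mulrC divfK ?gt_eqF // addrC subrK.
apply: (@le_trans _ _ (N n * (p n)%:R `^ e)); last first.
  apply: ler_pM => //; rewrite ?powR_ge0 ?mulr_ge0 //.
  by apply: ge0_ler_powR; rewrite ?nnegrE ?(ltW e0) ?powR_ge0.
have -> : ((p n)%:R * Q n) ^+ 2 = (p n)%:R * ((p n)%:R * Q n) * Q n by ring.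
apply: (@le_trans _ _ (n%:R * (p n)%:R `^ e * ((p n)%:R * Q n) * 1)); last first.
  by rewrite mulr1 /N; nra.
apply: ler_pM => //; rewrite ?mulr_ge0 //.
by rewrite ler_wpM2r ?mulr_ge0.
Unshelve. all: by end_near. Qed.

End Rates.

(** * Negligibility of the off-diagonal part *)

Section OffDiagonalSmall.
Context (d : measure_display) (T : measurableType d) (R : realType)
  (P : probability T R).
Variables (X : nat -> nat * nat -> {RV P >-> R}) (p : nat -> nat) (b Q : nat -> R)
  (alpha e eta : R).
Hypothesis X_indep : forall n, (0 < n)%N -> mutually_independent (X n).
Hypothesis X_ident : forall n, (0 < n)%N -> forall e (B : set R), measurable B ->
  P (X n e @^-1` B) = P (X n (0, 0)%N @^-1` B).
Hypothesis X_mom : forall g : R, 0 < g < alpha -> exists C : R, 0 <= C /\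
  forall n, (0 < n)%N -> forall e, (\int[P]_w (`|X n e w| `^ g)%:E <= (C * Q n)%:E)%E.
Hypothesis X_mean : 1 < alpha -> forall n, (0 < n)%N -> forall e,
  P.-integrable setT (EFin \o X n e) /\ \int[P]_w X n e w = 0.
Hypothesis Q01 : \forall n \near \oo, 0 <= Q n <= 1.
Hypothesis b_infty : forall M, \forall n \near \oo, M <= b n.
Hypothesis N_le : forall kappa, alpha < kappa ->
  \forall n \near \oo, n%:R * (p n)%:R * Q n <= b n `^ kappa.
Hypothesis pQ_le : forall kappa, alpha < kappa ->
  \forall n \near \oo, ((p n)%:R * Q n) ^+ 2 <= b n `^ kappa.
Hypothesis p_le : forall kappa, alpha < kappa ->
  \forall n \near \oo, (p n)%:R <= b n `^ kappa.
Hypothesis p_gt0 : \forall n \near \oo, (0 < p n)%N.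
Hypotheses (e0 : 0 < e) (eta0 : 0 < eta).

(** The event that some x violates the bound is an uncountable union; enclosing it
in a measurable B of small probability keeps it out of the argument. *)
Definition offdiag_mostly_small n := exists B : set T, [/\ measurable B, (P B <= eta%:E)%E &
  forall w, ~ B w -> forall x,
    `|qform (offgram (p n) n (fun e => X n e w) (fun e => X n e w)) x| <=
    e * b n ^+ 2 * dotrow x x].

Let pD (B a c : R) : 0 < B -> B `^ a * B `^ c = B `^ (a + c).
Proof. by move=> B0; rewrite powRD // (gt_eqF B0) implybT. Qed.

Let pX (B a : R) k : (B `^ a) ^+ k = B `^ (a * k%:R).
Proof. by rewrite -powR_mulrn ?powR_ge0 // -powRrM. Qed.

Let pn (B : R) k : 0 < B -> B ^+ k = B `^ k%:R.
Proof. by move=> B0; rewrite powR_mulrn // ltW. Qed.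

Let sqrt_le (B y kappa : R) : 0 < B -> y ^+ 2 <= B `^ kappa -> y <= B `^ (kappa / 2).
Proof.
move=> B0; have -> : B `^ kappa = (B `^ (kappa / 2)) ^+ 2.
  by rewrite pX divfK ?pnatr_eq0.
case: (leP 0 y) => [y0|/ltW y0 _]; last exact: le_trans y0 (powR_ge0 _ _).
by rewrite ler_pXn2r ?nnegrE ?powR_ge0.
Qed.

(** Take moments of order g = alpha - x, the bounds b^kappa with kappa = alpha + x,
and tau = b^(1 + de) with de = 4 x / alpha. The probability that an entry exceeds
tau has order b^(- 2 x + 4 x^2 / alpha), and the two Frobenius terms have orders
b^(- alpha / 2) and b^(- 2 alpha) up to exponents that are small multiples of x
and de; x is chosen so that all three decrease. *)
Lemma offdiag_small_light : 0 < alpha -> alpha < 2 -> \forall n \near \oo, offdiag_mostly_small n.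
Proof.
move=> a0 a2.
have [x [x0 xa x1]] : exists x : R,
    [/\ 0 < x, 100 * x <= alpha * alpha & 1 < alpha -> 2 * x <= alpha - 1].
  have aa : 0 < alpha * alpha by exact: mulr_gt0.
  case: (leP alpha 1) => a1.
    by exists (alpha * alpha / 100); split=> //; lra.
  exists (Num.min (alpha * alpha / 100) ((alpha - 1) / 2)); split.
  - by rewrite lt_min; apply/andP; split; lra.
  - by rewrite mulrC -ler_pdivlMr // ge_min lexx.
  - by move=> _; rewrite mulrC -ler_pdivlMr // ge_min lexx orbT.
have xa2 : 50 * x <= alpha by nra.
pose g := alpha - x; pose kappa := alpha + x; pose y := x / alpha.
have yE : y * alpha = x by rewrite divfK ?gt_eqF.
have y0 : 0 < y by exact: divr_gt0.
have ya : 100 * y <= alpha by rewrite /y mulrA ler_pdivrMr.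
pose de := 4 * y; pose D := 1 + de.
have ak : alpha < kappa by rewrite ltrDl.
have g0 : 0 < g by rewrite /g; lra.
have ga : g < alpha by rewrite /g; lra.
have [|C [C0 X_C]] := @X_mom g; first by rewrite g0.
have th1 : kappa + D * (- g) < 0.
  rewrite (_ : _ + _ = - 2 * x + 4 * x * y); first by nra.
  by rewrite /kappa /D /de /g; nra.
have th2 : kappa + kappa / 2 + (D * (2 - g) * 2 - 4) < 0.
  by rewrite /kappa /D /de /g; nra.
have th3 : kappa * 2 + (D * (1 - g) * 4 - 4) < 0.
  by rewrite /kappa /D /de /g; nra.
near=> n.
have n0 : (0 < n)%N by near: n; exact: nbhs_infty_gt.
have b0 : 0 < b n.
  by apply: (@lt_le_trans _ _ 1) => //; near: n; exact: b_infty.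
have /andP[Q0 Q1] : 0 <= Q n <= 1 by near: n.
have t0 : 0 < b n `^ D by exact: powR_gt0.
have c0 : 0 < e * b n ^+ 2 by rewrite mulr_gt0 // exprn_gt0.
have [||B [mB PB qB]] := offdiag_bound_light (p n) n (X_indep n0) (X_C n n0) c0 t0.
- by rewrite (ltW g0) /= (le_trans (ltW ga)) // ltW.
- move=> i; apply: (trunc_mean_le (X_C n n0 i) t0).
  case: (leP alpha 1) => a1; first by left; exact: le_trans (ltW ga) a1.
  right; have [iX X0] := X_mean a1 n0 i; split=> //.
  by have := x1 a1; rewrite /g; lra.
exists B; split=> //; apply: le_trans PB _; rewrite lee_fin.
have N_k : n%:R * (p n)%:R * Q n <= b n `^ kappa by near: n; exact: N_le.
have pQ_k : (p n)%:R * Q n <= b n `^ (kappa / 2).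
  by apply: sqrt_le => //; near: n; exact: pQ_le.
have N0 : 0 <= n%:R * (p n)%:R * Q n by rewrite !mulr_ge0.
have pQ0 : 0 <= (p n)%:R * Q n by rewrite mulr_ge0.
have r1 : C * b n `^ (kappa + D * (- g)) <= eta / 3.
  by near: n; apply: powR_vanish => //; rewrite divr_gt0.
have r2 : C ^+ 2 / e ^+ 2 * b n `^ (kappa + kappa / 2 + (D * (2 - g) * 2 - 4)) <= eta / 3.
  by near: n; apply: powR_vanish => //; rewrite divr_gt0.
have r3 : C ^+ 4 / e ^+ 2 * b n `^ (kappa * 2 + (D * (1 - g) * 4 - 4)) <= eta / 3.
  by near: n; apply: powR_vanish => //; rewrite divr_gt0.
have s1 : n%:R * (p n)%:R * ((b n `^ D) `^ (- g) * (C * Q n)) <= eta / 3.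
  apply: le_trans r1; rewrite -powRrM -pD // [leRHS]mulrA.
  rewrite [leLHS](_ : _ = C * (n%:R * (p n)%:R * Q n) * b n `^ (D * - g)); last by ring.
  by rewrite ler_wpM2r ?powR_ge0 // ler_wpM2l.
have b_neq0 : b n != 0 by rewrite gt_eqF.
have e_neq0 : e != 0 by rewrite gt_eqF.
have q4 (a : R) k : (b n `^ a) ^+ k / b n ^+ 4 = b n `^ (a * k%:R - 4).
  by rewrite pX [b n ^+ 4]pn // -powRN pD.
have s2 : (p n)%:R ^+ 2 * (n%:R * ((b n `^ D) `^ (2 - g) * (C * Q n)) ^+ 2) /
    (e * b n ^+ 2) ^+ 2 <= eta / 3.
  apply: le_trans r2; rewrite -powRrM -pD // -q4.
  rewrite [leLHS](_ : _ = C ^+ 2 / e ^+ 2 * ((n%:R * (p n)%:R * Q n) * ((p n)%:R * Q n)) *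
    ((b n `^ (D * (2 - g))) ^+ 2 / b n ^+ 4)); last first.
    by field; rewrite b_neq0 e_neq0.
  rewrite [leRHS]mulrA -pD //.
  rewrite ler_wpM2r ?divr_ge0 ?exprn_ge0 ?powR_ge0 ?(ltW b0) //.
  rewrite ler_wpM2l ?divr_ge0 ?exprn_ge0 ?(ltW e0) //.
  exact: ler_pM.
have s3 : (p n)%:R ^+ 2 * (n%:R ^+ 2 * ((b n `^ D) `^ (1 - g) * (C * Q n)) ^+ 4) /
    (e * b n ^+ 2) ^+ 2 <= eta / 3.
  apply: le_trans r3; rewrite -powRrM -pD // -q4 -pX.
  rewrite [leLHS](_ : _ = C ^+ 4 / e ^+ 2 * ((n%:R * (p n)%:R * Q n) ^+ 2 * Q n ^+ 2) *
    ((b n `^ (D * (1 - g))) ^+ 4 / b n ^+ 4)); last first.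
    by field; rewrite b_neq0 e_neq0.
  rewrite [leRHS]mulrA.
  rewrite ler_wpM2r ?divr_ge0 ?exprn_ge0 ?powR_ge0 ?(ltW b0) //.
  rewrite ler_wpM2l ?divr_ge0 ?exprn_ge0 ?(ltW e0) //.
  rewrite -[leRHS]mulr1; apply: ler_pM; rewrite ?exprn_ge0 ?exprn_ile1 //.
  by rewrite ler_pXn2r ?nnegrE ?powR_ge0.
rewrite mulrDr mulrDl; lra.
Unshelve. all: by end_near. Qed.

(** Take g = alpha - x, kappa = alpha + x and tau = b^(1 - x). The Frobenius terms
have order b^((alpha - 4) / 2) up to an exponent that is a small multiple of x,
and the trace of the power h contributes b^(kappa - 2 h x). *)
Lemma offdiag_small_heavy : 2 < alpha -> alpha < 4 -> \forall n \near \oo, offdiag_mostly_small n.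
Proof.
move=> a2 a4.
have [x [x0 x4 x2]] : exists x : R,
    [/\ 0 < x, 16 * x <= 4 - alpha & 16 * x <= alpha - 2].
  exists (Num.min ((4 - alpha) / 16) ((alpha - 2) / 16)); split.
  - by rewrite lt_min; apply/andP; split; lra.
  - by rewrite mulrC -ler_pdivlMr // ge_min lexx.
  - by rewrite mulrC -ler_pdivlMr // ge_min lexx orbT.
pose g := alpha - x; pose kappa := alpha + x; pose D := 1 - x.
have ak : alpha < kappa by rewrite ltrDl.
have ga : g < alpha by rewrite /g; lra.
have g2 : 2 <= g by rewrite /g; lra.
have [|C [C0 X_C]] := @X_mom g; first by rewrite ga andbT; lra.
have [|C2 [C20 X_C2]] := @X_mom 2; first by rewrite a2 andbT.
have a1 : 1 < alpha by lra.
have X_sqr n e' : (0 < n)%N -> P.-integrable setT (fun w => (X n e' w ^+ 2)%:E) /\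
    \int[P]_w (X n e' w ^+ 2) <= C2 * Q n.
  move=> n0; have [|||i2 le2] := @Rintegral_le_moment _ _ _ _ _ _ _ (X_C2 n n0 e')
    (fun w => X n e' w ^+ 2) 1.
  - exact: measurable_funX.
  - by move=> w; rewrite mul1r powR_mulrn // normrX.
  - by [].
  - split=> //; apply: le_trans (ler_norm _) _; by rewrite mul1r in le2.
(* The even order h of the trace moment makes h times the gain b ^ (- 2x) beat p. *)
have [h [h0 evenh hx]] : exists h : nat,
    [/\ (0 < h)%N, ~~ odd h & kappa < h.*2%:R * x].
  (* The trace of the power h gains b^(- 2 h x), which must beat p <= b^kappa. *)
  exists (Num.bound (kappa / x)).+1.*2; split=> //; first by rewrite odd_double.
  have : kappa / x < (Num.bound (kappa / x))%:R.
    by apply: archi_boundP; rewrite divr_ge0 ?(ltW x0) // /kappa; lra.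
  rewrite -ltr_pdivrMr // => /lt_trans; apply.
  rewrite ltr_nat; move: (Num.bound _) => k.
  by rewrite -!addnn -!addnA leq_addr.
pose F : R := (h.+1`! * h`!)%:R.
have th1 : kappa + (D * h.*2%:R - h.*2%:R) < 0 by rewrite /D; move: hx; lra.
have th2 : kappa + kappa / 2 + (D * (2 - g) - 4) < 0 by rewrite /kappa /D /g; nra.
have th3 : kappa / 2 < D * 2 by rewrite /kappa /D; lra.
have th4 : kappa < D * 4 by rewrite /kappa /D; lra.
near=> n.
have n0 : (0 < n)%N by near: n; exact: nbhs_infty_gt.
have p0 : (0 < p n)%N by near: n.
have b0 : 0 < b n.
  by apply: (@lt_le_trans _ _ 1) => //; near: n; exact: b_infty.
have /andP[Q0 Q1] : 0 <= Q n <= 1 by near: n.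
have t0 : 0 < b n `^ D by exact: powR_gt0.
have c0 : 0 < e * b n ^+ 2 by rewrite mulr_gt0 // exprn_gt0.
have N_k : n%:R * (p n)%:R * Q n <= b n `^ kappa by near: n; exact: N_le.
have pQ_k : (p n)%:R * Q n <= b n `^ (kappa / 2).
  by apply: sqrt_le => //; near: n; exact: pQ_le.
have p_k : (p n)%:R <= b n `^ kappa by near: n; exact: p_le.
have N0 : 0 <= n%:R * (p n)%:R * Q n by rewrite !mulr_ge0.
have pQ0 : 0 <= (p n)%:R * Q n by rewrite mulr_ge0.
have pV : (p n)%:R * (C2 * Q n) <= (2 * b n `^ D) ^+ 2.
  apply: (@le_trans _ _ (C2 * b n `^ (kappa / 2))).
    by rewrite mulrCA ler_wpM2l.
  apply: (@le_trans _ _ (b n `^ (D * 2))).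
    by near: n; apply: powR_dominate.
  by rewrite exprMn pX ler_peMl ?powR_ge0 // -natrX ler1n.
have npV : n%:R * (p n)%:R * (C2 * Q n) ^+ 2 <= (2 * b n `^ D) ^+ 4.
  apply: (@le_trans _ _ (C2 ^+ 2 * b n `^ kappa)).
    rewrite [leLHS](_ : _ = C2 ^+ 2 * ((n%:R * (p n)%:R * Q n) * Q n)); last by ring.
    by rewrite ler_wpM2l ?exprn_ge0 // -[leRHS]mulr1 ler_pM.
  apply: (@le_trans _ _ (b n `^ (D * 4))).
    by near: n; apply: powR_dominate.
  by rewrite exprMn pX ler_peMl ?powR_ge0 // -natrX ler1n.
have [B [mB PB qB]] := offdiag_bound_heavy (X_indep n0) (X_ident n0) (X_C n n0) c0 t0
  g2 (fun i => (X_sqr n i n0).1) (fun i => (X_sqr n i n0).2)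
  (fun i => (X_mean a1 n0 i).2) p0 n0 h0 evenh pV npV.
exists B; split=> //; apply: le_trans PB _; rewrite lee_fin.
have b_neq0 : b n != 0 by rewrite gt_eqF.
have e_neq0 : e != 0 by rewrite gt_eqF.
have qV (a : R) j : b n `^ a / b n ^+ j = b n `^ (a - j%:R).
  by rewrite [b n ^+ j]pn // -powRN pD.
have r1 : 4 ^+ h * 3 ^+ h * F / e ^+ h * b n `^ (kappa + (D * h.*2%:R - h.*2%:R)) <= eta / 2.
  by near: n; apply: powR_vanish => //; rewrite divr_gt0.
have r2 : 18 * C2 * C / e ^+ 2 * b n `^ (kappa + kappa / 2 + (D * (2 - g) - 4)) <= eta / 2.
  by near: n; apply: powR_vanish => //; rewrite divr_gt0.
have s1 : (p n)%:R * (2 * b n `^ D) ^+ h.*2 * F / (e * b n ^+ 2 / 3) ^+ h <= eta / 2.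
  apply: le_trans r1; rewrite -pD // -qV -pX.
  rewrite [leLHS](_ : _ = 4 ^+ h * 3 ^+ h * F / e ^+ h *
    ((p n)%:R * ((b n `^ D) ^+ h.*2 / b n ^+ h.*2))); last first.
    have three0 : 3 != 0 :> R by rewrite pnatr_eq0.
    have two4 : 4 ^+ h = 2 ^+ h * 2 ^+ h :> R by rewrite -exprMn -natrM.
    rewrite two4 -[h.*2]addnn !exprD !exprMn exprVn.
    move: (expf_neq0 h e_neq0) (expf_neq0 h b_neq0) (expf_neq0 h three0).
    move: (e ^+ h) (b n ^+ h) (3 ^+ h) (2 ^+ h) ((b n `^ D) ^+ h).
    by move=> E' B' T' ? ? E0 B0 T0; field; rewrite E0 B0 T0.
  rewrite ler_wpM2l ?divr_ge0 ?mulr_ge0 ?exprn_ge0 ?(ltW e0) //.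
  by rewrite ler_wpM2r // divr_ge0 ?exprn_ge0 ?powR_ge0 // ltW.
have s2 : 2 * ((p n)%:R ^+ 2 * n%:R * (C2 * Q n) * ((b n `^ D) `^ (2 - g) * (C * Q n)) /
    (e * b n ^+ 2 / 3) ^+ 2) <= eta / 2.
  apply: le_trans r2; rewrite -powRrM -pD // -qV.
  rewrite [leLHS](_ : _ = 18 * C2 * C / e ^+ 2 *
    ((n%:R * (p n)%:R * Q n) * ((p n)%:R * Q n)) *
    (b n `^ (D * (2 - g)) / b n ^+ 4)); last first.
    by field; rewrite b_neq0 e_neq0.
  rewrite [leRHS]mulrA -pD //.
  rewrite ler_wpM2r ?divr_ge0 ?exprn_ge0 ?powR_ge0 ?(ltW b0) //.
  rewrite ler_wpM2l ?divr_ge0 ?mulr_ge0 ?exprn_ge0 ?(ltW e0) //.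
  exact: ler_pM.
lra.
Unshelve. all: by end_near. Qed.

End OffDiagonalSmall.

(** * The eigenvalue gap as a random variable *)

Section EigenvalueGap.
Context (d : measure_display) (T : measurableType d) (R : realType)
  (P : probability T R).

Lemma measurable_bigmax (I : Type) (r : seq I) (F : I -> T -> R) :
  (forall i, measurable_fun setT (F i)) ->
  measurable_fun setT (fun w => \big[Num.max/0]_(i <- r) F i w).
Proof.
move=> mF; elim: r => [|i r IH].
  by under eq_fun do rewrite big_nil; exact: measurable_cst.
under eq_fun do rewrite big_cons.
by apply: measurable_maxr => //; exact: mF.
Qed.

Lemma measurable_conj_mx n (B : 'M[R]_n) (M : T -> 'M[R]_n) :
  (forall i j, measurable_fun setT (fun w => M w i j)) ->
  forall i j, measurable_fun setT (fun w => (B *m M w *m B) i j).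
Proof.
move=> mM i j; under eq_fun do rewrite mxE.
apply: measurable_sum => k; apply: measurable_funM => //.
under eq_fun do rewrite mxE.
by apply: measurable_sum => l; apply: measurable_funM.
Qed.

Variables (sg Z : nat * nat -> {RV P >-> R}) (p n : nat) (A : 'M[R]_p).
Hypothesis A_posdef : posdefmx A.

Let S w := let X := sv_matrix sg Z p n w in X *m X^T.
Let gap w := \big[Num.max/0]_(i < p)
  `|lambda (sqrtmx A *m S w *m sqrtmx A) i - lambda (diagpart (S w) *m A) i|.

Let S_sym w : (S w)^T = S w.
Proof. by rewrite /S /= trmx_mul trmxK. Qed.

Let measurable_S i j : measurable_fun setT (fun w => S w i j).
Proof.
under eq_fun do rewrite mxE.
apply: measurable_sum => t; under eq_fun do rewrite !mxE.
by apply: measurable_funM; apply: measurable_funM.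
Qed.

Lemma measurable_gap : measurable_fun setT gap.
Proof.
have [[Bs _] _] := sqrtmxP A_posdef.
apply: measurable_bigmax => i; apply: measurableT_comp => //.
apply: measurable_funB.
  apply: measurable_lambda; last exact: measurable_conj_mx.
  by move=> w; rewrite trmx_mul Bs trmx_mul Bs S_sym mulmxA.
under eq_fun do rewrite lambda_diag_mul //.
apply: measurable_lambda; last first.
  apply: measurable_conj_mx => k l.
  have [->|kl] := eqVneq k l.
    by under eq_fun do rewrite 2!mxE eqxx mulr1n; exact: measurable_S.
  by under eq_fun do rewrite 2!mxE (negbTE kl) mulr0n; exact: measurable_cst.
by move=> w; rewrite trmx_mul Bs trmx_mul Bs tr_diag_mx mulmxA.
Qed.

Lemma gap_le (K c : R) w : spectral_norm A <= K -> 0 <= K -> 0 <= c ->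
  (forall x, `|qform (offgram p n (fun e => thinned sg Z e w)
                                  (fun e => thinned sg Z e w)) x| <=
             c * dotrow x x) ->
  0 <= gap w <= c * K.
Proof.
move=> AK K0 c0 Sc; apply/andP; split; first exact: bigmax_ge_id.
apply: bigmax_le => [|i _]; first exact: mulr_ge0.
apply: eigenvalue_perturbation => // x.
suff -> : S w - diagpart (S w) = offgram p n (fun e => thinned sg Z e w)
   (fun e => thinned sg Z e w) by exact: Sc.
apply/matrixP => k l; rewrite !mxE; have [->|kl] := eqVneq k l.
  by rewrite mulr1n subrr.
by rewrite mulr0n subr0; apply: eq_bigr => t _; rewrite !mxE.
Qed.

End EigenvalueGap.

Lemma cvge_gt0_near (R : realType) (u : nat -> R) (l : \bar R) : (0 < l)%E ->
  (u n)%:E @[n --> \oo] --> l -> exists c : R, 0 < c /\ \forall n \near \oo, c <= u n.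
Proof.
case: l => [l|_|//].
  rewrite lte_fin => l0 /fine_cvgP[_ /cvgr_gt ul].
  exists (l / 2); split; first by rewrite divr_gt0.
  have /ul : l / 2 < l by lra.
  by apply: filterS => n /= /ltW.
by move=> /cvgeyPge/(_ 1) u1; exists 1; split=> //; apply: filterS u1 => n; rewrite lee_fin.
Qed.

(** * Asymptotic equality of the spectra *)

Theorem theorem4p5 (R : realType) (d : measure_display) (T : measurableType d)
  (P : probability T R)
  (Z : nat * nat -> {RV P >-> R}) (sigma : nat -> nat * nat -> {RV P >-> R})
  (alpha : R) (qp qm : R) (L : R -> R)
  (p : nat -> nat) (beta : R) (ell : R -> R)
  (m : nat) (s : 'I_m.+1 -> R) (q : nat -> 'I_m.+1 -> R)
  (A : forall n, 'M[R]_(p n)) (b : nat -> R)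
  (* the model *)
  (Z_iid : iid Z)
  (sigma_iid : forall n, (0 < n)%N -> iid (sigma n))
  (sigma_ge0 : forall n, (0 < n)%N -> forall it w, 0 <= sigma n it w)
  (sigma_Z_indep : forall n, (0 < n)%N -> independent_fields (sigma n) Z)
  (* the normalizing sequence *)
  (b_gt0 : forall n, (0 < n)%N -> 0 < b n)
  (b_norm : ((n%:R * (p n)%:R)%:E * 'E_P[fun w => (sigma n (0, 0)%N w `^ alpha)%R]
              * P [set w | (b n < `|Z (0, 0)%N w|)%R])%E @[n --> \oo] --> 1%E)
  (* assumption 1 *)
  (alpha_range : (0 < alpha < 2) \/ (2 < alpha < 4))
  (qp_ge0 : 0 <= qp) (qm_ge0 : 0 <= qm) (qp_qm : qp + qm = 1)
  (L_slow : slowly_varying L)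
  (Z_right_tail : fine (P [set w | x < Z (0, 0)%N w]) / (L x * x `^ (- alpha))
                  @[x --> +oo] --> qp)
  (Z_left_tail : fine (P [set w | Z (0, 0)%N w < - x]) / (L x * x `^ (- alpha))
                 @[x --> +oo] --> qm)
  (Z_centered : ('E_P[fun w => `|Z (0, 0)%N w|%R] < +oo)%E ->
                ('E_P[Z (0, 0)%N] = 0)%E)
  (* assumption 2 *)
  (p_infty : p n @[n --> \oo] --> \oo)
  (beta_range : 0 < beta <= 1)
  (ell_slow : slowly_varying ell)
  (p_form : forall n, (0 < n)%N -> (p n)%:R = n%:R `^ beta * ell n%:R)
  (* assumption 3 *)
  (m_ge1 : (1 <= m)%N)
  (s_0 : s ord0 = 0)
  (s_incr : forall i j : 'I_m.+1, (i < j)%N -> s i < s j)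
  (sigma_law : forall n, (0 < n)%N -> forall i : 'I_m.+1,
     P [set w | sigma n (0, 0)%N w = s i] = (q n i)%:E)
  (q_sum : forall n, (0 < n)%N -> \sum_i q n i = 1)
  (q_0 : q n ord0 @[n --> \oo] --> (1 : R))
  (q_lim : forall i : 'I_m.+1, (0 < i)%N ->
     exists l : \bar R, (0 < l)%E /\ (n%:R * q n i)%:E @[n --> \oo] --> l)
  (* assumption 4 *)
  (A_posdef : forall n, (0 < n)%N -> posdefmx (A n))
  (A_bounded : exists K : R, forall n, (0 < n)%N -> spectral_norm (A n) <= K) :
  let S n w := let X := sv_matrix (sigma n) Z (p n) n w in X *m X^T in
  cvg_in_probability P
    (fun n w => b n ^- 2 *
       \big[Num.max/0]_(i < p n)
          `|lambda (sqrtmx (A n) *m S n w *m sqrtmx (A n)) i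
            - lambda (diagpart (S n w) *m A n) i|) 0.
Proof.
have a0 : 0 < alpha by case: alpha_range => /andP[a1 a2]; lra.
pose H x := fine (P [set w | (x < `|Z (0, 0)%N w|)%R]).
have H_nincr x y : x <= y -> H y <= H x by exact: abs_tail_nonincr.
have H_ge0 x : 0 <= H x by exact: fine_ge0.
have HL : H x / (L x * x `^ (- alpha)) @[x --> +oo] --> (1 : R).
  rewrite -qp_qm.
  exact: (abs_tail_cvg (g := fun x => L x * x `^ (- alpha)) Z_right_tail Z_left_tail).
have Z_mom g : 0 < g -> g < alpha -> (\int[P]_w (`|Z (0, 0)%N w| `^ g)%:E < +oo)%E.
  move=> g0 ga.
  have [|x0 [x00 hx]] := tail_dyadic_upper H_nincr H_ge0 L_slow HL (gamma := (g + alpha) / 2).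
    by lra.
  by apply: (abs_moment_lty g0 _ x00 hx); lra.
pose Q n := \sum_(i | i != ord0) q n i.
have s0 n : (0 < n)%N -> forall e w, 0 <= sigma n e w by move=> ? ? ?; exact: sigma_ge0.
have q_ge0 n i : (0 < n)%N -> 0 <= q n i by move=> n0; exact: (law_ge0 (sigma_law n n0)).
have Q_le1 n : (0 < n)%N -> 0 <= Q n <= 1.
  move=> n0; rewrite sumr_ge0 => [|i _]; last exact: q_ge0.
  have := q_sum n n0; rewrite (bigD1 ord0) //= -/(Q n) => <-.
  by rewrite lerDr q_ge0.
pose X n := thinned (sigma n) Z.
have X_indep n : (0 < n)%N -> mutually_independent (X n).
  move=> n0; exact: (thinned_mutually_independent Z_iid (sigma_iid n n0)
    (sigma_Z_indep n n0) s_incr (sigma_law n n0) (q_sum n n0)).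
have X_ident n : (0 < n)%N -> forall e (B : set R), measurable B ->
    P (X n e @^-1` B) = P (X n (0, 0)%N @^-1` B).
  move=> n0; exact: (thinned_ident Z_iid (sigma_iid n n0)
    (sigma_Z_indep n n0) s_incr (sigma_law n n0) (q_sum n n0)).
have X_mom g : 0 < g < alpha -> exists C : R, 0 <= C /\
    forall n, (0 < n)%N -> forall e, (\int[P]_w (`|X n e w| `^ g)%:E <= (C * Q n)%:E)%E.
  move=> /andP[g0 ga].
  exists (s ord_max `^ g * fine (\int[P]_w (`|Z (0, 0)%N w| `^ g)%:E)); split.
    by rewrite mulr_ge0 ?powR_ge0 // fine_ge0 // integral_ge0 // => w _; rewrite lee_fin powR_ge0.
  move=> n n0 e; exact: (thinned_moment_le Z_iid (sigma_iid n n0)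
    (sigma_Z_indep n n0) s_0 s_incr (sigma_law n n0) (q_sum n n0) e g0 (Z_mom g g0 ga)).
have X_mean : 1 < alpha -> forall n, (0 < n)%N -> forall e,
    P.-integrable setT (EFin \o X n e) /\ \int[P]_w X n e w = 0.
  move=> a1.
  have absZ : (\int[P]_w (`|Z (0, 0)%N w|)%:E < +oo)%E.
    by have := Z_mom 1 ltr01 a1; under eq_integral do rewrite powRr1 //.
  have iZ : P.-integrable setT (EFin \o Z (0, 0)%N).
    by apply/integrableP; split=> //; exact/measurable_EFinP.
  have Z0 : \int[P]_w Z (0, 0)%N w = 0.
    have := Z_centered; rewrite unlock => /(_ absZ) Z0.
    by rewrite /Rintegral Z0.
  move=> n n0 e; exact: (thinned_mean0 Z_iid (sigma_iid n n0) (s0 n n0)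
    (sigma_Z_indep n n0) s_incr (sigma_law n n0) (q_sum n n0) e iZ Z0).
(* The smallest non-zero level bounds E sigma^alpha from below by s_1^alpha Q,
   which brings Q into the normalization of b. *)
pose i1 : 'I_m.+1 := inord 1.
have i1E : i1 = 1%N :> nat by rewrite inordK // ltnS.
have i1_neq0 : i1 != ord0 by rewrite -(inj_eq val_inj) /= i1E.
have s1_gt0 : 0 < s i1 by rewrite -s_0; apply: s_incr; rewrite i1E.
have s1_le i : i != ord0 -> s i1 <= s i.
  move=> i0; have [->//|ii1] := eqVneq i i1; apply/ltW/s_incr.
  by rewrite i1E ltn_neqAle eq_sym -{1}i1E (inj_eq val_inj) ii1 lt0n.
have [c1 [c10 nQ]] : exists c1 : R, 0 < c1 /\ \forall n \near \oo, c1 <= n%:R * Q n.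
  have [|l [l0 /(cvge_gt0_near l0)[c1 [c10 c1q]]]] := q_lim i1; first by rewrite i1E.
  exists c1; split=> //; near=> n.
  have n0 : (0 < n)%N by near: n; exact: nbhs_infty_gt.
  apply: (@le_trans _ _ (n%:R * q n i1)); first by near: n.
  rewrite ler_wpM2l // /Q (bigD1 i1) //= lerDl sumr_ge0 // => i _; exact: q_ge0.
have b_norm' : \forall n \near \oo,
    s i1 `^ alpha * (n%:R * (p n)%:R * Q n) * H (b n) <= 2.
  move: b_norm => /fine_cvgP[_ /cvgr_lt/(_ 2)]; rewrite ltr1n => /(_ isT).
  move=> bn; near=> n.
  have n0 : (0 < n)%N by near: n; exact: nbhs_infty_gt.
  have : (fine ((n%:R * (p n)%:R)%:E * 'E_P[fun w => (sigma n (0, 0)%N w `^ alpha)%R]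
              * P [set w | (b n < `|Z (0, 0)%N w|)%R]) < 2)%R by near: n.
  rewrite unlock (integral_sg (sigma_iid n n0) s_incr (sigma_law n n0) (q_sum n n0)
    (0, 0)%N (measurable_powR alpha) (fun x => powR_ge0 x alpha)).
  have mZ : measurable [set w | b n < `|Z (0, 0)%N w|].
    by apply: measurable_set_lt => //; exact: measurableT_comp.
  rewrite -EFinM fineM ?fin_num_measure //= -/(H (b n)) => /ltW; apply: le_trans.
  rewrite ler_wpM2r // mulrCA ler_wpM2l // /Q mulr_sumr.
  rewrite [leRHS](bigD1 ord0) //= -[leLHS]add0r lerD //.
    by rewrite mulr_ge0 ?powR_ge0 ?q_ge0.
  apply: ler_sum => i i0; rewrite ler_wpM2r ?q_ge0 //.
  by apply: ge0_ler_powR; rewrite ?nnegrE ?(ltW a0) ?(ltW s1_gt0) ?s1_le // (le_trans (ltW s1_gt0)) ?s1_le.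
have c00 : 0 < s i1 `^ alpha by exact: powR_gt0.
have Q01 : \forall n \near \oo, 0 <= Q n <= 1.
  by near=> n; apply: Q_le1; near: n; exact: nbhs_infty_gt.
have beta1 : beta <= 1 by case/andP: beta_range.
have b_inf := normalizer_infty H_nincr H_ge0 HL c00 c10 b_norm' nQ p_infty.
have N_k := nonzero_entries_le H_nincr H_ge0 L_slow HL a0 c00 c10 b_norm' Q01 nQ p_infty.
have pQ_k := row_density_sqr_le H_nincr H_ge0 L_slow HL a0 c00 c10 b_norm' Q01 nQ p_infty
  beta1 ell_slow p_form.
have p_k := rows_le H_nincr H_ge0 L_slow HL a0 c00 c10 b_norm' Q01 nQ p_infty.
have p_gt0 : \forall n \near \oo, (0 < p n)%N by move/cvgnyPgt: p_infty; exact.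
have [K0 A_K0] := A_bounded; pose K := Num.max 1 K0.
have K_gt0 : 0 < K by rewrite lt_max ltr01.
have A_K n : (0 < n)%N -> spectral_norm (A n) <= K.
  by move=> n0; rewrite le_max A_K0 ?orbT.
move=> S e e0; pose gap n w := \big[Num.max/0]_(i < p n)
  `|lambda (sqrtmx (A n) *m S n w *m sqrtmx (A n)) i - lambda (diagpart (S n w) *m A n) i|.
(* The event is compared with an exceptional set by monotonicity of P, which
   requires both to be measurable. *)
have mE n : (0 < n)%N -> measurable [set w | e < `|b n ^- 2 * gap n w - 0|].
  move=> n0; apply: measurable_set_lt => //; apply: measurableT_comp => //.
  under eq_fun do rewrite subr0.
  by apply: measurable_funM => //; exact: measurable_gap (A_posdef n n0).
have eK : 0 < e / K by exact: divr_gt0.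
apply/fine_cvgP; split.
  by near=> n; apply: fin_num_measure; apply: mE; near: n; exact: nbhs_infty_gt.
apply/cvgrPdist_le => eta eta0.
have small : \forall n \near \oo, offdiag_mostly_small X p b (e / K) eta n.
  case: alpha_range => /andP[a1 a2].
    exact: (offdiag_small_light X_indep X_mom X_mean Q01 b_inf N_k pQ_k eK eta0 a0 a2).
  exact: (offdiag_small_heavy X_indep X_ident X_mom X_mean Q01 b_inf N_k pQ_k p_k p_gt0
    eK eta0 a1 a2).
near=> n.
have n0 : (0 < n)%N by near: n; exact: nbhs_infty_gt.
have [B [mB PB qB]] : offdiag_mostly_small X p b (e / K) eta n by near: n.
have b0 := b_gt0 n n0.
rewrite sub0r normrN /= ger0_norm ?fine_ge0 //.
rewrite -lee_fin fineK; last exact: fin_num_measure (mE n n0).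
apply: le_trans PB; apply: le_measure; rewrite ?inE //; first exact: mE.
move=> w; apply: contraPP => /qB off_w.
have /andP[g0 gK] : 0 <= gap n w <= e / K * b n ^+ 2 * K.
  apply: (gap_le (A_posdef n n0) (A_K n n0)) off_w; first exact: ltW.
  by rewrite mulr_ge0 ?(ltW eK) // exprn_ge0 // ltW.
apply/negP; rewrite -leNgt subr0 ger0_norm; last first.
  by rewrite mulr_ge0 // invr_ge0 exprn_ge0 // ltW.
rewrite mulrC ler_pdivrMr ?exprn_gt0 //; apply: le_trans gK _.
by rewrite mulrAC divfK ?gt_eqF.
Unshelve. all: by end_near. Qed.
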